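(* Let $\Bbbk$ be a complete field of characteristic $\neq2$. The category $\mathsf{SMFD}$ of super-manifolds over $\Bbbk$ has finite products.
   Context: A complete field is a field complete with respect to a non-trivial absolute value. Super-algebras are $\mathbb Z_2$-graded algebras, super-commutative ($A_0$ central, $ab=-ba$ for odd $a,b$). A manifold is an analytic manifold over $\Bbbk$ in the sense of Serre (Lie Algebras and Lie Groups, Part II, Ch. III), not necessarily Hausdorff, second countable or of constant dimension; $\mathcal F_X$ is its sheaf of analytic functions. A super-ringed space is a pair $X=(|X|,\mathcal O_X)$ of a topological space and a sheaf of super-algebras; a morphism $\phi=(|\phi|,\phi^* ):X\to Y$ is a continuous map $|\phi|:|X|\to|Y|$ with a sheaf-morphism $\phi^*:\mathcal O_Y\to|\phi|_*\mathcal O_X$ of super-algebras. A super-manifold is a super-ringed space that is locally isomorphic to super-ringed spaces of the form $(|X|,\mathcal F_X\otimes\wedge(W))$, with sections $\mathcal F_X(U)\otimes\wedge(W)$ over $U$, where $X$ is a manifold and $W$ a finite-dimensional (purely odd) vector space. $\mathsf{SMFD}$ is the full subcategory of the category of super-ringed spaces consisting of all super-manifolds. *)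

(* Defs.v *)
From HB Require Import structures.
From mathcomp Require Import all_boot all_order all_algebra finmap.
From mathcomp Require Import all_classical reals topology ring lra.

Set Implicit Arguments.
Unset Strict Implicit.
Unset Printing Implicit Defensive.

Import Order.TTheory GRing.Theory Num.Theory.
Local Open Scope ring_scope.

(* [exterior q A] is [A (x) wedge(W)] for the vector space [W = k^q] with basis
   [e_0, ..., e_{q-1}]: the family [f] stands for the sum of the [f I (x) e_I],
   where [e_I] is the product of the [e_i], [i \in I], in increasing order.
   Thus [e_I * e_J] is [0] unless [I] and [J] are disjoint, and otherwise
   [(-1)^(inversions I J) * e_(I :|: J)]. *)

Definition inversions (q : nat) (I J : {set 'I_q}) : nat :=
  (\sum_(i in I) \sum_(j in J) (j < i))%N.

Definition exterior (q : nat) (A : comPzRingType) := {ffun {set 'I_q} -> A}.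

HB.instance Definition _ q A := GRing.Zmodule.on (exterior q A).

Section Inversions.
Variable q : nat.
Implicit Types I J K L : {set 'I_q}.

Lemma inversions0l J : inversions finset.set0 J = 0%N.
Proof. by rewrite /inversions big_set0. Qed.

Lemma inversions0r I : inversions I finset.set0 = 0%N.
Proof. by rewrite /inversions big1 // => i _; rewrite big_set0. Qed.

Lemma inversionsDl I L J : I \subset L ->
  inversions L J = (inversions I J + inversions (L :\: I) J)%N.
Proof.
by move=> IL; rewrite {1}/inversions (big_setID I) /= (finset.setIidPr IL).
Qed.

Lemma inversionsDr I J L : J \subset L ->
  inversions I L = (inversions I J + inversions I (L :\: J))%N.
Proof.
move=> JL; rewrite /inversions -big_split /=; apply: eq_bigr => i _.
by rewrite (big_setID J) /= (finset.setIidPr JL).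
Qed.

Lemma inversionsC I J : [disjoint I & J] ->
  (inversions I J + inversions J I = #|I| * #|J|)%N.
Proof.
move=> dIJ; rewrite /inversions [X in (_ + X)%N]exchange_big /= -big_split /=.
rewrite -sum_nat_const; apply: eq_bigr => i iI; rewrite -big_split /= -sum1_card.
apply: eq_bigr => j jJ; have : (i : nat) <> j.
  by move=> /val_inj ij; have := disjointFr dIJ iI; rewrite ij jJ.
by case: (ltngtP i j) => [||->].
Qed.

End Inversions.

Section Exterior.
Variables (q : nat) (A : comPzRingType).
Local Notation E := (exterior q A).
Implicit Types (f g h : E) (I J K L : {set 'I_q}).

Definition ext_mul f g : E :=
  [ffun K : {set 'I_q} => \sum_(I : {set 'I_q} | I \subset K)
     (-1) ^+ inversions I (K :\: I) * (f I * g (K :\: I))].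

Definition ext_cst (c : A) : E :=
  [ffun I : {set 'I_q} => if I == finset.set0 then c else 0].

Lemma ext_mulE f g K : ext_mul f g K = \sum_(I : {set 'I_q} | I \subset K)
     (-1) ^+ inversions I (K :\: I) * (f I * g (K :\: I)).
Proof. by rewrite ffunE. Qed.

Lemma ext_mulDl : left_distributive ext_mul +%R.
Proof.
move=> f g h; apply/ffunP => K; rewrite [RHS]ffunE !ext_mulE -big_split /=.
by apply: eq_bigr => I _; rewrite !ffunE /= mulrDl mulrDr.
Qed.

Lemma ext_mulDr : right_distributive ext_mul +%R.
Proof.
move=> f g h; apply/ffunP => K; rewrite [RHS]ffunE !ext_mulE -big_split /=.
by apply: eq_bigr => I _; rewrite !ffunE /= mulrDr mulrDr.
Qed.

Lemma ext_cst_mulE c f K : ext_mul (ext_cst c) f K = c * f K.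
Proof.
rewrite ext_mulE (bigD1 finset.set0) ?finset.sub0set //= big1 => [|I /andP[_ /negPf I0]].
  by rewrite ffunE eqxx finset.setD0 inversions0l mul1r addr0.
by rewrite ffunE I0 mul0r mulr0.
Qed.

Lemma ext_mul_cstE c f K : ext_mul f (ext_cst c) K = f K * c.
Proof.
rewrite ext_mulE (bigD1 K) //= big1 => [|I /andP[IK IneK]].
  by rewrite ffunE finset.setDv eqxx inversions0r mul1r addr0.
rewrite ffunE finset.setD_eq0; case: ifP => [KI|_]; last by rewrite !mulr0.
by rewrite finset.eqEsubset IK KI in IneK.
Qed.

Lemma ext_mul1 : left_id (ext_cst 1) ext_mul.
Proof. by move=> f; apply/ffunP => K; rewrite ext_cst_mulE mul1r. Qed.

Lemma ext_mulr1 : right_id (ext_cst 1) ext_mul.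
Proof. by move=> f; apply/ffunP => K; rewrite ext_mul_cstE mulr1. Qed.

Lemma ext_mulA : associative ext_mul.
Proof.
move=> f g h; apply/ffunP => K; rewrite !ext_mulE.
under [RHS]eq_bigr => L LK.
  rewrite ext_mulE mulr_suml mulr_sumr; over.
rewrite [RHS](exchange_big_dep (fun I => I \subset K)) /=; last first.
  by move=> L I LK IL; exact: fintype.subset_trans IL LK.
apply: eq_bigr => I IK; rewrite ext_mulE mulr_sumr mulr_sumr.
rewrite [RHS](reindex_onto (fun J => I :|: J) (fun L => L :\: I)) /=; last first.
  by move=> L /andP[_ IL]; rewrite finset.setDE finset.setUIr finset.setUCr
    finset.setIT; apply/finset.setUidPr.
apply: eq_big => [J|J JKI].
  rewrite finset.subUset IK finset.subsetUl andbT /= finset.setDUl finset.setDv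
    finset.set0U subsetD; congr (_ && _).
  by apply/idP/eqP => /finset.setDidPl.
have JdI : [disjoint J & I] by move: JKI; rewrite subsetD => /andP[].
have -> : (I :|: J) :\: I = J.
  by rewrite finset.setDUl finset.setDv finset.set0U; apply/finset.setDidPl.
have -> : K :\: (I :|: J) = (K :\: I) :\: J by rewrite finset.setDDl.
set M := (K :\: I) :\: J.
have sgn : (inversions I (K :\: I) + inversions J M =
            inversions (I :|: J) M + inversions I J)%N.
  rewrite (inversionsDr I JKI) (inversionsDl M (finset.subsetUl I J)).
  rewrite finset.setDUl finset.setDv finset.set0U.
  have -> : J :\: I = J by apply/finset.setDidPl.
  by rewrite -/M -addnA addnC.
by rewrite (mulrCA (f I)) [LHS]mulrA -exprD sgn exprD !mulrA.
Qed.

HB.instance Definition _ := GRing.Zmodule_isPzRing.Build E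
  ext_mulA ext_mul1 ext_mulr1 ext_mulDl ext_mulDr.

Lemma ext_cst_zmod_morphism : zmod_morphism ext_cst.
Proof.
move=> c d; apply/ffunP => I; rewrite !ffunE /=; case: eqP => // _.
by rewrite subr0.
Qed.

Lemma ext_cst_monoid_morphism : monoid_morphism ext_cst.
Proof.
split=> // c d; apply/ffunP => I.
by rewrite [RHS]ext_cst_mulE !ffunE; case: eqP; rewrite ?mulr0.
Qed.

HB.instance Definition _ :=
  GRing.isZmodMorphism.Build A E ext_cst ext_cst_zmod_morphism.
HB.instance Definition _ :=
  GRing.isMonoidMorphism.Build A E ext_cst ext_cst_monoid_morphism.

(* The elements of parity [i]: [false] for even, [true] for odd. *)
Definition ext_part (i : bool) (f : E) : Prop :=
  forall I : {set 'I_q}, odd #|I| != i -> f I = 0.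

Lemma ext_sgnC I J : [disjoint I & J] ->
  (-1) ^+ inversions I J =
  (-1) ^+ (odd #|I| && odd #|J|) * (-1) ^+ inversions J I :> A.
Proof.
move=> dIJ; rewrite -oddM signr_odd -(inversionsC dIJ) exprD -mulrA -exprD.
by rewrite addnn -mul2n exprM sqrrN !expr1n mulr1.
Qed.

Lemma ext_mulC f g K : (f * g) K = \sum_(I : {set 'I_q} | I \subset K)
  (-1) ^+ inversions (K :\: I) I * (f (K :\: I) * g I).
Proof.
rewrite [LHS]ext_mulE (reindex_onto (fun I => K :\: I) (fun I => K :\: I)) /=.
  apply: eq_big => [I|I IK].
    rewrite finset.subDset finset.subsetUr /= finset.setDDr finset.setDv
      finset.set0U; apply/eqP/idP => [<-|/finset.setIidPr//].
    exact: finset.subsetIl.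
  by congr (_ ^+ inversions _ _ * (_ * g _)); case/andP: IK => _ /eqP.
by move=> I IK; rewrite finset.setDDr finset.setDv finset.set0U;
  apply/finset.setIidPr.
Qed.

End Exterior.

Local Open Scope classical_set_scope.

Record category := Category {
  Ob :> Type;
  Hom : Ob -> Ob -> Type;
  idm : forall X, Hom X X;
  comp : forall X Y Z, Hom Y Z -> Hom X Y -> Hom X Z;
  comp1m : forall X Y (f : Hom X Y), comp (idm Y) f = f;
  compm1 : forall X Y (f : Hom X Y), comp f (idm X) = f;
  compA : forall X Y Z T (h : Hom Z T) (g : Hom Y Z) (f : Hom X Y),
    comp h (comp g f) = comp (comp h g) f }.

Arguments Hom {c} X Y.
Arguments idm {c} X.
Arguments comp {c X Y Z} g f.

Definition isomorphic (C : category) (X Y : C) :=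
  exists (f : Hom X Y) (g : Hom Y X), comp g f = idm X /\ comp f g = idm Y.

Definition full_subcategory (C : category) (P : C -> Prop) : category :=
  @Category {X : C | P X} (fun X Y => Hom (sval X) (sval Y))
    (fun X => idm (sval X)) (fun X Y Z => @comp C (sval X) (sval Y) (sval Z))
    (fun X Y => @comp1m C (sval X) (sval Y))
    (fun X Y => @compm1 C (sval X) (sval Y))
    (fun X Y Z T => @compA C (sval X) (sval Y) (sval Z) (sval T)).

(* [I] may be empty, so this includes a terminal object. *)
Definition has_finite_products (C : category) :=
  forall (I : finType) (X : I -> C),
  exists (P : C) (p : forall i, Hom P (X i)),
  forall (Q : C) (f : forall i, Hom Q (X i)),
  exists! h : Hom Q P, forall i, comp (p i) h = f i.

(* The algebra types of the library exclude the zero ring, which is the ring of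
   sections over the empty set.  A super-algebra is therefore presented as a
   ring with a central structure morphism from [k]; [sa_part false] and
   [sa_part true] are the even and the odd part. *)
Record super_algebra (k : fieldType) := SuperAlgebra {
  sa_ring :> pzRingType;
  sa_alg : {rmorphism k -> sa_ring};
  sa_algC : forall c a, sa_alg c * a = a * sa_alg c;
  sa_part : bool -> set sa_ring;
  sa_part0 : forall i, sa_part i 0;
  sa_partD : forall i a b, sa_part i a -> sa_part i b -> sa_part i (a + b);
  sa_partZ : forall i c a, sa_part i a -> sa_part i (sa_alg c * a);
  sa_part_span : forall a, exists a0 a1,
    [/\ sa_part false a0, sa_part true a1 & a = a0 + a1];
  sa_part_direct : forall a, sa_part false a -> sa_part true a -> a = 0;
  sa_part1 : sa_part false 1;
  sa_partM : forall i j a b,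
    sa_part i a -> sa_part j b -> sa_part (i (+) j) (a * b);
  sa_even_central : forall a b, sa_part false a -> a * b = b * a;
  sa_odd_anticomm : forall a b,
    sa_part true a -> sa_part true b -> a * b = - (b * a) }.

Arguments sa_alg {k} s.
Arguments sa_part {k} s i.

Record sa_hom (k : fieldType) (A B : super_algebra k) := SaHom {
  sa_fun :> {rmorphism A -> B};
  sa_fun_alg : forall c, sa_fun (sa_alg A c) = sa_alg B c;
  sa_fun_part : forall i a, sa_part A i a -> sa_part B i (sa_fun a) }.

Lemma rmorph_ext (A B : pzRingType) (f g : {rmorphism A -> B}) :
  f =1 g -> f = g.
Proof.
case: f => f [[f1] [f2]]; case: g => g [[g1] [g2]] /= fg.
have {fg} efg : f = g by apply: funext.
case: _ / efg g1 g2 => g1 g2.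
by rewrite (Prop_irrelevance f1 g1) (Prop_irrelevance f2 g2).
Qed.

Lemma sa_hom_ext (k : fieldType) (A B : super_algebra k) (f g : sa_hom A B) :
  f =1 g -> f = g.
Proof.
case: f => f f1 f2; case: g => g g1 g2 /= /rmorph_ext efg.
case: _ / efg g1 g2 => g1 g2.
by rewrite (Prop_irrelevance f1 g1) (Prop_irrelevance f2 g2).
Qed.

Program Definition sa_id (k : fieldType) (A : super_algebra k) : sa_hom A A :=
  @SaHom k A A (GRing.RMorphism.clone _ _ idfun _) _ _.
Next Obligation. by []. Qed.
Next Obligation. by []. Qed.

Program Definition sa_comp (k : fieldType) (A B C : super_algebra k)
  (g : sa_hom B C) (f : sa_hom A B) : sa_hom A C :=
  @SaHom k A C (GRing.RMorphism.clone _ _ (g \o f) _) _ _.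
Next Obligation. by move=> k A B C g f c /=; rewrite !sa_fun_alg. Qed.
Next Obligation. by move=> k A B C g f i a Aa /=; do 2! apply: sa_fun_part. Qed.

Record opens (X : topologicalType) := Opens {
  oset :> set X;
  oset_open : open oset }.

Lemma opens_ext (X : topologicalType) (U V : opens X) :
  (U : set X) = V -> U = V.
Proof.
case: U => U oU; case: V => V oV /= eUV.
by case: _ / eUV oV => oV; rewrite (Prop_irrelevance oU oV).
Qed.

Record sa_sheaf (k : fieldType) (X : topologicalType) := SaSheaf {
  sections :> opens X -> super_algebra k;
  restr : forall U V : opens X, V `<=` U -> sa_hom (sections U) (sections V);
  restr_id : forall (U : opens X) (h : U `<=` U) s, restr h s = s;
  restr_comp : forall (U V W : opens X)
    (hV : V `<=` U) (hW : W `<=` V) (hWU : W `<=` U) s,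
    restr hW (restr hV s) = restr hWU s;
  sheaf_sep : forall (U : opens X) (I : Type) (C : I -> opens X)
    (hC : forall i, C i `<=` U), U `<=` \bigcup_i C i ->
    forall s t : sections U,
    (forall i, restr (hC i) s = restr (hC i) t) -> s = t;
  sheaf_glue : forall (U : opens X) (I : Type) (C : I -> opens X)
    (hC : forall i, C i `<=` U), U `<=` \bigcup_i C i ->
    forall s : forall i, sections (C i),
    (forall i j (W : opens X) (hi : W `<=` C i) (hj : W `<=` C j),
       restr hi (s i) = restr hj (s j)) ->
    exists t : sections U, forall i, restr (hC i) t = s i }.

Arguments restr {k X} F {U V} hVU : rename.

Lemma restr_trans (k : fieldType) (X : topologicalType) (F : sa_sheaf k X)
  (U V W : opens X) (hV : V `<=` U) (hW : W `<=` V) s :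
  restr F hW (restr F hV s) = restr F (subset_trans hW hV) s.
Proof. exact: restr_comp. Qed.

Lemma restr_irr (k : fieldType) (X : topologicalType) (F : sa_sheaf k X)
  (U V : opens X) (h h' : V `<=` U) s : restr F h s = restr F h' s.
Proof. by rewrite (Prop_irrelevance h h'). Qed.

Record super_ringed_space (k : fieldType) := SuperRingedSpace {
  carrier :> topologicalType;
  structure_sheaf : sa_sheaf k carrier }.

Arguments structure_sheaf {k} s.
Notation "''O_' X" := (structure_sheaf X)
  (at level 8, X at level 2, format "''O_' X") : type_scope.

Definition preim_opens (X Y : topologicalType) (f : X -> Y)
  (cf : continuous f) (V : opens Y) : opens X :=
  Opens (proj1 (continuousP f) cf V (oset_open V)).

Lemma preim_opensS (X Y : topologicalType) (f : X -> Y) (cf : continuous f)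
  (U V : opens Y) : V `<=` U -> preim_opens cf V `<=` preim_opens cf U.
Proof. by move=> VU x /VU. Qed.

Record srs_hom (k : fieldType) (X Y : super_ringed_space k) := SrsHom {
  srs_map :> X -> Y;
  srs_map_continuous : continuous srs_map;
  pullback : forall V : opens Y,
    sa_hom ('O_Y V) ('O_X (preim_opens srs_map_continuous V));
  pullback_restr : forall (U V : opens Y) (h : V `<=` U) (s : 'O_Y U),
    pullback V (restr 'O_Y h s) =
    restr 'O_X (preim_opensS (cf := srs_map_continuous) h) (pullback U s) }.

Arguments srs_map_continuous {k X Y} f : rename.
Arguments pullback {k X Y} f V : rename.

Lemma srs_hom_ext (k : fieldType) (X Y : super_ringed_space k)
  (f g : srs_hom X Y) :
  f =1 g ->
  (forall (V : opens Y) (U : opens X)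
     (hf : U `<=` preim_opens (srs_map_continuous f) V)
     (hg : U `<=` preim_opens (srs_map_continuous g) V) s,
     restr 'O_X hf (pullback f V s) = restr 'O_X hg (pullback g V s)) ->
  f = g.
Proof.
case: f => f cf pf nf; case: g => g cg pg ng /= fg.
have {fg} efg : f = g by apply: funext.
case: _ / efg cg pg ng => cg.
rewrite -(Prop_irrelevance cf cg) => pg ng pfg.
have epg : pf = pg.
  apply: functional_extensionality_dep => V; apply: sa_hom_ext => s.
  have := pfg V (preim_opens cf V) (fun _ h => h) (fun _ h => h) s.
  by rewrite !restr_id.
by case: _ / epg ng pfg => ng _; rewrite (Prop_irrelevance nf ng).
Qed.

Lemma continuous_id (X : topologicalType) : continuous (@idfun X).
Proof. by move=> x; apply: cvg_id. Qed.

Program Definition srs_id (k : fieldType) (X : super_ringed_space k) :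
  srs_hom X X :=
  @SrsHom k X X idfun (@continuous_id X)
    (fun V => @restr _ _ 'O_X V (preim_opens (@continuous_id X) V)
                (fun _ h => h)) _.
Next Obligation.
move=> k X U V h s /=.
by rewrite !restr_trans; apply: restr_irr.
Qed.

Section SrsComp.
Variables (k : fieldType) (X Y Z : super_ringed_space k).
Variables (g : srs_hom Y Z) (f : srs_hom X Y).

Lemma srs_comp_continuous : continuous (g \o f).
Proof.
by move=> x; apply: continuous_comp; apply: srs_map_continuous.
Qed.

(* The restriction is along an equality of open sets. *)
Definition srs_comp_pullback (V : opens Z) :
    sa_hom ('O_Z V) ('O_X (preim_opens srs_comp_continuous V)) :=
  sa_comp
    (@restr _ _ 'O_X (preim_opens (srs_map_continuous f)
                        (preim_opens (srs_map_continuous g) V))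
       (preim_opens srs_comp_continuous V) (fun _ h => h))
    (sa_comp (pullback f (preim_opens (srs_map_continuous g) V))
             (pullback g V)).

Program Definition srs_comp : srs_hom X Z :=
  @SrsHom k X Z (g \o f) srs_comp_continuous srs_comp_pullback _.
Next Obligation.
by move=> U V h s /=; rewrite !pullback_restr !restr_trans; apply: restr_irr.
Qed.

End SrsComp.

Section SrsCategory.
Variable k : fieldType.

Program Definition SRS : category :=
  @Category (super_ringed_space k) (@srs_hom k) (@srs_id k) (@srs_comp k) _ _ _.
Next Obligation.
move=> X Y f; apply: srs_hom_ext => //= V U hf hg s.
by rewrite pullback_restr !restr_trans; apply: restr_irr.
Qed.
Next Obligation.
move=> X Y f; apply: srs_hom_ext => //= V U hf hg s.
by rewrite !restr_trans; apply: restr_irr.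
Qed.
Next Obligation.
move=> X Y Z T h g f; apply: srs_hom_ext => //= V U h1 h2 s.
by rewrite pullback_restr !restr_trans; apply: restr_irr.
Qed.

End SrsCategory.

Section OpenSubspace.
Variables (k : fieldType) (X : super_ringed_space k) (U : opens X).

Lemma image_open (V : opens (set_type U)) :
  open ([set set_val x | x in V] : set X).
Proof.
have [W oW eV] := oset_open V.
suff -> : [set set_val x | x in V] = W `&` U.
  by apply: openI => //; apply: oset_open.
rewrite -eV; apply/seteqP; split=> [_ [x Wx <-]|x [Wx Ux]].
  by split => //; apply: set_valP.
by exists (exist _ x (mem_set Ux)).
Qed.

Definition image_opens (V : opens (set_type U)) : opens X :=
  Opens (image_open V).

Lemma image_opensS (V W : opens (set_type U)) :
  W `<=` V -> image_opens W `<=` image_opens V.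
Proof. exact: image_subset. Qed.

Program Definition restr_sheaf : sa_sheaf k (set_type U) :=
  @SaSheaf k _ (fun V => 'O_X (image_opens V))
    (fun V W hWV => restr 'O_X (image_opensS hWV)) _ _ _ _.
Next Obligation. by move=> V h s; apply: restr_id. Qed.
Next Obligation. by move=> V1 V2 V3 h1 h2 h3 s /=; apply: restr_comp. Qed.
Next Obligation.
move=> V I C hC cov s t st.
refine (@sheaf_sep k X 'O_X (image_opens V) I (fun i => image_opens (C i))
  (fun i => image_opensS (hC i)) _ s t st).
by move=> _ [x /cov[i _ Cx] <-]; exists i => //; exists x.
Qed.
Next Obligation.
move=> V I C hC cov s compat.
refine (@sheaf_glue k X 'O_X (image_opens V) I (fun i => image_opens (C i))
  (fun i => image_opensS (hC i)) _ s _).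
  by move=> _ [x /cov[i _ Cx] <-]; exists i => //; exists x.
move=> i j W hi hj.
have oW' : open (set_val @^-1` W : set (set_type U)).
  by exists W => //; apply: oset_open.
pose W' := Opens oW'.
have hiW : W' `<=` C i.
  by move=> x /= /hi [y Cy] /val_inj <-.
have hjW : W' `<=` C j.
  by move=> x /= /hj [y Cy] /val_inj <-.
have hW : W `<=` image_opens W'.
  by move=> x Wx; have [y _ exy] := hi _ Wx; exists y => //=; rewrite /= exy.
have := compat i j W' hiW hjW => /(congr1 (restr 'O_X hW)).
by rewrite !restr_comp.
Qed.

Definition open_subspace : super_ringed_space k := SuperRingedSpace restr_sheaf.

End OpenSubspace.

Record complete_field (R : realType) := CompleteField {
  cf_field :> fieldType;
  cf_abs : cf_field -> R;
  cf_abs_ge0 : forall x, 0 <= cf_abs x;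
  cf_abs_eq0 : forall x, (cf_abs x == 0) = (x == 0);
  cf_absM : forall x y, cf_abs (x * y) = cf_abs x * cf_abs y;
  cf_absD : forall x y, cf_abs (x + y) <= cf_abs x + cf_abs y;
  cf_abs_nontrivial : exists x, x != 0 /\ cf_abs x != 1;
  cf_complete : forall u : nat -> cf_field,
    (forall e, 0 < e -> exists N, forall m n, (N <= m)%N -> (N <= n)%N ->
       cf_abs (u m - u n) < e) ->
    exists l, forall e, 0 < e -> exists N, forall n, (N <= n)%N ->
       cf_abs (u n - l) < e }.

Section Analytic.
Variables (R : realType) (k : complete_field R).
Local Notation abs := (@cf_abs R k).

Definition sums_to (T : choiceType) (u : T -> k) (l : k) :=
  forall e, 0 < e -> exists F0 : {fset T}, forall F : {fset T},
    (F0 `<=` F)%fset -> abs (\sum_(t <- F) u t - l) < e.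

Definition abs_summable (T : choiceType) (u : T -> R) :=
  exists M, forall F : {fset T}, \sum_(t <- F) u t <= M.

Lemma cf_abs0 : abs 0 = 0.
Proof. by apply/eqP; rewrite cf_abs_eq0. Qed.

Lemma cf_abs1 : abs 1 = 1.
Proof.
have n1 : abs 1 != 0 by rewrite cf_abs_eq0 oner_eq0.
by apply: (mulfI n1); rewrite -cf_absM !mulr1.
Qed.

Lemma cf_absN x : abs (- x) = abs x.
Proof.
have sq : abs (-1) ^+ 2 = 1 by rewrite expr2 -cf_absM mulrNN mulr1 cf_abs1.
have h : abs (-1) = 1.
  by apply/eqP; rewrite -(eqrXn2 (n := 2)) ?cf_abs_ge0 // sq expr1n.
by rewrite -mulN1r cf_absM h mul1r.
Qed.

Lemma cf_absB x y : abs (x - y) = abs (y - x).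
Proof. by rewrite -cf_absN opprB. Qed.

Lemma cf_absX x n : abs (x ^+ n) = abs x ^+ n.
Proof. by elim: n => [|n IHn]; rewrite ?cf_abs1 // !exprS cf_absM IHn. Qed.

Lemma cf_abs_sum (T : Type) (r : seq T) (P : pred T) (u : T -> k) :
  abs (\sum_(t <- r | P t) u t) <= \sum_(t <- r | P t) abs (u t).
Proof.
elim/big_rec2: _ => [|t x y _ le]; first by rewrite cf_abs0.
by apply: le_trans (cf_absD _ _) _; rewrite lerD2l.
Qed.

Lemma cf_abs_prod (T : Type) (r : seq T) (P : pred T) (u : T -> k) :
  abs (\prod_(t <- r | P t) u t) = \prod_(t <- r | P t) abs (u t).
Proof.
by apply: (big_ind2 (fun x y => abs x = y)); rewrite ?cf_abs1 // => a b c d <- <-;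
  rewrite cf_absM.
Qed.

Lemma fset_sum_cond (T : choiceType) (V : nmodType) (w : T -> V)
  (F G : {fset T}) : (F `<=` G)%fset ->
  \sum_(t <- F) w t = \sum_(t <- G | t \in F) w t.
Proof.
move=> FG; rewrite [RHS]big_fset_condE; apply: eq_fbig => // t.
rewrite !inE /= andbC; case tF: (t \in F) => //=.
by rewrite (fsubsetP FG).
Qed.

Section Summable.
Variable T : choiceType.
Implicit Types (u v : T -> k) (F G : {fset T}).

Lemma fset_sum_le (w : T -> R) F G : (forall t, 0 <= w t) -> (F `<=` G)%fset ->
  \sum_(t <- F) w t <= \sum_(t <- G) w t.
Proof.
move=> w0 FG; rewrite (fset_sum_cond _ FG) [leRHS](bigID (mem F)) /=.
by rewrite lerDl sumr_ge0.
Qed.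

Lemma abs_summable_near (w : T -> R) : (forall t, 0 <= w t) ->
  abs_summable w ->
  exists2 S, 0 <= S & (forall F, \sum_(t <- F) w t <= S) /\
  (forall e, 0 < e -> exists F0, forall F, (F0 `<=` F)%fset ->
     S - e < \sum_(t <- F) w t).
Proof.
move=> w0 [M wM]; pose E := [set \sum_(t <- F) w t | F in [set: {fset T}]].
have hE : has_sup E.
  split; first by exists (\sum_(t <- fset0) w t); exists fset0.
  by exists M => _ [F _ <-].
have ub F : \sum_(t <- F) w t <= sup E.
  by apply: sup_upper_bound => //; exists F.
exists (sup E); first by apply: le_trans (ub fset0); rewrite sumr_ge0.
split=> // e e0; have [_ [F0 _ <-] lt] := sup_adherent e0 hE.
by exists F0 => F FF; apply: lt_le_trans lt _; apply: fset_sum_le.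
Qed.

Lemma sums_toD u v l m : sums_to u l -> sums_to v m ->
  sums_to (fun t => u t + v t) (l + m).
Proof.
move=> ul vm e e0; have e2 : 0 < e / 2 by rewrite divr_gt0.
have [F1 h1] := ul _ e2; have [F2 h2] := vm _ e2.
exists (F1 `|` F2)%fset => F; rewrite fsubUset => /andP[/h1 {}h1 /h2 {}h2].
rewrite big_split /= opprD addrACA (splitr e).
by apply: le_lt_trans (cf_absD _ _) _; apply: ltrD.
Qed.

Lemma sums_toN u l : sums_to u l -> sums_to (fun t => - u t) (- l).
Proof.
move=> ul e e0; have [F0 h] := ul _ e0; exists F0 => F /h {}h.
by rewrite sumrN -opprD cf_absN.
Qed.

Lemma sums_to1 (t0 : T) (u : T -> k) :
  (forall t, t != t0 -> u t = 0) -> sums_to u (u t0).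
Proof.
move=> u0 e e0; exists [fset t0]%fset => F; rewrite fsub1set => t0F.
rewrite (big_fsetD1 t0) //= big_seq_cond big1 ?addr0 ?subrr ?cf_abs0 //.
by move=> t /andP[]; rewrite !inE => /andP[/u0].
Qed.

Section CauchyProduct.
Variables (add : T -> T -> T) (dec : T -> {fset T * T}).
Hypothesis decP : forall t p, (p \in dec t) = (add p.1 p.2 == t).

Lemma cauchy_sum F :
  exists S : {fset T * T}, (forall p, (p \in S) = (add p.1 p.2 \in F)) /\
  forall (V : nmodType) (G : T * T -> V), \sum_(t <- F) \sum_(p <- dec t) G p = \sum_(p <- S) G p.
Proof.
pose S := (\bigcup_(t <- F) dec t)%fset.
have SP p : (p \in S) = (add p.1 p.2 \in F).
  apply/bigfcupP/idP => [[t /andP[tF _]]|pF].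
    by rewrite decP => /eqP ->.
  by exists (add p.1 p.2); rewrite ?pF ?decP.
exists S; split=> // V G.
rewrite [RHS](partition_big_imfset _ (fun p => add p.1 p.2)) /=.
have sub : ([fset add p.1 p.2 | p in S] `<=` F)%fset.
  by apply/fsubsetP => _ /imfsetP[p /= pS ->]; rewrite -SP.
rewrite (big_fset_incl _ sub) => [|t tF]; last first.
  move=> tn; rewrite big_seq_cond big1 // => p /andP[pS /eqP pt].
  by case/imfsetP: tn; exists p.
rewrite big_seq [RHS]big_seq; apply: eq_bigr => t tF.
rewrite [RHS]big_fset_condE; apply: eq_fbig => // p.
by rewrite !inE /= decP SP andbC; case: eqP => //= ->; rewrite tF.
Qed.

Lemma prod_sum (A : comPzRingType) (f g : T -> A) F G :
  (\sum_(t <- F) f t) * (\sum_(t <- G) g t) =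
  \sum_(p <- (F `*` G)%fset) f p.1 * g p.2.
Proof.
rewrite big_distrl /=; under eq_bigr do rewrite big_distrr /=.
by rewrite [RHS]big_imfset2 //= => -[? ?] [? ?] _ _ /= [-> ->].
Qed.

Lemma cauchy_bound (f g : T -> R) (A B : R) :
  (forall t, 0 <= f t) -> (forall t, 0 <= g t) ->
  (forall F, \sum_(t <- F) f t <= A) -> (forall F, \sum_(t <- F) g t <= B) ->
  forall F, \sum_(t <- F) \sum_(p <- dec t) f p.1 * g p.2 <= A * B.
Proof.
move=> f0 g0 fA gB F; have [S [_ ->]] := cauchy_sum F.
pose S1 := [fset p.1 | p in S]%fset; pose S2 := [fset p.2 | p in S]%fset.
apply: le_trans (_ : (\sum_(t <- S1) f t) * (\sum_(t <- S2) g t) <= _); last first.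
  by rewrite ler_pM // sumr_ge0.
rewrite prod_sum.
have sub : (S `<=` S1 `*` S2)%fset.
  by apply/fsubsetP => p pS; rewrite inE !in_imfset.
apply: (@le_trans _ _ (\sum_(p <- (S1 `*` S2)%fset | p \in S) f p.1 * g p.2)).
  rewrite le_eqVlt; apply/orP; left; apply/eqP.
  rewrite [RHS]big_fset_condE; apply: eq_fbig => // p.
  rewrite !inE /= andbC; case pS: (p \in S) => //=.
  by have /fsubsetP/(_ p pS) := sub; rewrite inE.
rewrite [leRHS](bigID (mem S)) /= lerDl sumr_ge0 // => p _.
by rewrite mulr_ge0.
Qed.

Lemma cauchy_sums_to u v l m :
  abs_summable (fun t => abs (u t)) -> abs_summable (fun t => abs (v t)) ->
  sums_to u l -> sums_to v m ->
  sums_to (fun t => \sum_(p <- dec t) u p.1 * v p.2) (l * m).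
Proof.
move=> /abs_summable_near [] => [t|SU SU0 [uS nearU]]; first exact: cf_abs_ge0.
move=> /abs_summable_near [] => [t|SV SV0 [vS nearV]]; first exact: cf_abs_ge0.
move=> ul vm e e0; pose D := SU + SV + SV + abs l + 1.
have l0 := cf_abs_ge0 l; have D0 : 0 < D by rewrite /D; lra.
pose d := e / D; have d0 : 0 < d by rewrite divr_gt0.
have dD : d * D = e by rewrite divfK // gt_eqF.
have [A1 hA1] := nearU _ d0; have [A2 hA2] := ul _ d0.
have [B1 hB1] := nearV _ d0; have [B2 hB2] := vm _ d0.
pose A := (A1 `|` A2)%fset; pose B := (B1 `|` B2)%fset.
have {hA1} nA := hA1 A (fsubsetUl _ _); have {hA2} lA := hA2 A (fsubsetUr _ _).
have {hB1} nB := hB1 B (fsubsetUl _ _); have {hB2} lB := hB2 B (fsubsetUr _ _).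
exists [fset add p.1 p.2 | p in (A `*` B)%fset]%fset => F FF.
have [S [SP sumS]] := cauchy_sum F.
have sub : (A `*` B `<=` S)%fset.
  apply/fsubsetP => p pAB; rewrite SP; apply: (fsubsetP FF).
  by apply/imfsetP; exists p.
have hatF := cauchy_bound (fun t => cf_abs_ge0 (u t)) (fun t => cf_abs_ge0 (v t))
  uS vS F.
rewrite sumS in hatF; rewrite {}sumS; set a := \sum_(t <- A) u t in lA.
set b := \sum_(t <- B) v t in lB.
have ab : a * b = \sum_(p <- S | p \in (A `*` B)%fset) u p.1 * v p.2.
  by rewrite prod_sum (fset_sum_cond _ sub).
have hatAB : (\sum_(t <- A) abs (u t)) * (\sum_(t <- B) abs (v t)) =
  \sum_(p <- S | p \in (A `*` B)%fset) abs (u p.1) * abs (v p.2).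
  by rewrite prod_sum (fset_sum_cond _ sub).
have diff : abs (\sum_(p <- S) u p.1 * v p.2 - a * b) <=
  SU * SV - (\sum_(t <- A) abs (u t)) * (\sum_(t <- B) abs (v t)).
  rewrite hatAB ab (bigID (mem (A `*` B)%fset)) /= addrAC subrr add0r.
  apply: le_trans (cf_abs_sum _ _ _) _.
  rewrite lerBrDr; apply: le_trans hatF; rewrite [leRHS](bigID (mem (A `*` B)%fset)) /=.
  by rewrite [leRHS]addrC lerD2r; apply: ler_sum => p _; rewrite cf_absM.
have -> : \sum_(p <- S) u p.1 * v p.2 - l * m =
  (\sum_(p <- S) u p.1 * v p.2 - a * b) + ((a - l) * b + l * (b - m)) by ring.
have h1 : abs ((a - l) * b) <= d * SV.
  rewrite cf_absM ler_pM ?cf_abs_ge0 // ?(ltW lA) //.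
  exact: le_trans (cf_abs_sum _ _ _) (vS _).
have h2 : abs (l * (b - m)) <= abs l * d.
  by rewrite cf_absM ler_wpM2l // ltW.
apply: le_lt_trans (cf_absD _ _) _.
have h3 := cf_absD ((a - l) * b) (l * (b - m)).
have uA := uS A; have vB := vS B.
set x := \sum_(t <- A) abs (u t) in nA uA diff; set y := \sum_(t <- B) abs (v t) in nB vB diff.
have x0 : 0 <= x by apply: sumr_ge0 => t _; exact: cf_abs_ge0.
have h4 : SU * SV - x * y <= SU * d + d * SV.
  have -> : SU * SV - x * y = x * (SV - y) + (SU - x) * SV by ring.
  by apply: lerD; apply: ler_pM => //; lra.
rewrite /D !mulrDr mulr1 in dD.
rewrite (mulrC SU d) (mulrC (abs l) d) in h2 h4; lra.
Qed.

End CauchyProduct.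
End Summable.

Section MultiIndex.
Variable n : nat.
Local Notation mi := {ffun 'I_n -> nat}.

Definition mi_deg (a : mi) : nat := (\sum_i a i)%N.

Definition mi_add (a b : mi) : mi := [ffun i => (a i + b i)%N].

Definition mi_below (c : mi) : {fset mi} :=
  [fset x in codom (fun x : {ffun 'I_n -> 'I_(mi_deg c).+1} =>
                      [ffun i => nat_of_ord (x i)] : mi)]%fset.

Definition mi_dec (c : mi) : {fset mi * mi} :=
  [fset p in (mi_below c `*` mi_below c)%fset | mi_add p.1 p.2 == c]%fset.

Lemma mem_mi_below (a c : mi) : (forall i, (a i <= c i)%N) -> a \in mi_below c.
Proof.
move=> ac; have lt i : (a i < (mi_deg c).+1)%N.
  by rewrite ltnS (leq_trans (ac i)) // /mi_deg (bigD1 i) //= leq_addr.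
rewrite in_fset; apply/codomP; exists [ffun i => Ordinal (lt i)].
by apply/ffunP => i; rewrite !ffunE.
Qed.

Lemma mi_decP (c : mi) p : (p \in mi_dec c) = (mi_add p.1 p.2 == c).
Proof.
apply/idP/idP => [|/eqP <-]; first by rewrite !inE => /andP[].
have h1 : p.1 \in mi_below (mi_add p.1 p.2).
  by apply: mem_mi_below => i; rewrite ffunE leq_addr.
have h2 : p.2 \in mi_below (mi_add p.1 p.2).
  by apply: mem_mi_below => i; rewrite ffunE leq_addl.
by rewrite !inE /= in h1 h2 *; rewrite h1 h2 eqxx.
Qed.

Lemma mi_degD a b : mi_deg (mi_add a b) = (mi_deg a + mi_deg b)%N.
Proof.
by rewrite /mi_deg -big_split /=; apply: eq_bigr => i _; rewrite ffunE.
Qed.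

Definition monomial (h : 'rV[k]_n) (a : mi) : k := \prod_i h 0 i ^+ a i.

Lemma monomialD h a b : monomial h (mi_add a b) = monomial h a * monomial h b.
Proof.
by rewrite /monomial -big_split /=; apply: eq_bigr => i _; rewrite ffunE exprD.
Qed.

Definition polydisc (r : R) : set 'rV[k]_n := [set h | forall i, abs (h 0 i) < r].

Lemma polydisc0 r : 0 < r -> polydisc r 0.
Proof. by move=> r0 i; rewrite mxE cf_abs0. Qed.

Lemma polydiscS r s : r <= s -> polydisc r `<=` polydisc s.
Proof. by move=> rs h hr i; apply: lt_le_trans rs. Qed.

(* Open subsets of [k^n] for the product topology. *)
Definition coord_open (D : set 'rV[k]_n) :=
  forall x, D x -> exists2 r, 0 < r & forall h, polydisc r h -> D (x + h).

(* [g] is given near each point of [D] by a convergent power series; its values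
   outside [D] are irrelevant. *)
Definition analytic_on (D : set 'rV[k]_n) (g : 'rV[k]_n -> k) :=
  forall x, D x -> exists (r : R) (a : mi -> k),
    [/\ 0 < r,
        abs_summable (fun c => abs (a c) * r ^+ mi_deg c) &
        forall h, polydisc r h ->
          D (x + h) /\ sums_to (fun c => a c * monomial h c) (g (x + h))].

Lemma monomial_le h r c : polydisc r h -> abs (monomial h c) <= r ^+ mi_deg c.
Proof.

move=> hr; rewrite /monomial cf_abs_prod.
have -> : r ^+ mi_deg c = \prod_i r ^+ c i.
  by rewrite /mi_deg; elim/big_rec2: _ => //= i y x _ <-; rewrite exprD.
apply: ler_prod => i _; rewrite cf_absX exprn_ge0 ?cf_abs_ge0 //=.
by rewrite lerXn2r // ?nnegrE ?cf_abs_ge0 ?(ltW (hr i)) //;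
  apply: le_trans (ltW (hr i)); apply: cf_abs_ge0.
Qed.

Lemma term_summable a r h : abs_summable (fun c => abs (a c) * r ^+ mi_deg c) ->
  polydisc r h -> abs_summable (fun c => abs (a c * monomial h c)).
Proof.
move=> [M aM] hr; exists M => F; apply: le_trans (aM F).
apply: ler_sum => c _; rewrite cf_absM ler_wpM2l ?cf_abs_ge0 //.
exact: monomial_le.
Qed.

Lemma abs_summable_radius (a : mi -> k) r s : 0 < s -> s <= r ->
  abs_summable (fun c => abs (a c) * r ^+ mi_deg c) ->
  abs_summable (fun c => abs (a c) * s ^+ mi_deg c).
Proof.
move=> s0 sr [M aM]; exists M => F; apply: le_trans (aM F).
apply: ler_sum => c _; rewrite ler_wpM2l ?cf_abs_ge0 // lerXn2r //.
  exact: ltW.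
by rewrite nnegrE (le_trans (ltW s0)).
Qed.

Lemma analytic_open D g : analytic_on D g -> coord_open D.
Proof.
move=> gD x /gD[r [a [r0 _ ha]]]; exists r => // h /ha[]//.
Qed.

Lemma analytic_local D g : coord_open D ->
  (forall x, D x -> exists D' g', [/\ D' x, analytic_on D' g' &
     forall y, D y -> D' y -> g y = g' y]) -> analytic_on D g.
Proof.
move=> oD loc x Dx; have [D' [g' [D'x g'D' gg']]] := loc x Dx.
have [r [a [r0 aS ha]]] := g'D' x D'x; have [s s0 hs] := oD x Dx.
pose t := Num.min r s; have t0 : 0 < t by rewrite lt_min r0.
have tr : t <= r by rewrite ge_min lexx.
have ts : t <= s by rewrite ge_min lexx orbT.
exists t, a; split=> //; first exact: abs_summable_radius aS.
move=> h ht; have [D'h sh] := ha h (polydiscS tr ht).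
have Dh := hs h (polydiscS ts ht).
by split=> //; rewrite gg'.
Qed.

Lemma analytic_sub D E g : coord_open E -> E `<=` D ->
  analytic_on D g -> analytic_on E g.
Proof.
by move=> oE ED gD; apply: analytic_local => // x /ED Dx; exists D, g.
Qed.

Lemma analytic_cst D (c : k) : coord_open D -> analytic_on D (fun=> c).
Proof.
move=> oD x /oD[r r0 hr]; pose z : mi := [ffun=> 0%N].
exists r, (fun m => if m == z then c else 0); split=> //.
  exists (abs c) => F; case zF: (z \in F); last first.
    rewrite big_seq big1 ?cf_abs_ge0 // => m mF.
    by case: eqP => [mz|_]; [rewrite mz zF in mF | rewrite cf_abs0 mul0r].
  rewrite (big_fsetD1 z) //= eqxx big_seq big1 => [|m].
    by rewrite addr0 /mi_deg big1 ?mulr1 // => i _; rewrite ffunE.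
  by rewrite !inE => /andP[/negPf-> _]; rewrite cf_abs0 mul0r.
move=> h /hr Dh; split=> //.
have := @sums_to1 _ z (fun m => (if m == z then c else 0) * monomial h m).
rewrite eqxx /monomial big1 ?mulr1; last by move=> i _; rewrite ffunE.
by apply=> m /negPf ->; rewrite mul0r.
Qed.

Lemma analyticN D g : analytic_on D g -> analytic_on D (fun x => - g x).
Proof.
move=> gD x /gD[r [a [r0 aS ha]]]; exists r, (fun c => - a c); split=> //.
  by case: aS => M aM; exists M => F; under eq_bigr do rewrite cf_absN.
move=> h /ha[Dh sh]; split=> //.
have -> : (fun c => - a c * monomial h c) = (fun c => - (a c * monomial h c)).
  by apply/funext => c; rewrite mulNr.
exact: sums_toN.
Qed.

Section Binary.
Variables (D : set 'rV[k]_n) (f g : 'rV[k]_n -> k).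
Hypotheses (fD : analytic_on D f) (gD : analytic_on D g).

Lemma analytic_common x : D x -> exists (r : R) (a b : mi -> k),
  [/\ 0 < r, abs_summable (fun c => abs (a c) * r ^+ mi_deg c),
      abs_summable (fun c => abs (b c) * r ^+ mi_deg c) &
  forall h, polydisc r h ->
    [/\ D (x + h), sums_to (fun c => a c * monomial h c) (f (x + h)) &
        sums_to (fun c => b c * monomial h c) (g (x + h))]].
Proof.
move=> Dx; have [r [a [r0 aS ha]]] := fD Dx; have [s [b [s0 bS hb]]] := gD Dx.
pose t := Num.min r s; have t0 : 0 < t by rewrite lt_min r0.
have tr : t <= r by rewrite ge_min lexx.
have ts : t <= s by rewrite ge_min lexx orbT.
exists t, a, b; split=> //; [exact: abs_summable_radius aS|
  exact: abs_summable_radius bS|].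
move=> h ht; have [D1 s1] := ha h (polydiscS tr ht).
by have [D2 s2] := hb h (polydiscS ts ht).
Qed.

Lemma analyticD : analytic_on D (fun x => f x + g x).
Proof.
move=> x /analytic_common[r [a [b [r0 [M aM] [N bN] hab]]]].
exists r, (fun c => a c + b c); split=> //.
  exists (M + N) => F; apply: le_trans (lerD (aM F) (bN F)).
  rewrite -big_split /=; apply: ler_sum => c _.
  by rewrite -mulrDl ler_wpM2r ?cf_absD // exprn_ge0 ?ltW.
move=> h /hab[Dh sa sb]; split=> //.
have -> : (fun c => (a c + b c) * monomial h c) =
   (fun c => a c * monomial h c + b c * monomial h c).
  by apply/funext => c; rewrite mulrDl.
exact: sums_toD.
Qed.

Lemma analyticM : analytic_on D (fun x => f x * g x).
Proof.
move=> x /analytic_common[r [a [b [r0 aS bS hab]]]].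
exists r, (fun c => \sum_(p <- mi_dec c) a p.1 * b p.2); split=> //.
  case: aS bS => [M aM] [N bN]; exists (M * N) => F.
  have pos (e : mi -> k) c : 0 <= abs (e c) * r ^+ mi_deg c.
    by rewrite mulr_ge0 ?cf_abs_ge0 // exprn_ge0 ?ltW.
  apply: le_trans (cauchy_bound mi_decP (pos a) (pos b) aM bN F).
  apply: ler_sum => c _.
  apply: le_trans (_ : (\sum_(p <- mi_dec c) abs (a p.1 * b p.2)) * r ^+ mi_deg c <= _).
    by rewrite ler_wpM2r ?(exprn_ge0 _ (ltW r0)) // cf_abs_sum.
  rewrite mulr_suml big_seq [leRHS]big_seq; apply: ler_sum => p.
  rewrite mi_decP => /eqP <-; rewrite mi_degD exprD cf_absM.
  by rewrite mulrACA.
move=> h hr; have [Dh sa sb] := hab h hr; split=> //.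
have -> : (fun c => (\sum_(p <- mi_dec c) a p.1 * b p.2) * monomial h c) =
  (fun c => \sum_(p <- mi_dec c) (a p.1 * monomial h p.1) * (b p.2 * monomial h p.2)).
  apply/funext => c; rewrite mulr_suml big_seq [RHS]big_seq; apply: eq_bigr => p.
  by rewrite mi_decP => /eqP <-; rewrite monomialD mulrACA.
apply: (cauchy_sums_to mi_decP (u := fun c => a c * monomial h c)
          (v := fun c => b c * monomial h c)) => //.
  exact: term_summable aS hr.
exact: term_summable bS hr.
Qed.

End Binary.
End MultiIndex.
End Analytic.

Section ExteriorSuperAlgebra.
Variables (k : fieldType) (q : nat) (A : comPzRingType).
Variable (j : {rmorphism k -> A}).
Local Notation E := (exterior q A).

Lemma ext_partM (i i' : bool) (f g : E) :
  ext_part i f -> ext_part i' g -> ext_part (i (+) i') (f * g).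
Proof.
move=> fi gi K Ki; rewrite [LHS]ext_mulE big1 // => I IK.
have [Ii|Ii] := eqVneq (odd #|I|) i; last by rewrite fi // mul0r mulr0.
rewrite gi ?mulr0 //; apply: contraNN Ki => /eqP <-; rewrite -Ii.
rewrite -(finset.cardsID I K) (finset.setIidPr IK) oddD.
by rewrite eqxx.
Qed.

Lemma ext_even_central (f g : E) : ext_part false f -> f * g = g * f.
Proof.
move=> f0; apply/ffunP => K; rewrite [LHS]ext_mulE [RHS]ext_mulC; apply: eq_bigr => I IK.
have [Io|Ie] := boolP (odd #|I|); first by rewrite f0 ?Io // !(mul0r, mulr0).
rewrite ext_sgnC ?(negPf Ie) ?mul1r ?(mulrC (f I)) //.
by rewrite disjoint_sym; apply/finset.setDidPl; rewrite finset.setDDl finset.setUid.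
Qed.

Lemma ext_odd_anticomm (f g : E) :
  ext_part true f -> ext_part true g -> f * g = - (g * f).
Proof.
move=> f1 g1; apply/ffunP => K; rewrite [LHS]ext_mulE [RHS]ffunE [X in _ = - X]ext_mulC -sumrN.
apply: eq_bigr => I IK; have [Io|Ie] := boolP (odd #|I|); last first.
  by rewrite f1 ?(negPf Ie) // !(mul0r, mulr0) oppr0.
have [Jo|Je] := boolP (odd #|K :\: I|); last first.
  by rewrite g1 ?(negPf Je) // !(mul0r, mulr0) oppr0.
rewrite ext_sgnC ?Io ?Jo ?(mulrC (f I)) ?mulN1r ?mulNr //.
by rewrite disjoint_sym; apply/finset.setDidPl; rewrite finset.setDDl finset.setUid.
Qed.

Lemma ext_part_span (f : E) : exists f0 f1 : E,
  [/\ ext_part false f0, ext_part true f1 & f = f0 + f1].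
Proof.
exists ([ffun I : {set 'I_q} => if odd #|I| then 0 else f I] : E).
exists ([ffun I : {set 'I_q} => if odd #|I| then f I else 0] : E).
split=> [I|I|]; try by rewrite ffunE; case: (odd _).
by apply/ffunP => I; rewrite !ffunE; case: (odd _); rewrite ?add0r ?addr0.
Qed.

Program Definition exterior_super_algebra : super_algebra k :=
  @SuperAlgebra k E (GRing.RMorphism.clone _ _ (@ext_cst q A \o j) _)
    _ (@ext_part q A) _ _ _ ext_part_span _ _ ext_partM
    ext_even_central ext_odd_anticomm.
Next Obligation.
by move=> c f; apply/ffunP => I; rewrite [LHS]ext_cst_mulE [RHS]ext_mul_cstE mulrC.
Qed.
Next Obligation. by move=> i I _; rewrite ffunE. Qed.
Next Obligation. by move=> i f g fi gi I Ii; rewrite ffunE /= fi ?gi ?addr0. Qed.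
Next Obligation. by move=> i c f fi I Ii; rewrite [LHS]ext_cst_mulE fi ?mulr0. Qed.
Next Obligation.
move=> f f0 f1; apply/ffunP => I; rewrite ffunE.
by have [Io|Io] := boolP (odd #|I|); [apply: f0; rewrite Io|apply: f1; rewrite (negPf Io)].
Qed.
Next Obligation.
move=> I Ii; rewrite ffunE; have [I0|//] := eqVneq I finset.set0.
by rewrite I0 finset.cards0 in Ii.
Qed.

End ExteriorSuperAlgebra.

Section ExteriorMap.
Variables (k : fieldType) (q : nat) (A B : comPzRingType).
Variables (jA : {rmorphism k -> A}) (jB : {rmorphism k -> B}).
Variable phi : {rmorphism A -> B}.
Hypothesis phi_alg : forall c, phi (jA c) = jB c.

Definition ext_map (f : exterior q A) : exterior q B :=
  [ffun I : {set 'I_q} => phi (f I)].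

Lemma ext_map_zmod_morphism : zmod_morphism ext_map.
Proof. by move=> f g; apply/ffunP => I; rewrite !ffunE /= rmorphB. Qed.

Lemma ext_map_monoid_morphism : monoid_morphism ext_map.
Proof.
split=> [|f g]; apply/ffunP => K.
  by rewrite !ffunE; case: eqP; rewrite ?rmorph0 ?rmorph1.
rewrite ffunE [RHS]ext_mulE [(f * g) K]ext_mulE rmorph_sum; apply: eq_bigr => I _.
by rewrite !rmorphM rmorphXn rmorphN1 !ffunE.
Qed.

HB.instance Definition _ := GRing.isZmodMorphism.Build
  (exterior q A) (exterior q B) ext_map ext_map_zmod_morphism.
HB.instance Definition _ := GRing.isMonoidMorphism.Build
  (exterior q A) (exterior q B) ext_map ext_map_monoid_morphism.

Program Definition exterior_hom :
    sa_hom (exterior_super_algebra q jA) (exterior_super_algebra q jB) :=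
  @SaHom k (exterior_super_algebra q jA) (exterior_super_algebra q jB)
    (GRing.RMorphism.clone (exterior q A) (exterior q B) ext_map _) _ _.
Next Obligation.
move=> c; apply/ffunP => I; rewrite !ffunE.
by case: eqP; rewrite ?rmorph0 ?phi_alg.
Qed.
Next Obligation. by move=> i f fi I Ii; rewrite ffunE fi ?rmorph0. Qed.

End ExteriorMap.

Section Manifold.
Variables (R : realType) (k : complete_field R).

Record chart (X : topologicalType) := Chart {
  chart_dim : nat;
  chart_dom : set X;
  chart_map : X -> 'rV[k]_chart_dim;
  chart_dom_open : open chart_dom;
  chart_map_inj : forall x y, chart_dom x -> chart_dom y ->
    chart_map x = chart_map y -> x = y;
  chart_map_continuous : forall D : set 'rV[k]_chart_dim, coord_open D ->
    open (chart_dom `&` chart_map @^-1` D);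
  chart_map_open : forall U : set X, open U -> U `<=` chart_dom ->
    coord_open (chart_map @` U) }.

(* [f], read in the chart [c], is analytic on the image of [U]; the function
   [g] is [f] composed with the inverse of the chart. *)
Definition analytic_in_chart (X : topologicalType) (c : chart X) (U : set X)
    (f : U -> k) :=
  exists2 g, (forall y : U, chart_dom c (val y) ->
                g (chart_map c (val y)) = f y) &
             analytic_on (chart_map c @` (U `&` chart_dom c)) g.

(* An atlas stands for the manifold structure that it generates; the analytic
   functions only depend on the latter. *)
Record manifold := Manifold {
  manifold_carrier :> topologicalType;
  atlas : set (chart manifold_carrier);
  atlas_cover : forall x, exists2 c, atlas c & chart_dom c x;
  atlas_compatible : forall c d, atlas c -> atlas d ->
    forall i, @analytic_in_chart _ c (chart_dom d)
                (fun y => chart_map d (val y) 0 i) }.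

Section AnalyticFunctions.
Variable M : manifold.

Record analytic_fun (U : set M) := AnalyticFun {
  af_fun :> U -> k;
  af_analytic : forall c, atlas c -> analytic_in_chart c af_fun }.

HB.instance Definition _ U := gen_eqMixin (analytic_fun U).
HB.instance Definition _ U := gen_choiceMixin (analytic_fun U).

Lemma af_ext U (f g : analytic_fun U) : f =1 g -> f = g.
Proof.
case: f => f hf; case: g => g hg /= fg.
have {fg} efg : f = g by apply: funext.
by case: _ / efg hg => hg; rewrite (Prop_irrelevance hf hg).
Qed.

Lemma chart_image_open (c : chart M) (U : opens M) :
  coord_open (chart_map c @` (U `&` chart_dom c)).
Proof.
apply: chart_map_open; last by move=> x [].
by apply: openI; [exact: oset_open|exact: chart_dom_open].
Qed.

Section Ring.
Variable U : opens M.
Local Notation F := (analytic_fun U).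
Implicit Types f g : F.

Program Definition af_cst (a : k) : F := @AnalyticFun U (fun=> a) _.
Next Obligation.
by move=> a c _; exists (fun=> a) => //; apply/analytic_cst/chart_image_open.
Qed.

Program Definition af_opp f : F := @AnalyticFun U (fun x => - f x) _.
Next Obligation.
move=> f c Mc; have [g gf ga] := af_analytic f Mc.
by exists (fun x => - g x); [move=> y cy; rewrite gf|exact: analyticN].
Qed.

Program Definition af_add f g : F := @AnalyticFun U (fun x => f x + g x) _.
Next Obligation.
move=> f g c Mc; have [f' ff fa] := af_analytic f Mc.
have [g' gg ga] := af_analytic g Mc.
by exists (fun x => f' x + g' x); [move=> y cy; rewrite ff ?gg|exact: analyticD].
Qed.

Program Definition af_mul f g : F := @AnalyticFun U (fun x => f x * g x) _.
Next Obligation.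
move=> f g c Mc; have [f' ff fa] := af_analytic f Mc.
have [g' gg ga] := af_analytic g Mc.
by exists (fun x => f' x * g' x); [move=> y cy; rewrite ff ?gg|exact: analyticM].
Qed.

Lemma af_addA : associative af_add.
Proof. by move=> f g h; apply: af_ext => x /=; rewrite addrA. Qed.
Lemma af_addC : commutative af_add.
Proof. by move=> f g; apply: af_ext => x /=; rewrite addrC. Qed.
Lemma af_add0 : left_id (af_cst 0) af_add.
Proof. by move=> f; apply: af_ext => x /=; rewrite add0r. Qed.
Lemma af_addN : left_inverse (af_cst 0) af_opp af_add.
Proof. by move=> f; apply: af_ext => x /=; rewrite addNr. Qed.
Lemma af_mulA : associative af_mul.
Proof. by move=> f g h; apply: af_ext => x /=; rewrite mulrA. Qed.
Lemma af_mulC : commutative af_mul.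
Proof. by move=> f g; apply: af_ext => x /=; rewrite mulrC. Qed.
Lemma af_mul1 : left_id (af_cst 1) af_mul.
Proof. by move=> f; apply: af_ext => x /=; rewrite mul1r. Qed.
Lemma af_mulDl : left_distributive af_mul af_add.
Proof. by move=> f g h; apply: af_ext => x /=; rewrite mulrDl. Qed.

HB.instance Definition _ :=
  GRing.isZmodule.Build F af_addA af_addC af_add0 af_addN.
HB.instance Definition _ :=
  GRing.Zmodule_isComPzRing.Build F af_mulA af_mulC af_mul1 af_mulDl.

Lemma af_cst_zmod_morphism : zmod_morphism af_cst.
Proof. by move=> a b; apply: af_ext. Qed.
Lemma af_cst_monoid_morphism : monoid_morphism af_cst.
Proof. by split=> // a b; apply: af_ext. Qed.

HB.instance Definition _ :=
  GRing.isZmodMorphism.Build k F af_cst af_cst_zmod_morphism.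
HB.instance Definition _ :=
  GRing.isMonoidMorphism.Build k F af_cst af_cst_monoid_morphism.

End Ring.

Definition set_incl (T : Type) (U V : set T) (h : V `<=` U) (x : V) : U :=
  exist _ (val x) (mem_set (h _ (set_valP x))).

Section Restriction.
Variables (U V : opens M) (h : V `<=` U).

Program Definition af_restr (f : analytic_fun U) : analytic_fun V :=
  @AnalyticFun V (fun x => f (set_incl h x)) _.
Next Obligation.
move=> f c Mc; have [g gf ga] := af_analytic f Mc; exists g.
  by move=> y cy; rewrite -gf.
apply: analytic_sub ga; first exact: chart_image_open.
by move=> _ [x [Vx cx] <-]; exists x => //; split=> //; apply: h.
Qed.

Lemma af_restr_zmod_morphism : zmod_morphism af_restr.
Proof. by move=> f g; apply: af_ext. Qed.
Lemma af_restr_monoid_morphism : monoid_morphism af_restr.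
Proof. by split=> [|f g]; apply: af_ext. Qed.

HB.instance Definition _ := GRing.isZmodMorphism.Build
  (analytic_fun U) (analytic_fun V) af_restr af_restr_zmod_morphism.
HB.instance Definition _ := GRing.isMonoidMorphism.Build
  (analytic_fun U) (analytic_fun V) af_restr af_restr_monoid_morphism.

End Restriction.

Lemma af_glue (U : opens M) (I : Type) (C : I -> opens M)
  (hC : forall i, C i `<=` U) : U `<=` \bigcup_i C i ->
  forall s : forall i, analytic_fun (C i),
  (forall i j (W : opens M) (hi : W `<=` C i) (hj : W `<=` C j),
     af_restr hi (s i) = af_restr hj (s j)) ->
  exists t : analytic_fun U, forall i, af_restr (hC i) t = s i.
Proof.
move=> cov s compat.
have wit (x : U) : exists i, (C i : set M) (val x).
  by have [i _ Ci] := cov _ (set_valP x); exists i.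
pose ix x := sval (cid (wit x)).
have ixP x : (C (ix x) : set M) (val x) := svalP (cid (wit x)).
pose t (x : U) : k := s (ix x) (exist _ (val x) (mem_set (ixP x))).
have agree i j x (hi : x \in (C i : set M)) (hj : x \in (C j : set M)) :
    s i (exist _ x hi) = s j (exist _ x hj).
  pose W := Opens (openI (oset_open (C i)) (oset_open (C j))).
  have Wx : x \in (W : set M) by apply/mem_set; split; apply/set_mem.
  have hWi : W `<=` C i by move=> y [].
  have hWj : W `<=` C j by move=> y [].
  have /(congr1 (fun f : analytic_fun W => f (exist _ x Wx))) /= :=
    compat i j W hWi hWj.
  rewrite /set_incl /=.
  by rewrite (Prop_irrelevance (mem_set _) hi) (Prop_irrelevance (mem_set _) hj).
have tE i x (hi : x \in (C i : set M)) (hU : x \in (U : set M)) :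
    t (exist _ x hU) = s i (exist _ x hi).
  exact: agree.
have ta c : atlas c -> analytic_in_chart c t.
  move=> Mc; pose g y : k :=
    if pselect (exists x : U, chart_dom c (val x) /\ chart_map c (val x) = y)
      is left e then t (sval (cid e)) else 0.
  have gt (x : U) : chart_dom c (val x) -> g (chart_map c (val x)) = t x.
    move=> cx; rewrite /g; case: pselect => [e|[]]; last by exists x.
    case: (cid e) => /= y [cy eyx]; congr t.
    by apply: val_inj; apply: chart_map_inj eyx.
  exists g => //; apply: analytic_local; first exact: chart_image_open.
  move=> _ [x [Ux cx] <-]; have [i _ Cx] := cov x Ux.
  have [g' g's ga'] := af_analytic (s i) Mc.
  exists (chart_map c @` (C i `&` chart_dom c)), g'; split=> //.
    by exists x.
  move=> _ _ [y [Ciy cy] <-].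
  have Uy : y \in (U : set M) by apply/mem_set; apply: hC Ciy.
  rewrite (gt (exist _ y Uy)) // (tE i _ (mem_set Ciy)).
  by rewrite -(g's (exist _ y (mem_set Ciy))).
exists (AnalyticFun ta) => i; apply: af_ext => -[x Cx] /=.
exact: tE.
Qed.

End AnalyticFunctions.

Section StandardModel.
Variables (M : manifold) (q : nat).

Definition model_sections (U : opens M) : super_algebra k :=
  exterior_super_algebra q (GRing.RMorphism.clone k (analytic_fun U) (@af_cst M U) _).

Program Definition model_restr (U V : opens M) (h : V `<=` U) :
    sa_hom (model_sections U) (model_sections V) :=
  @exterior_hom k q (analytic_fun U) (analytic_fun V) _ _
    (GRing.RMorphism.clone (analytic_fun U) (analytic_fun V) (af_restr h) _) _.
Next Obligation. by move=> U V h c; apply: af_ext. Qed.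

Program Definition model_sheaf : sa_sheaf k M :=
  @SaSheaf k M model_sections model_restr _ _ _ _.
Next Obligation.
move=> U h s; apply/ffunP => K; rewrite ffunE; apply: af_ext => -[x Ux] /=.
by rewrite /set_incl /= (Prop_irrelevance (mem_set _) Ux).
Qed.
Next Obligation.
move=> U V W hV hW hWU s; apply/ffunP => K; rewrite !ffunE; apply: af_ext => x /=.
by congr (s K _); apply: val_inj.
Qed.
Next Obligation.
move=> U I C hC cov s t st; apply/ffunP => K; apply: af_ext => -[x Ux].
have [i _ Cx] := cov x (set_mem Ux).
have /ffunP/(_ K) := st i; rewrite !ffunE.
move=> /(congr1 (fun f : analytic_fun (C i) => f (exist _ x (mem_set Cx)))) /=.
by rewrite /set_incl /= (Prop_irrelevance (mem_set _) Ux).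
Qed.
Next Obligation.
move=> U I C hC cov s compat.
have glue K : exists t : analytic_fun U, forall i, af_restr (hC i) t = s i K.
  apply: af_glue => // i j W hi hj.
  by have /ffunP/(_ K) := compat i j W hi hj; rewrite !ffunE.
exists [ffun K : {set 'I_q} => sval (cid (glue K))] => i.
by apply/ffunP => K; rewrite !ffunE; exact: (svalP (cid (glue K))).
Qed.

(* The super-ringed space [(|M|, F_M (x) wedge(k^q))]. *)
Definition model : super_ringed_space k := SuperRingedSpace model_sheaf.

End StandardModel.

Definition is_super_manifold (X : SRS k) :=
  forall x : X, exists U : opens X, (U : set X) x /\
  exists (M : manifold) (q : nat),
    @isomorphic (SRS k) (open_subspace U) (model M q).

Definition SMFD : category := full_subcategory is_super_manifold.

End Manifold.

(* Main.v *)
From HB Require Import structures.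
From mathcomp Require Import all_boot all_order all_algebra finmap.
From mathcomp Require Import all_classical reals topology ring lra.
Require Import Defs.

(** A product of super-manifolds exists because locally morphisms are given by
    their coordinates, and because this local information can be glued without
    choosing charts.

    Write [AA n q] for the affine super-space of dimension [n|q] and call its open
    subspaces super-domains, or probes. The local statement is that a morphism from
    a super-domain to [AA n q] is the same thing as [n] even and [q] odd sections.
    - It is determined by these sections ([domain_map_uniq]). A coordinate minus a
      constant is invertible where it has no zero; hence the underlying map is the
      body of the even sections ([coord_body]). Near a point [y] Hadamard's lemma
      writes a function as [f = f(y) + sum_i (x_i - y_i) g_i]. If two morphisms have
      the same coordinates, then it follows by induction that the values of the two
      pullbacks of [f] at a point, which lie in an exterior algebra over the field,
      differ by an element of any given power of the augmentation ideal
      ([pval_at_fil]), so that they agree.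
    - All even and odd sections occur ([domain_map_ex]). If [b] is the body of the
      even sections and [N] their nilpotent part, then [f] is pulled back to the
      finite Taylor sum of the [(D_be f)(b) N^be], with the Hasse derivatives [D_be]
      in place of divided partial derivatives since the characteristic may be
      positive. Leibniz's rule makes this a ring homomorphism ([taylor]), which the
      universal property of the exterior algebra extends to odd coordinates
      ([ext_lift]).
    Consequently super-domains have finite products: one collects all the
    coordinates ([pairing_unique]).

    The analysis behind this is that of absolutely convergent power series over a
    complete field. Substitution of series ([pval_psubst]) yields composition of
    analytic functions, re-expansion at other points and, by expanding [g (x + y)]
    in both variables, the analyticity of the Hasse derivatives. Division by
    coordinates ([pval_split]) yields Hadamard's lemma and the uniqueness of the
    coefficients.

    For the global statement, a super-manifold is covered by super-domains
    ([smfd_covered]) and is therefore the colimit of all the probes over it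
    ([probe_colimit]). So it suffices to find a super-manifold with the product
    property for morphisms from probes. Its space is the product of the spaces, and
    its sheaf is dictated by the Yoneda lemma: a section over [W] is a natural
    family of sections, one on every probe with morphisms to the factors that map
    it into [W] ([psec], [probe_product]). Products of charts of the factors are
    open immersions into this space ([chart_oi]); therefore it is a super-manifold
    ([covered_smfd]), and morphisms from probes to it are determined by their
    components ([yon_surj]). *)

Set Implicit Arguments.
Unset Strict Implicit.
Unset Printing Implicit Defensive.

Import Order.TTheory GRing.Theory Num.Theory.
Local Open Scope ring_scope.
Local Open Scope classical_set_scope.

(** * Morphisms of super-ringed spaces and open immersions *)

Section SuperAlgebraMaps.
Variable k : fieldType.

(** Homogeneity can be tested after a jointly injective family of morphisms: the
    component of [b] of the wrong parity has image zero everywhere. *)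
Lemma sa_part_reflect (B : super_algebra k) (b : B) (J : Type)
  (D : J -> super_algebra k) (beta : forall j, sa_hom B (D j)) i :
  (forall b : B, (forall j, beta j b = 0) -> b = 0) ->
  (forall j, sa_part (D j) i (beta j b)) -> sa_part B i b.
Proof.
move=> inj parts; have [b0 [b1 [p0 p1 eb]]] := sa_part_span b.
case: i parts => parts.
- suff b00 : b0 = 0 by rewrite eb b00 add0r.
  apply: inj => j; apply: sa_part_direct; first exact: sa_fun_part.
  have -> : beta j b0 = beta j b + sa_alg _ (-1) * beta j b1.
    by rewrite eb rmorphD rmorphN1 mulN1r addrK.
  by apply: sa_partD => //; apply: sa_partZ; apply: sa_fun_part.
- suff b10 : b1 = 0 by rewrite eb b10 addr0.
  apply: inj => j; apply: sa_part_direct; last exact: sa_fun_part.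
  have -> : beta j b1 = beta j b + sa_alg _ (-1) * beta j b0.
    by rewrite eb rmorphD rmorphN1 mulN1r addrAC subrr add0r.
  by apply: sa_partD => //; apply: sa_partZ; apply: sa_fun_part.
Qed.

Lemma sa_compE (A B C : super_algebra k) (g : sa_hom B C) (f : sa_hom A B) a :
  sa_comp g f a = g (f a).
Proof. by []. Qed.

(** A correspondence between elements of [A] and [B] that is cut out by equations
    between morphisms of super-algebras is itself such a morphism. All the
    pullbacks below that are obtained by gluing or by inverting a bijection are
    built in this way. *)
Lemma sa_hom_of_char (A B : super_algebra k) (J : Type)
  (C : J -> super_algebra k) (alpha : forall j, sa_hom A (C j))
  (beta : forall j, sa_hom B (C j)) :
  (forall b : B, (forall j, beta j b = 0) -> b = 0) ->
  (forall a, exists b, forall j, beta j b = alpha j a) ->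
  exists g : sa_hom A B, forall a j, beta j (g a) = alpha j a.
Proof.
move=> inj ex; pose g a := sval (cid (ex a)).
have gP a j : beta j (g a) = alpha j a := svalP (cid (ex a)) j.
have eqB b b' : (forall j, beta j b = beta j b') -> b = b'.
  move=> bb; apply/eqP; rewrite -subr_eq0; apply/eqP; apply: inj => j.
  by rewrite rmorphB bb subrr.
have gB : zmod_morphism g.
  by move=> a a'; apply: eqB => j; rewrite rmorphB !gP rmorphB.
have gM : monoid_morphism g.
  split=> [|a a']; apply: eqB => j; first by rewrite gP !rmorph1.
  by rewrite rmorphM !gP rmorphM.
pose gz := GRing.isZmodMorphism.Build A B g gB.
pose gm := GRing.isMonoidMorphism.Build A B g gM.
pose gr : {rmorphism A -> B} := HB.pack g gz gm.
have ga c : gr (sa_alg A c) = sa_alg B c.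
  by apply: eqB => j; rewrite gP !sa_fun_alg.
have gp i a : sa_part A i a -> sa_part B i (gr a).
  move=> pa; apply: (@sa_part_reflect B _ _ _ beta) => // j.
  by rewrite gP; apply: sa_fun_part.
by exists (SaHom ga gp) => a j; rewrite /= gP.
Qed.

End SuperAlgebraMaps.

Section Pullback.
Variable k : fieldType.
Implicit Types X Y Z : super_ringed_space k.

(** Keeping the open subset of the source free, instead of the exact preimage,
    avoids transports along equalities of open sets. *)
Definition pb X Y (f : srs_hom X Y) (V : opens Y) (U : opens X)
    (h : U `<=` f @^-1` V) : sa_hom ('O_Y V) ('O_X U) :=
  sa_comp (@restr _ _ 'O_X (preim_opens (srs_map_continuous f) V) U h)
          (pullback f V).
Arguments pb : simpl never.

Lemma preimP X Y (f : srs_hom X Y) (V : opens Y) :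
  preim_opens (srs_map_continuous f) V `<=` f @^-1` V.
Proof. by []. Qed.

Lemma pb_restr X Y (f : srs_hom X Y) (V V' : opens Y) (U : opens X)
  (hV : V' `<=` V) (h : U `<=` f @^-1` V') (h' : U `<=` f @^-1` V) s :
  pb h (restr 'O_Y hV s) = pb h' s.
Proof. by rewrite /pb /= pullback_restr restr_trans; apply: restr_irr. Qed.

Lemma restr_pb X Y (f : srs_hom X Y) (V : opens Y) (U U' : opens X)
  (hU : U' `<=` U) (h : U `<=` f @^-1` V) (h' : U' `<=` f @^-1` V) s :
  restr 'O_X hU (pb h s) = pb h' s.
Proof. by rewrite /pb /= restr_trans; apply: restr_irr. Qed.

Lemma pb_irr X Y (f : srs_hom X Y) (V : opens Y) (U : opens X)
  (h h' : U `<=` f @^-1` V) s : pb h s = pb h' s.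
Proof. by rewrite (Prop_irrelevance h h'). Qed.

Lemma pb_eq X Y (f g : srs_hom X Y) (V : opens Y) (U : opens X)
  (h : U `<=` f @^-1` V) (h' : U `<=` g @^-1` V) s : f = g -> pb h s = pb h' s.
Proof. by move=> fg; case: _ / fg h' => h'; apply: pb_irr. Qed.

Lemma pb_comp X Y Z (g : srs_hom Y Z) (f : srs_hom X Y) (V : opens Z)
  (W : opens Y) (U : opens X) (h : U `<=` srs_comp g f @^-1` V)
  (hf : U `<=` f @^-1` W) (hg : W `<=` g @^-1` V) s :
  pb h s = pb hf (pb hg s).
Proof.
by rewrite /pb /= pullback_restr !restr_trans; apply: restr_irr.
Qed.

Lemma pb_id X (V U : opens X) (h : U `<=` srs_id X @^-1` V) s :
  pb h s = restr 'O_X (h : U `<=` V) s.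
Proof. by rewrite /pb /= restr_trans; apply: restr_irr. Qed.

Lemma section_local X (U : opens X) (s t : 'O_X U) :
  (forall x, (U : set X) x -> exists (W : opens X) (h : W `<=` U),
     (W : set X) x /\ restr 'O_X h s = restr 'O_X h t) -> s = t.
Proof.
move=> loc; pose J := {x : X | (U : set X) x}.
have wit (j : J) : exists W : {W : opens X | W `<=` U},
    (sval W : set X) (sval j) /\
    restr 'O_X (svalP W) s = restr 'O_X (svalP W) t.
  have [W [h [Wx e]]] := loc (sval j) (svalP j).
  exists (exist (fun W : opens X => W `<=` U) W h); split=> //=.
  by rewrite (restr_irr _ h s) (restr_irr _ h t).
pose C j := sval (sval (cid (wit j))).
apply: (@sheaf_sep k X 'O_X U J C (fun j => svalP (sval (cid (wit j))))).
  move=> x Ux; exists (exist _ x Ux) => //.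
  exact: (proj1 (svalP (cid (wit (exist _ x Ux))))).
by move=> j; exact: (proj2 (svalP (cid (wit j)))).
Qed.

Lemma srs_ext_local X Y (f g : srs_hom X Y) : f =1 g ->
  (forall (V : opens Y) (s : 'O_Y V) x, (V : set Y) (f x) ->
     exists (U : opens X) (h : U `<=` f @^-1` V) (h' : U `<=` g @^-1` V),
       (U : set X) x /\ pb h s = pb h' s) -> f = g.
Proof.
move=> fg loc; apply: srs_hom_ext => // V U hf hg s.
apply: section_local => x Ux; have [W [h [h' [Wx e]]]] := loc V s x (hf x Ux).
have oUW : open ((U : set X) `&` W) by apply: openI; apply: oset_open.
pose UW := Opens oUW; have sU : UW `<=` U by move=> y [].
have sW : UW `<=` W by move=> y [].
exists UW, sU; split; first by split.
transitivity (restr 'O_X sW (pb h s)); last rewrite e.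
  by rewrite !restr_trans; apply: restr_irr.
by rewrite !restr_trans; apply: restr_irr.
Qed.

Definition full X : opens X := Opens (@openT X).

Definition image_of X Y (j : X -> Y) (oj : forall V, open V -> open (j @` V))
  (V : opens X) : opens Y := Opens (oj V (oset_open V)).

(** An isomorphism onto an open subspace, stated without mention of the latter:
    bijectivity on the sections over the open subsets of the image. *)
Record open_imm X Y (j : srs_hom X Y) : Prop := OpenImm {
  oi_inj : injective j;
  oi_open : forall V : set X, open V -> open (j @` V);
  oi_mono : forall (V : opens X) (U : opens Y) (h : V `<=` j @^-1` U),
    U `<=` j @` V -> forall s, pb h s = 0 -> s = 0;
  oi_epi : forall (V : opens X) (U : opens Y) (h : V `<=` j @^-1` U),
    U `<=` j @` V -> forall t, exists s, pb h s = t }.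

Lemma oi_section_inj X Y (j : srs_hom X Y) (oj : open_imm j)
  (V : opens X) (U : opens Y) (h : V `<=` j @^-1` U) : U `<=` j @` V ->
  forall s t, pb h s = pb h t -> s = t.
Proof.
move=> hU s t e; apply/eqP; rewrite -subr_eq0; apply/eqP.
by apply: (oi_mono oj hU (h := h)); rewrite rmorphB e subrr.
Qed.

Definition oi_image X Y (j : srs_hom X Y) (oj : open_imm j) (V : opens X) :=
  image_of (oi_open oj) V.

Lemma oi_imageP X Y (j : srs_hom X Y) (oj : open_imm j) (V : opens X) :
  V `<=` j @^-1` (oi_image oj V).
Proof. by move=> x Vx; exists x. Qed.

(** Over its image an open immersion can be inverted on sections. *)
Lemma oi_inverse X Y (j : srs_hom X Y) (oj : open_imm j) (V : opens X) :
  exists g : sa_hom ('O_X V) ('O_Y (oi_image oj V)),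
    forall s, pb (oi_imageP oj (V := V)) (g s) = s.
Proof.
have [|a|g gP] := @sa_hom_of_char k ('O_X V) ('O_Y (oi_image oj V)) unit
  (fun=> 'O_X V) (fun=> sa_id _) (fun=> pb (oi_imageP oj (V := V))).
- by move=> b /(_ tt); apply: (oi_mono oj).
- by have [|b bP] := oi_epi oj (oi_imageP oj (V := V)) _ a; last by exists b.
- by exists g => s; apply: gP s tt.
Qed.

Lemma oi_cancel X Y Z (j : srs_hom Y Z) (f g : srs_hom X Y) : open_imm j ->
  srs_comp j f = srs_comp j g -> f = g.
Proof.
move=> oj e; have fg : f =1 g.
  by move=> x; apply: (oi_inj oj); have := congr1 (fun u : srs_hom _ _ => u x) e.
apply: srs_ext_local => // V s x Vfx.
have [|t <-] := oi_epi oj (oi_imageP oj (V := V)) _ s; first by [].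
pose U := preim_opens (srs_map_continuous f) V.
have hg : U `<=` g @^-1` V by move=> y; rewrite /U /= -fg.
exists U, (fun _ h => h), hg; split=> //.
have hUf : U `<=` srs_comp j f @^-1` (oi_image oj V) by move=> y Vy; exists (f y).
have hUg : U `<=` srs_comp j g @^-1` (oi_image oj V).
  by move=> y Vy; exists (g y) => //; apply: hg.
by rewrite -(pb_comp hUf) -(pb_comp hUg); apply: pb_eq.
Qed.

(** The universal property of open subspaces: a section over [V] is the
    restriction of a unique section over the image of [V], which is then pulled
    back along [f]. *)
Lemma oi_lift X Y Z (j : srs_hom Y Z) (f : srs_hom X Z) : open_imm j ->
  (forall x, exists y, j y = f x) -> exists g : srs_hom X Y, srs_comp j g = f.
Proof.
move=> oj im; pose g x := sval (cid (im x)).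
have gP x : j (g x) = f x := svalP (cid (im x)).
have gV (V : opens Y) x : (V : set Y) (g x) <-> (oi_image oj V : set Z) (f x).
  split=> [Vg|[y Vy]]; first by exists (g x).
  by rewrite -gP => /(oi_inj oj) <-.
have gc : continuous g.
  apply/continuousP => V oV; have oW := oi_open oj oV.
  have -> : g @^-1` V = f @^-1` (j @` V).
    by apply/seteqP; split=> x; have := gV (Opens oV) x => /= -[].
  by move/continuousP : (@srs_map_continuous _ _ _ f); apply.
pose inv V := sval (cid (oi_inverse oj V)).
have invP V s : pb (oi_imageP oj (V := V)) (inv V s) = s :=
  svalP (cid (oi_inverse oj V)) s.
have hV V : preim_opens gc V `<=` f @^-1` (oi_image oj V).
  by move=> x; rewrite /= => Vx; apply/gV.
pose pg V : sa_hom ('O_Y V) ('O_X (preim_opens gc V)) := sa_comp (pb (hV V)) (inv V).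
have pgP (V : opens Y) (U : opens Z) (h : V `<=` j @^-1` U) (W : opens X)
    (hW : W `<=` f @^-1` U) (hW' : W `<=` preim_opens gc V) s :
    restr 'O_X hW' (pg V (pb h s)) = pb hW s.
  have hU : oi_image oj V `<=` U by move=> _ [y Vy <-]; apply: h.
  have -> : pb h s = pb (oi_imageP oj (V := V)) (restr 'O_Z hU s).
    by rewrite (pb_restr _ _ h).
  rewrite /pg /=.
  have -> : inv V (pb (oi_imageP oj (V := V)) (restr 'O_Z hU s)) = restr 'O_Z hU s.
    by apply: (oi_section_inj oj _ (invP V _)).
  have hW2 : W `<=` f @^-1` (oi_image oj V) by apply: subset_trans hW' (hV V).
  by rewrite (restr_pb _ _ hW2) (pb_restr _ _ hW).
have pgr (U V : opens Y) (h : V `<=` U) (s : 'O_Y U) :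
    pg V (restr 'O_Y h s) = restr 'O_X (preim_opensS (cf := gc) h) (pg U s).
  have [|t <-] := oi_epi oj (oi_imageP oj (V := U)) _ s; first by [].
  have hVU : V `<=` j @^-1` (oi_image oj U) by move=> y Vy; exists y => //; apply: h.
  have hW : preim_opens gc V `<=` f @^-1` (oi_image oj U).
    by move=> x Vx; apply/gV; apply: h.
  rewrite (restr_pb _ _ hVU) (pgP _ _ _ _ hW).
  by rewrite -[LHS](restr_id (fun _ h => h)) (pgP _ _ _ _ hW).
exists (SrsHom pgr); apply: srs_ext_local => [x /=|V s x Vx]; first exact: gP.
pose U := preim_opens (srs_map_continuous f) V.
have h1 : U `<=` srs_comp j (SrsHom pgr) @^-1` V by move=> y; rewrite /U /= gP.
exists U, h1, (fun _ h => h); split; first by rewrite /U /= -gP.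
pose W := preim_opens (srs_map_continuous j) V.
have hUW : U `<=` (SrsHom pgr) @^-1` W by move=> y; rewrite /U /= gP.
by rewrite (pb_comp h1 hUW (fun _ h => h)) {1}/pb /=; apply: pgP.
Qed.

Lemma oi_comp X Y Z (g : srs_hom Y Z) (f : srs_hom X Y) :
  open_imm g -> open_imm f -> open_imm (srs_comp g f).
Proof.
move=> og of_; split=> [x y /(oi_inj og)/(oi_inj of_)//|V oV||].
- by rewrite -image_comp; apply: (oi_open og); apply: (oi_open of_).
- move=> V U h hU s; have hUW : oi_image of_ V `<=` g @^-1` U.
    by move=> _ [x Vx <-]; apply: h.
  rewrite (pb_comp h (oi_imageP of_ (V := V)) hUW) => e0.
  have e := oi_mono of_ (U := oi_image of_ V) (fun _ h => h) e0.
  by apply: (oi_mono og _ e) => z /hU[x Vx <-]; exists (f x) => //; exists x.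
- move=> V U h hU t; have hUW : oi_image of_ V `<=` g @^-1` U.
    by move=> _ [x Vx <-]; apply: h.
  have [|s <-] := oi_epi of_ (oi_imageP of_ (V := V)) _ t; first by [].
  have [|r <-] := oi_epi og hUW _ s.
    by move=> z /hU[x Vx <-]; exists (f x) => //; exists x.
  by exists r; apply: pb_comp.
Qed.

Lemma oi_iso X Y (f : srs_hom X Y) (g : srs_hom Y X) :
  srs_comp g f = srs_id X -> srs_comp f g = srs_id Y -> open_imm f.
Proof.
move=> gf fg; have gfK : cancel f g.
  by move=> x; have := congr1 (fun u : srs_hom _ _ => u x) gf.
have fgK : cancel g f.
  by move=> x; have := congr1 (fun u : srs_hom _ _ => u x) fg.
split=> [|V oV|V U h hU s|V U h hU t].
- exact: can_inj gfK.
- have -> : f @` V = g @^-1` V.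
    apply/seteqP; split=> [_ [x Vx <-]|y Vy]; first by rewrite /= gfK.
    by exists (g y).
  by move/continuousP : (@srs_map_continuous _ _ _ g); apply.
- move=> e; have hg : U `<=` g @^-1` V by move=> _ /hU[x Vx <-]; rewrite /= gfK.
  have h1 : U `<=` srs_id Y @^-1` U by [].
  have h2 : U `<=` srs_comp f g @^-1` U by move=> y; rewrite /= fgK.
  have := pb_comp h2 hg h s; rewrite e rmorph0 (pb_eq _ h1 _ fg) pb_id.
  by rewrite restr_id.
- have hg : U `<=` g @^-1` V by move=> _ /hU[x Vx <-]; rewrite /= gfK.
  have h1 : V `<=` srs_id X @^-1` V by [].
  have h2 : V `<=` srs_comp g f @^-1` V by move=> y; rewrite /= gfK.
  exists (pb hg t); rewrite -(pb_comp h2) (pb_eq _ h1 _ gf) pb_id.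
  by rewrite restr_id.
Qed.

Section Inclusion.
Variables (X : super_ringed_space k) (U : opens X).

Lemma set_val_continuous : continuous (set_val : set_type U -> X).
Proof. by apply/continuousP => V oV; exists V. Qed.

Lemma incl_image (V : opens X) :
  image_opens (preim_opens set_val_continuous V) `<=` V.
Proof. by move=> _ [x Vx <-]. Qed.

Program Definition incl : srs_hom (open_subspace U) X :=
  @SrsHom k (open_subspace U) X set_val set_val_continuous
    (fun V => restr 'O_X (@incl_image V)) _.
Next Obligation. by move=> V W h s /=; rewrite !restr_trans; apply: restr_irr. Qed.

Lemma incl_pb (V : opens X) (W : opens (open_subspace U))
  (h : W `<=` incl @^-1` V) (h' : image_opens W `<=` V) s :
  pb h s = restr 'O_X h' s.
Proof. by rewrite /pb /= restr_trans; apply: restr_irr. Qed.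

Lemma incl_oi : open_imm incl.
Proof.
split=> [x y /val_inj//|V oV|V W h hW s|V W h hW t].
- exact: (image_open (Opens oV)).
- have h' : image_opens V `<=` W by move=> _ [x Vx <-]; apply: h.
  rewrite (incl_pb h h') => e.
  rewrite -[s](restr_id (fun _ h => h)) -(restr_comp h' hW).
  by rewrite e rmorph0.
- have h' : image_opens V `<=` W by move=> _ [x Vx <-]; apply: h.
  have hW' : W `<=` image_opens V by [].
  exists (restr 'O_X hW' (t : 'O_X (image_opens V))); rewrite (incl_pb h h').
  by rewrite restr_trans; exact: (@restr_id k X 'O_X (image_opens V)).
Qed.

Lemma incl_range x : (U : set X) x -> exists y, incl y = x.
Proof. by move=> Ux; exists (exist _ x (mem_set Ux)). Qed.

Lemma incl_in y : (U : set X) (incl y).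
Proof. exact: set_valP. Qed.

End Inclusion.

Lemma oi_factor X Y Z (g : srs_hom Y Z) (f : srs_hom X Y) :
  open_imm g -> open_imm (srs_comp g f) -> open_imm f.
Proof.
move=> og ogf.
have im (V : set X) : f @` V = g @^-1` (srs_comp g f @` V).
  apply/seteqP; split=> [_ [x Vx <-]|y [x Vx /(oi_inj og) <-]]; last by exists x.
  by exists x.
split=> [x y xy|V oV|V U h hU s|V U h hU t].
- by apply: (oi_inj ogf); rewrite /= xy.
- rewrite im; move/continuousP : (@srs_map_continuous _ _ _ g); apply.
  exact: (oi_open ogf).
- have [|s' <-] := oi_epi og (oi_imageP og (V := U)) _ s; first by [].
  have h' : V `<=` srs_comp g f @^-1` (oi_image og U).
    by move=> x Vx; exists (f x) => //; apply: h.
  rewrite -(pb_comp h') => /(oi_mono ogf) ->; rewrite ?rmorph0 //.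
  by move=> _ [_ /hU[x Vx <-] <-]; exists x.
- have h' : V `<=` srs_comp g f @^-1` (oi_image ogf V) by move=> x Vx; exists x.
  have [|r <-] := oi_epi ogf h' _ t; first by [].
  have hg : U `<=` g @^-1` (oi_image ogf V) by move=> _ /hU[x Vx <-]; exists x.
  by exists (pb hg r); rewrite -(pb_comp h').
Qed.

Lemma oi_ext X Y (f g : srs_hom X Y) :
  (forall x, exists Z (j : srs_hom Z X), [/\ open_imm j, exists z, j z = x &
     srs_comp f j = srs_comp g j]) -> f = g.
Proof.
move=> loc; have fg : f =1 g.
  move=> x; have [Z [j [_ [z <-] e]]] := loc x.
  by have := congr1 (fun u : srs_hom _ _ => u z) e.
apply: srs_ext_local => // V s x Vx.
have [Z [j [oj [z zx] e]]] := loc x.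
pose W := preim_opens (srs_map_continuous (srs_comp f j)) V.
have hf : oi_image oj W `<=` f @^-1` V by move=> _ [y Wy <-].
have hg : oi_image oj W `<=` g @^-1` V.
  by move=> _ [y Wy <-]; rewrite /preimage /= -fg.
exists (oi_image oj W), hf, hg; split; first by exists z => //; rewrite /W /= zx.
apply: (oi_section_inj oj (h := oi_imageP oj (V := W))) => //.
have h1 : W `<=` srs_comp f j @^-1` V by [].
have h2 : W `<=` srs_comp g j @^-1` V by move=> y; rewrite /W /= fg.
by rewrite -(pb_comp h1) -(pb_comp h2); apply: pb_eq.
Qed.

End Pullback.

(** * Gluing along probes *)

(** A class of test spaces, in which every open subset of a member is again
    isomorphic to a member. *)
Definition closed_under_opens (k : fieldType) (Pr : Type)
    (psp : Pr -> super_ringed_space k) :=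
  forall d (W : opens (psp d)),
  exists d' (u : srs_hom (psp d') (psp d)), open_imm u /\
    forall z, (W : set (psp d)) z <-> exists y, u y = z.

Section Probes.
Variables (k : fieldType) (Pr : Type) (psp : Pr -> super_ringed_space k).

Hypothesis psp_sub : closed_under_opens psp.

Lemma fullS (Y Z : super_ringed_space k) (u : srs_hom Y Z) :
  full Y `<=` u @^-1` (full Z).
Proof. by []. Qed.

Lemma probe_sub_near d (W : opens (psp d)) z : (W : set (psp d)) z ->
  exists d' (u : srs_hom (psp d') (psp d)), [/\ open_imm u,
    full _ `<=` u @^-1` W, (exists y, u y = z) & W `<=` u @` (full _)].
Proof.
move=> Wz; have [d' [u [ou uW]]] := psp_sub W; exists d', u; split=> //.
- by move=> y _; apply/uW; exists y.
- exact/uW.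
- by move=> y /uW[t <-]; exists t.
Qed.

Section Sieve.
Variables (Q : super_ringed_space k) (W : opens Q).
Variable ok : forall d, srs_hom (psp d) Q -> Prop.
Hypothesis okW : forall d (j : srs_hom (psp d) Q),
  ok j -> full (psp d) `<=` j @^-1` W.
Hypothesis ok_cov : forall x, (W : set Q) x ->
  exists d (j : srs_hom (psp d) Q), [/\ ok j, open_imm j & exists z, j z = x].

Lemma sieve_sep (a b : 'O_Q W) :
  (forall d (j : srs_hom (psp d) Q) (h : ok j), pb (okW h) a = pb (okW h) b) ->
  a = b.
Proof.
move=> ab; apply: section_local => x Wx.
have [d [j [hj oj [z zx]]]] := ok_cov Wx.
have hC : oi_image oj (full _) `<=` W by move=> _ [y _ <-]; apply: okW hj _ I.
exists (oi_image oj (full _)), hC; split; first by exists z.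
apply: (oi_section_inj oj (h := oi_imageP oj (V := full _))) => //.
by rewrite !(pb_restr _ _ (okW hj)).
Qed.

Hypothesis ok_comp : forall d d' (j : srs_hom (psp d) Q)
  (u : srs_hom (psp d') (psp d)), ok j -> ok (srs_comp j u).
Variable tau : forall d (j : srs_hom (psp d) Q), ok j ->
  'O_(psp d) (full (psp d)).
Hypothesis tau_nat : forall d d' (j : srs_hom (psp d) Q) (h : ok j)
  (u : srs_hom (psp d') (psp d)) (hu : ok (srs_comp j u)),
  pb (fullS u) (tau h) = tau hu.

Lemma tau_eq d (j j' : srs_hom (psp d) Q) (h : ok j) (h' : ok j') :
  j = j' -> tau h = tau h'.
Proof. by move=> e; case: _ / e h' => h'; rewrite (Prop_irrelevance h h'). Qed.

(** Sections of [Q] over [W] are the same as compatible sections on the probes of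
    a covering sieve [ok] on [W]; here an arbitrary [j] in the sieve is compared
    with the covering open immersions by lifting it locally through them. *)
Lemma sieve_glue : exists a : 'O_Q W,
  forall d (j : srs_hom (psp d) Q) (h : ok j), pb (okW h) a = tau h.
Proof.
pose J := {x : Q | (W : set Q) x}.
pose good (C : opens Q) (a : 'O_Q C) := forall d (j : srs_hom (psp d) Q)
  (h : ok j) (hC : full _ `<=` j @^-1` C), pb hC a = tau h.
have wit (x : J) : exists C : {C : opens Q | C `<=` W},
    (sval C : set Q) (sval x) /\ exists a : 'O_Q (sval C), good (sval C) a.
  have [d [j [hj oj [z zx]]]] := ok_cov (proj2_sig x).
  have hC : oi_image oj (full _) `<=` W by move=> _ [y _ <-]; apply: okW hj _ I.
  exists (exist (fun C : opens Q => C `<=` W) _ hC); split=> /=.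
    by rewrite -zx; exists z.
  have [|a ea] := oi_epi oj (oi_imageP oj (V := full _)) _ (tau hj); first by [].
  exists a => d' e he hC'; have [|v ev] := @oi_lift _ _ _ _ j e oj.
    by move=> y; have [t _ te] := hC' y I; exists t.
  have hje : full _ `<=` srs_comp j v @^-1` oi_image oj (full _).
    by move=> y _; exists (v y).
  have hv : ok (srs_comp j v) by rewrite ev.
  rewrite -(pb_eq hje hC' _ ev) (pb_comp hje (fullS v) (oi_imageP oj (V := full _))) ea.
  by rewrite (tau_nat hj hv); apply: tau_eq.
pose C x := sval (sval (cid (wit x))).
have hC x : C x `<=` W := proj2_sig (sval (cid (wit x))).
have Cx x : (C x : set Q) (sval x) := proj1 (svalP (cid (wit x))).
pose a x : 'O_Q (C x) := sval (cid (proj2 (svalP (cid (wit x))))).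
have aP x : good (C x) (a x) := svalP (cid (proj2 (svalP (cid (wit x))))).
have cov : W `<=` \bigcup_x C x.
  by move=> x Wx; exists (exist _ x Wx); last exact: (Cx (exist _ x Wx)).
have [|t tP] := @sheaf_glue k Q 'O_Q W J C hC cov a.
  move=> x y W' hx hy; apply: section_local => w W'w.
  have [d [j [hj oj [z zw]]]] := ok_cov (hC _ _ (hx _ W'w)).
  have [|d' [u [ou uW [t tz] _]]] :=
    @probe_sub_near d (preim_opens (srs_map_continuous j) W') z; first by rewrite /= zw.
  have oju := oi_comp oj ou.
  have hW' : oi_image oju (full _) `<=` W' by move=> _ [s _ <-]; apply: uW.
  exists (oi_image oju (full _)), hW'; split; first by exists t => //=; rewrite tz.
  apply: (oi_section_inj oju (h := oi_imageP oju (V := full _))) => //.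
  have h1 : full _ `<=` srs_comp j u @^-1` W' by move=> s _; apply: uW.
  have h2 : full _ `<=` srs_comp j u @^-1` C x by move=> s _; apply: hx; apply: h1.
  have h3 : full _ `<=` srs_comp j u @^-1` C y by move=> s _; apply: hy; apply: h1.
  rewrite !(pb_restr _ _ h1) (pb_restr _ _ h2) (pb_restr _ _ h3).
  by rewrite !(aP _ _ _ (ok_comp u hj)).
exists t => d j hj; apply: section_local => z _.
have [x _ xC] := cov _ (okW hj (I : (full (psp d) : set _) z)).
have [|d' [u [ou uC [y yz] _]]] :=
  @probe_sub_near d (preim_opens (srs_map_continuous j) (C x)) z; first by [].
exists (oi_image ou (full _)), (fun _ _ => I); split; first by exists y.
apply: (oi_section_inj ou (h := oi_imageP ou (V := full _))) => //.
rewrite !(pb_restr _ _ (fullS u)) (tau_nat hj (ok_comp u hj)).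
have h1 : full _ `<=` srs_comp j u @^-1` W by move=> s _; apply: okW hj _ I.
have h2 : full _ `<=` srs_comp j u @^-1` C x by move=> s _; apply: uC.
by rewrite -(pb_comp h1) -(pb_restr (hC x) h2) tP; apply: aP.
Qed.

End Sieve.

(** As the probes will be open subsets of affine super-spaces, the spaces covered
    by probes will be the super-manifolds. *)
Definition covered (X : super_ringed_space k) := forall x : X,
  exists d (j : srs_hom (psp d) X), open_imm j /\ exists z, j z = x.

Lemma covered_in (X : super_ringed_space k) (W : opens X) x : covered X -> (W : set X) x ->
  exists d (j : srs_hom (psp d) X), [/\ full _ `<=` j @^-1` W, open_imm j &
    exists z, j z = x].
Proof.
move=> cX Wx; have [d [j [oj [z zx]]]] := cX x.
have [|d' [u [ou uW [y yz] _]]] :=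
  @probe_sub_near d (preim_opens (srs_map_continuous j) W) z; first by rewrite /= zx.
exists d', (srs_comp j u); split; [exact: uW|exact: oi_comp|].
by exists y => /=; rewrite yz.
Qed.

Section Colimit.
Variables (Q Z : super_ringed_space k).
Hypothesis Qcov : covered Q.
Variable H : forall d, srs_hom (psp d) Q -> srs_hom (psp d) Z.
Hypothesis Hnat : forall d d' (j : srs_hom (psp d) Q)
  (u : srs_hom (psp d') (psp d)), H (srs_comp j u) = srs_comp (H j) u.

(** The value at [x] is read off a chart around [x]; any other probe through [x]
    factors through this chart after shrinking, and [H] is natural. *)
Lemma colimit_map : exists h : Q -> Z,
  forall d (j : srs_hom (psp d) Q) z, h (j z) = H j z.
Proof.
pose ch x := cid (Qcov x); pose d x := sval (ch x).
pose e x : srs_hom (psp (d x)) Q := sval (cid (svalP (ch x))).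
have eP x : open_imm (e x) /\ exists z, e x z = x := svalP (cid (svalP (ch x))).
pose z x := sval (cid (proj2 (eP x))).
have ez x : e x (z x) = x := svalP (cid (proj2 (eP x))).
exists (fun x => H (e x) (z x)) => d0 j y; set x := j y.
have [oe _] := eP x.
pose W := preim_opens (srs_map_continuous j) (oi_image oe (full _)).
have [|d' [u [ou uW [w wy] _]]] := @probe_sub_near d0 W y.
  by exists (z x) => //; rewrite ez.
have [|v ev] := @oi_lift k (psp d') _ _ (e x) (srs_comp j u) oe.
  by move=> s; have [t _ ts] := uW s I; exists t.
have -> : z x = v w.
  apply: (oi_inj oe); rewrite ez.
  by have := congr1 (fun f : srs_hom _ _ => f w) ev; rewrite /= wy.
have := congr1 (fun f => H f w) ev; rewrite /= !Hnat /=.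
by rewrite wy.
Qed.

(** A space covered by probes is the colimit of the probes over it. Universal
    properties of such spaces therefore need only be tested on probes. *)
Lemma probe_colimit : exists h : srs_hom Q Z,
  forall d (j : srs_hom (psp d) Q), srs_comp h j = H j.
Proof.
have [h hH] := colimit_map.
have hc : continuous h.
  apply/continuousP => V oV; rewrite openE => x Vx; rewrite /interior.
  have [d [j [oj [z zx]]]] := Qcov x.
  have oU : open (H j @^-1` V).
    by move/continuousP : (@srs_map_continuous _ _ _ (H j)); apply.
  apply: (@filterS _ _ _ (j @` (H j @^-1` V))); first by move=> _ [y Vy <-]; rewrite /= hH.
  apply: open_nbhs_nbhs; split; first exact: (oi_open oj).
  by exists z => //; rewrite /= -hH zx.
pose ok V d (j : srs_hom (psp d) Q) := full _ `<=` j @^-1` preim_opens hc V.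
have okH V d (j : srs_hom (psp d) Q) : ok V d j -> full _ `<=` H j @^-1` V.
  by move=> h' z /h'; rewrite /= hH.
have cov (V : opens Z) x := @covered_in Q (preim_opens hc V) x Qcov.
have char V : exists g : sa_hom ('O_Z V) ('O_Q (preim_opens hc V)),
    forall s d (j : srs_hom (psp d) Q) (h : ok V d j), pb h (g s) = pb (okH _ _ _ h) s.
  pose J := {x : {d : Pr & srs_hom (psp d) Q} | ok V _ (tagged x)}.
  pose toJ d (j : srs_hom (psp d) Q) (h : ok V d j) : J :=
    exist (fun x => ok V _ (tagged x)) (Tagged (fun d => srs_hom (psp d) Q) j) h.
  have [|s|g gP] := @sa_hom_of_char k ('O_Z V) ('O_Q (preim_opens hc V)) J
    (fun x => 'O_(psp (tag (sval x))) (full _))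
    (fun x => pb (okH _ _ _ (proj2_sig x))) (fun x => pb (proj2_sig x)).
  - move=> b b0; apply: (@sieve_sep Q (preim_opens hc V) (ok V) (fun _ _ h => h)).
      exact: cov.
    by move=> d j hj; rewrite rmorph0; exact: b0 (toJ d j hj).
  - have [||a aP] := @sieve_glue Q (preim_opens hc V) (ok V) (fun _ _ h => h) (cov V)
      _ (fun d j h => pb (okH _ _ _ h) s) _.
    + by move=> d d' j u hj z _; exact: (hj _ I).
    + move=> d d' j hj u hu; have h1 : full _ `<=` srs_comp (H j) u @^-1` V.
        by move=> z _; apply: okH hj _ I.
      by rewrite -(pb_comp h1); apply: pb_eq; rewrite Hnat.
    + by exists a => -[[d j] hj]; exact: (aP d j hj).
  - exists g => s d j hj; exact: gP s (toJ d j hj).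
pose g V := sval (cid (char V)).
have gP V s d (j : srs_hom (psp d) Q) (h : ok V d j) :
  pb h (g V s) = pb (okH _ _ _ h) s := svalP (cid (char V)) s d j h.
have gr (U V : opens Z) (hV : V `<=` U) (s : 'O_Z U) :
    g V (restr 'O_Z hV s) = restr 'O_Q (preim_opensS (cf := hc) hV) (g U s).
  apply: (@sieve_sep Q (preim_opens hc V) (ok V) (fun _ _ h => h)).
    exact: cov.
  move=> d j hj; have h1 : ok U d j by move=> z /hj/hV.
  by rewrite gP (pb_restr _ _ h1) gP (pb_restr _ _ (okH _ _ _ h1)).
exists (SrsHom gr) => d j; apply: srs_ext_local => [z|V s z Vz]; first exact: hH.
pose U := preim_opens (srs_map_continuous (H j)) V.
have hU : U `<=` srs_comp (SrsHom gr) j @^-1` V by move=> y; rewrite /U /= hH.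
exists U, hU, (fun _ p => p).
have Uz : (U : set _) z by rewrite /U /= -hH.
split=> //; have [d' [u [ou uU _ Uu]]] := probe_sub_near Uz.
apply: (oi_section_inj ou (h := uU)) => //.
have hju : ok V d' (srs_comp j u) by move=> y _; apply: hU; apply: uU.
have h1 : full _ `<=` srs_comp (srs_comp (SrsHom gr) j) u @^-1` V by [].
have h2 : full _ `<=` srs_comp (SrsHom gr) (srs_comp j u) @^-1` V by [].
have h3 : full _ `<=` srs_comp (H j) u @^-1` V by move=> y _; apply: uU.
rewrite -(pb_comp h1) -(pb_comp h3) -(pb_eq h2 h1 s (compA (c := SRS k) _ _ _)).
have h4 : preim_opens hc V `<=` SrsHom gr @^-1` V by [].
have e : pb h4 s = g V s by rewrite /pb /= restr_id.
rewrite (pb_comp h2 hju h4) e gP.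
by apply: pb_eq; rewrite Hnat.
Qed.

End Colimit.
End Probes.

(** * The product as a sheaf on probes *)

Section Box.
Variables (I : finType) (T : I -> topologicalType).

(** On a finite product the boxes of open sets generate the topology; stating it
    directly keeps the verification of continuity elementary. *)
Definition box := forall i, T i.

HB.instance Definition _ := gen_eqMixin box.
HB.instance Definition _ := gen_choiceMixin box.

Definition box_open (A : set box) := forall x, A x ->
  exists B : forall i, opens (T i), (forall i, (B i : set (T i)) (x i)) /\
    forall y : box, (forall i, (B i : set (T i)) (y i)) -> A y.

Lemma box_openT : box_open setT.
Proof. by move=> x _; exists (fun i => Opens (@openT (T i))). Qed.

Lemma box_openI : setI_closed box_open.
Proof.
move=> A B Ao Bo x [/Ao[C [Cx CA]] /Bo[D [Dx DB]]].
exists (fun i => Opens (openI (oset_open (C i)) (oset_open (D i)))).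
split=> [i|y CDy]; first by split.
by split; [apply: CA => i; case: (CDy i)|apply: DB => i; case: (CDy i)].
Qed.

Lemma box_open_bigU (J : Type) (f : J -> set box) :
  (forall j, box_open (f j)) -> box_open (\bigcup_j f j).
Proof.
move=> fo x [j _ /fo[B [Bx Bf]]]; exists B; split=> // y By.
by exists j => //; apply: Bf.
Qed.

HB.instance Definition _ := isOpenTopological.Build box
  box_openT box_openI box_open_bigU.

Lemma box_openE (A : set box) : open A = box_open A.
Proof. by []. Qed.

Lemma box_proj_continuous i : continuous (fun x : box => x i).
Proof.
apply/continuousP => V oV; rewrite box_openE => x Vx.
have ex j : exists B : opens (T j), (B : set (T j)) (x j) /\
    forall y : box, (B : set (T j)) (y j) -> i = j -> V (y i).
  have [ij|nij] := pselect (i = j); last by exists (Opens (@openT (T j))).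
  by case: _ / ij; exists (Opens oV).
exists (fun j => sval (cid (ex j))); split=> [j|y By].
  exact: (proj1 (svalP (cid (ex j)))).
exact: (proj2 (svalP (cid (ex i))) y (By i)).
Qed.

End Box.

Lemma box_continuous (I : finType) (T : I -> topologicalType)
  (Y : topologicalType) (f : forall i, Y -> T i) :
  (forall i, continuous (f i)) -> continuous (fun y => (fun i => f i y) : box T).
Proof.
move=> fc; apply/continuousP => A; rewrite box_openE => oA.
rewrite openE => y /oA[B [By BA]]; rewrite /interior.
apply: (@filterS _ _ _ [set z | forall i, (B i : set (T i)) (f i z)]).
  by move=> z Bz; apply: BA.
apply: filter_forall => i; apply: fc.
by apply: open_nbhs_nbhs; split; [exact: oset_open|exact: By].
Qed.

Section ProbeProduct.
Variables (k : fieldType) (Pr : Type) (psp : Pr -> super_ringed_space k).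
Hypothesis psp_sub : closed_under_opens psp.

Variables (I : finType) (X : I -> super_ringed_space k).

Local Notation B := (box (fun i => carrier (X i))).
Local Notation F d := (full (psp d)).

Definition into d (f : forall i, srs_hom (psp d) (X i)) (W : set B) :=
  forall z, W (fun i => f i z).

(** By the Yoneda lemma a section over [W] of the product to be constructed is
    determined by its pullbacks along all morphisms from probes into [W], that
    is, along all tuples [f] of morphisms to the factors. This is taken as the
    definition, so that neither charts of the factors nor gluing data enter. *)
Record psec (W : opens B) := Psec {
  ps_fun :> forall d (f : forall i, srs_hom (psp d) (X i)), into f W ->
    'O_(psp d) (F d);
  ps_nat : forall d d' (f : forall i, srs_hom (psp d) (X i)) (hf : into f W)
    (u : srs_hom (psp d') (psp d)) (hfu : into (fun i => srs_comp (f i) u) W),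
    pb (fullS u) (ps_fun hf) = ps_fun hfu }.

HB.instance Definition _ W := gen_eqMixin (psec W).
HB.instance Definition _ W := gen_choiceMixin (psec W).

Lemma psec_ext W (s t : psec W) :
  (forall d (f : forall i, srs_hom (psp d) (X i)) (h : into f W),
     s d f h = t d f h) -> s = t.
Proof.
case: s => s sn; case: t => t tn /= st.
have {st} est : s = t.
  apply: functional_extensionality_dep => d.
  apply: functional_extensionality_dep => f.
  by apply: functional_extensionality_dep => h.
by case: _ / est tn => tn; rewrite (Prop_irrelevance sn tn).
Qed.

Lemma psec_irr W (s : psec W) d (f : forall i, srs_hom (psp d) (X i))
  (h h' : into f W) : s d f h = s d f h'.
Proof. by rewrite (Prop_irrelevance h h'). Qed.

Lemma psec_eq W (s : psec W) d (f g : forall i, srs_hom (psp d) (X i))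
  (h : into f W) (h' : into g W) : (forall i, f i = g i) -> s d f h = s d g h'.
Proof.
move=> fg; have e : f = g by apply: functional_extensionality_dep.
by case: _ / e h' => h'; apply: psec_irr.
Qed.

Section Ring.
Variable W : opens B.
Implicit Types s t : psec W.

Program Definition ps_cst (c : k) : psec W :=
  @Psec W (fun d f h => sa_alg _ c) _.
Next Obligation. by move=> c d d' f hf u hfu; rewrite sa_fun_alg. Qed.

Program Definition ps_zero : psec W := @Psec W (fun d f h => 0) _.
Next Obligation. by move=> d d' f hf u hfu; rewrite rmorph0. Qed.

Program Definition ps_one : psec W := @Psec W (fun d f h => 1) _.
Next Obligation. by move=> d d' f hf u hfu; rewrite rmorph1. Qed.

Program Definition ps_opp s : psec W := @Psec W (fun d f h => - s d f h) _.
Next Obligation. by move=> s d d' f hf u hfu; rewrite rmorphN (ps_nat _ _ hfu). Qed.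

Program Definition ps_add s t : psec W :=
  @Psec W (fun d f h => s d f h + t d f h) _.
Next Obligation.
by move=> s t d d' f hf u hfu; rewrite rmorphD !(ps_nat _ _ hfu).
Qed.

Program Definition ps_mul s t : psec W :=
  @Psec W (fun d f h => s d f h * t d f h) _.
Next Obligation.
by move=> s t d d' f hf u hfu; rewrite rmorphM !(ps_nat _ _ hfu).
Qed.

Lemma ps_addA : associative ps_add.
Proof. by move=> a b c; apply: psec_ext => d f h /=; rewrite addrA. Qed.
Lemma ps_addC : commutative ps_add.
Proof. by move=> a b; apply: psec_ext => d f h /=; rewrite addrC. Qed.
Lemma ps_add0 : left_id ps_zero ps_add.
Proof. by move=> a; apply: psec_ext => d f h /=; rewrite add0r. Qed.
Lemma ps_addN : left_inverse ps_zero ps_opp ps_add.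
Proof. by move=> a; apply: psec_ext => d f h /=; rewrite addNr. Qed.
Lemma ps_mulA : associative ps_mul.
Proof. by move=> a b c; apply: psec_ext => d f h /=; rewrite mulrA. Qed.
Lemma ps_mul1 : left_id ps_one ps_mul.
Proof. by move=> a; apply: psec_ext => d f h /=; rewrite mul1r. Qed.
Lemma ps_mulr1 : right_id ps_one ps_mul.
Proof. by move=> a; apply: psec_ext => d f h /=; rewrite mulr1. Qed.
Lemma ps_mulDl : left_distributive ps_mul ps_add.
Proof. by move=> a b c; apply: psec_ext => d f h /=; rewrite mulrDl. Qed.
Lemma ps_mulDr : right_distributive ps_mul ps_add.
Proof. by move=> a b c; apply: psec_ext => d f h /=; rewrite mulrDr. Qed.

HB.instance Definition _ := GRing.isZmodule.Build (psec W)
  ps_addA ps_addC ps_add0 ps_addN.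
HB.instance Definition _ := GRing.Zmodule_isPzRing.Build (psec W)
  ps_mulA ps_mul1 ps_mulr1 ps_mulDl ps_mulDr.

Lemma ps_cst_zmod_morphism : zmod_morphism ps_cst.
Proof. by move=> a b; apply: psec_ext => d f h /=; rewrite rmorphB. Qed.
Lemma ps_cst_monoid_morphism : monoid_morphism ps_cst.
Proof.
split=> [|a b]; apply: psec_ext => d f h /=; first by rewrite rmorph1.
by rewrite rmorphM.
Qed.

HB.instance Definition _ := GRing.isZmodMorphism.Build k (psec W) ps_cst
  ps_cst_zmod_morphism.
HB.instance Definition _ := GRing.isMonoidMorphism.Build k (psec W) ps_cst
  ps_cst_monoid_morphism.

Definition ps_part (i : bool) : set (psec W) := [set s | forall d
  (f : forall i, srs_hom (psp d) (X i)) (h : into f W), sa_part _ i (s d f h)].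

(** The even and the odd part of each value are unique, hence natural. *)
Lemma ps_part_span s : exists s0 s1,
  [/\ ps_part false s0, ps_part true s1 & s = s0 + s1].
Proof.
have ex d f h := sa_part_span (s d f h).
pose s0 d f h := sval (cid (ex d f h)).
pose s1 d f h := sval (cid (svalP (cid (ex d f h)))).
have sP d f h : [/\ sa_part _ false (s0 d f h), sa_part _ true (s1 d f h) &
    s d f h = s0 d f h + s1 d f h] := svalP (cid (svalP (cid (ex d f h)))).
have nat01 d d' f (hf : into f W) (u : srs_hom (psp d') (psp d)) hfu :
    pb (fullS u) (s0 d f hf) = s0 d' (fun i => srs_comp (f i) u) hfu /\
    pb (fullS u) (s1 d f hf) = s1 d' (fun i => srs_comp (f i) u) hfu.
  have [p0 p1 e] := sP d f hf; have [q0 q1 e'] := sP d' _ hfu.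
  have := ps_nat s hf hfu; rewrite e e' rmorphD => /eqP.
  rewrite -subr_eq0 opprD addrACA addr_eq0 => /eqP e0.
  have N (A : super_algebra k) i (a : A) : sa_part A i a -> sa_part A i (- a).
    by move=> pa; rewrite -mulN1r -(rmorphN1 (sa_alg A)); apply: sa_partZ.
  have z0 : pb (fullS u) (s0 d f hf) - s0 d' (fun i => srs_comp (f i) u) hfu = 0.
    apply: sa_part_direct.
      by apply: sa_partD; [exact: sa_fun_part|exact: N].
    by rewrite e0; apply: (N); apply: sa_partD; [exact: sa_fun_part|exact: N].
  split; apply/eqP; rewrite -subr_eq0; first by rewrite z0.
  by rewrite -oppr_eq0 -e0 z0.
exists (Psec (fun d d' f hf u hfu => (nat01 d d' f hf u hfu).1)).
exists (Psec (fun d d' f hf u hfu => (nat01 d d' f hf u hfu).2)).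
split=> [d f h|d f h|]; first by case: (sP d f h).
  by case: (sP d f h).
by apply: psec_ext => d f h /=; case: (sP d f h).
Qed.

Program Definition psec_super_algebra : super_algebra k :=
  @SuperAlgebra k (psec W) (GRing.RMorphism.clone k (psec W) ps_cst _) _
    ps_part _ _ _ ps_part_span _ _ _ _ _.
Next Obligation. by move=> c s; apply: psec_ext => d f h /=; rewrite sa_algC. Qed.
Next Obligation. by move=> i d f h; apply: sa_part0. Qed.
Next Obligation. by move=> i a b pa pb d f h; apply: sa_partD. Qed.
Next Obligation. by move=> i c a pa d f h; apply: sa_partZ. Qed.
Next Obligation.
by move=> a p0 p1; apply: psec_ext => d f h /=; apply: sa_part_direct.
Qed.
Next Obligation. by move=> d f h; apply: sa_part1. Qed.
Next Obligation. by move=> i j a b pa pb d f h; apply: sa_partM. Qed.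
Next Obligation. by move=> a b pa; apply: psec_ext => d f h /=; apply: sa_even_central. Qed.
Next Obligation. by move=> a b pa pb; apply: psec_ext => d f h /=; apply: sa_odd_anticomm. Qed.

End Ring.

Section Restriction.
Variables (U V : opens B) (hVU : V `<=` U).

Lemma intoS d (f : forall i, srs_hom (psp d) (X i)) : into f V -> into f U.
Proof. by move=> fV z; apply: hVU. Qed.

Program Definition ps_restr_fun (s : psec U) : psec V :=
  @Psec V (fun d f h => s d f (intoS h)) _.
Next Obligation. by move=> s d d' f hf u hfu; apply: ps_nat. Qed.

Lemma ps_restr_zmod_morphism : zmod_morphism ps_restr_fun.
Proof. by move=> a b; apply: psec_ext. Qed.
Lemma ps_restr_monoid_morphism : monoid_morphism ps_restr_fun.
Proof. by split=> [|a b]; apply: psec_ext. Qed.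

HB.instance Definition _ := GRing.isZmodMorphism.Build (psec U) (psec V)
  ps_restr_fun ps_restr_zmod_morphism.
HB.instance Definition _ := GRing.isMonoidMorphism.Build (psec U) (psec V)
  ps_restr_fun ps_restr_monoid_morphism.

Program Definition ps_restr :
    sa_hom (psec_super_algebra U) (psec_super_algebra V) :=
  @SaHom k (psec_super_algebra U) (psec_super_algebra V)
    (GRing.RMorphism.clone (psec U) (psec V) ps_restr_fun _) _ _.
Next Obligation. by move=> c; apply: psec_ext. Qed.
Next Obligation. by move=> i a pa d f h; apply: pa. Qed.

End Restriction.

Lemma cover_probe (U : opens B) (J : Type) (C : J -> opens B)
  (cov : U `<=` \bigcup_j C j) d (f : forall i, srs_hom (psp d) (X i)) :
  into f U -> forall z, exists j d' (u : srs_hom (psp d') (psp d)),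
    [/\ open_imm u, into (fun i => srs_comp (f i) u) (C j) &
        exists y, u y = z].
Proof.
move=> fU z; have [j _ Cz] := cov _ (fU z).
have fc : continuous ((fun y => (fun i => f i y)) : psp d -> B).
  by apply: box_continuous => i; apply: srs_map_continuous.
have [d' [u [ou uW]]] := psp_sub (preim_opens fc (C j)).
exists j, d', u; split=> //; last exact/uW.
by move=> y; apply/uW; exists y.
Qed.

Program Definition psec_sheaf : sa_sheaf k B :=
  @SaSheaf k B psec_super_algebra ps_restr _ _ _ _.
Next Obligation. by move=> U h s; apply: psec_ext => d f hf /=; apply: psec_irr. Qed.
Next Obligation. by move=> U V W hV hW hWU s; apply: psec_ext => d f hf /=; apply: psec_irr. Qed.
Next Obligation.
move=> U J C hC cov s t st; apply: psec_ext => d f hf.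
apply: section_local => z _.
have [j [d' [u [ou fu [y yz]]]]] := cover_probe cov hf z.
exists (oi_image ou (full _)), (fun _ _ => Logic.I).
split; first by exists y.
apply: (oi_section_inj ou (h := oi_imageP ou (V := full _))) => //.
have h2 := intoS (hC j) fu.
rewrite !(pb_restr _ _ (fullS u)) !(ps_nat _ _ h2).
have := congr1 (fun s : psec (C j) => s d' _ fu) (st j) => /=.
by rewrite !(psec_irr _ _ h2).
Qed.
Next Obligation.
move=> U J C hC cov s compat.
(* The value on [d] is glued from the subprobes of [d] that are mapped into some
   [C j]; the compatibility of the [s j] makes the choice of [j] irrelevant. *)
have loc d (f : forall i, srs_hom (psp d) (X i)) (hf : into f U) :
    exists a : 'O_(psp d) (F d), forall d' (u : srs_hom (psp d') (psp d)) j
      (h : into (fun i => srs_comp (f i) u) (C j)), pb (fullS u) a = s j d' _ h.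
  pose ok d' (u : srs_hom (psp d') (psp d)) :=
    exists j, into (fun i => srs_comp (f i) u) (C j).
  pose tau d' (u : srs_hom (psp d') (psp d)) (h : ok d' u) :=
    s (sval (cid h)) d' _ (svalP (cid h)).
  have tauE d' (u : srs_hom (psp d') (psp d)) (h : ok d' u) j
      (h' : into (fun i => srs_comp (f i) u) (C j)) : tau d' u h = s j d' _ h'.
    have oW : open ((C (sval (cid h)) : set B) `&` C j) by apply: openI; apply: oset_open.
    have := compat (sval (cid h)) j (Opens oW) (fun _ p => p.1) (fun _ p => p.2).
    have hW : into (fun i => srs_comp (f i) u) (Opens oW).
      by move=> z; split; [apply: (svalP (cid h))|apply: h'].
    move/(congr1 (fun s : psec (Opens oW) => s d' _ hW)) => /=.
    by rewrite (psec_irr _ _ (svalP (cid h))) (psec_irr _ _ h').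
  have [|||a aP] := @sieve_glue _ _ _ psp_sub (psp d) (F d) ok (fun _ u _ => fullS u)
    _ _ tau _.
  - move=> z _; have [j [d' [u [ou fu yz]]]] := cover_probe cov hf z.
    by exists d', u; split=> //; exists j.
  - by move=> d1 d2 u v [j h]; exists j => z; apply: h.
  - move=> d1 d2 u [j h] v hv.
    have hj : into (fun i => srs_comp (srs_comp (f i) u) v) (C j) by move=> z; apply: h.
    rewrite (tauE _ _ _ _ h) (ps_nat _ _ hj).
    have hj' : into (fun i => srs_comp (f i) (srs_comp u v)) (C j) by [].
    rewrite (tauE _ _ _ _ hj'); apply: psec_eq => i.
    exact: (esym (compA (c := SRS k) _ _ _)).
  - exists a => d' u j h; have hu : ok d' u by exists j.
    by rewrite -(tauE _ _ hu) -aP.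
pose t d f hf := sval (cid (loc d f hf)).
have tP d f hf d' u j h : pb (fullS u) (t d f hf) = s j d' _ h :=
  svalP (cid (loc d f hf)) d' u j h.
have tn d d' f hf (u : srs_hom (psp d') (psp d)) hfu :
    pb (fullS u) (t d f hf) = t d' (fun i => srs_comp (f i) u) hfu.
  apply: section_local => z _.
  have [j [d2 [v [ov fv [y yz]]]]] := cover_probe cov hfu z.
  exists (oi_image ov (full _)), (fun _ _ => Logic.I); split; first by exists y.
  apply: (oi_section_inj ov (h := oi_imageP ov (V := full _))) => //.
  rewrite !(pb_restr _ _ (fullS v)) (tP _ _ _ _ _ _ fv).
  have fv' : into (fun i => srs_comp (f i) (srs_comp u v)) (C j) by [].
  rewrite -(pb_comp (fullS (srs_comp u v))) (tP _ _ _ _ _ _ fv').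
  by apply: psec_eq => i; exact: (compA (c := SRS k)).
exists (Psec tn) => j; apply: psec_ext => d f hf /=.
have fid : into (fun i => srs_comp (f i) (srs_id _)) (C j) by [].
have h1 : full (psp d) `<=` srs_id (psp d) @^-1` full _ by [].
have := tP d f (intoS (hC j) hf) d (srs_id _) j fid.
rewrite pb_id restr_id => ->; apply: psec_eq => i.
exact: (compm1 (c := SRS k)).
Qed.

Definition probe_product : super_ringed_space k := SuperRingedSpace psec_sheaf.

End ProbeProduct.

(** * Projections, Yoneda morphisms and the universal property *)

Section ProductProperty.
Variables (k : fieldType) (Pr : Type) (psp : Pr -> super_ringed_space k).
Hypothesis psp_sub : closed_under_opens psp.

Variables (I : finType) (X : I -> super_ringed_space k).

Local Notation P := (probe_product psp_sub X).
Local Notation F d := (full (psp d)).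

Lemma probe_hom_ext d (Z : super_ringed_space k) (f g : srs_hom (psp d) Z) :
  f =1 g ->
  (forall (V : opens Z) s d' (u : srs_hom (psp d') (psp d))
     (h : F d' `<=` srs_comp f u @^-1` V) (h' : F d' `<=` srs_comp g u @^-1` V),
     pb h s = pb h' s) -> f = g.
Proof.
move=> fg fgu; apply: srs_ext_local => // V s z Vz.
pose U := preim_opens (srs_map_continuous f) V.
have hg : U `<=` g @^-1` V by move=> y; rewrite /U /= fg.
exists U, (preimP (V := V)), hg; split=> //.
have [|d' [u [ou uU _ Uu]]] := @probe_sub_near _ _ _ psp_sub d U z; first by [].
apply: (oi_section_inj ou (h := uU)) => //.
have h1 : F d' `<=` srs_comp f u @^-1` V by move=> y _; apply: uU.
have h2 : F d' `<=` srs_comp g u @^-1` V by move=> y _; apply: hg; apply: uU.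
by rewrite -(pb_comp h1) -(pb_comp h2).
Qed.

Section Eval.
Variables (W : opens P) (d : Pr) (f : forall i, srs_hom (psp d) (X i)).
Hypothesis fW : into f W.

Definition ps_eval_fun (s : 'O_P W) : 'O_(psp d) (F d) := (s : psec psp W) d f fW.

Lemma ps_eval_zmod_morphism : zmod_morphism ps_eval_fun.
Proof. by []. Qed.
Lemma ps_eval_monoid_morphism : monoid_morphism ps_eval_fun.
Proof. by []. Qed.

HB.instance Definition _ := GRing.isZmodMorphism.Build ('O_P W) ('O_(psp d) (F d))
  ps_eval_fun ps_eval_zmod_morphism.
HB.instance Definition _ := GRing.isMonoidMorphism.Build ('O_P W) ('O_(psp d) (F d))
  ps_eval_fun ps_eval_monoid_morphism.

Program Definition ps_eval : sa_hom ('O_P W) ('O_(psp d) (F d)) :=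
  @SaHom k ('O_P W) ('O_(psp d) (F d))
    (GRing.RMorphism.clone ('O_P W) ('O_(psp d) (F d)) ps_eval_fun _) _ _.
Next Obligation. by []. Qed.
Next Obligation. by move=> i s ps; apply: ps. Qed.

End Eval.

Section Projection.
Variable i : I.

Lemma proj_continuous : continuous (fun x : P => x i).
Proof. exact: box_proj_continuous. Qed.

Section Pull.
Variable V : opens (X i).

Program Definition proj_pull_fun (a : 'O_(X i) V) :
    'O_P (preim_opens proj_continuous V) :=
  @Psec _ _ _ I X (preim_opens proj_continuous V)
    (fun d f h => pb (fun z _ => h z : (V : set (X i)) (f i z)) a) _.
Next Obligation.
move=> a d d' f hf u hfu.
have h1 : F d' `<=` srs_comp (f i) u @^-1` V by move=> z _; apply: hfu.
by rewrite -(pb_comp h1); apply: pb_irr.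
Qed.

Lemma proj_pull_zmod_morphism : zmod_morphism proj_pull_fun.
Proof. by move=> a b; apply: psec_ext => d f h; exact: (rmorphB (pb _)). Qed.
Lemma proj_pull_monoid_morphism : monoid_morphism proj_pull_fun.
Proof.
split=> [|a b]; apply: psec_ext => d f h; first exact: (rmorph1 (pb _)).
exact: (rmorphM (pb _)).
Qed.

HB.instance Definition _ := GRing.isZmodMorphism.Build
  ('O_(X i) V) ('O_P (preim_opens proj_continuous V))
  proj_pull_fun proj_pull_zmod_morphism.
HB.instance Definition _ := GRing.isMonoidMorphism.Build
  ('O_(X i) V) ('O_P (preim_opens proj_continuous V))
  proj_pull_fun proj_pull_monoid_morphism.

Program Definition proj_pull :
    sa_hom ('O_(X i) V) ('O_P (preim_opens proj_continuous V)) :=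
  @SaHom k ('O_(X i) V) ('O_P (preim_opens proj_continuous V))
    (GRing.RMorphism.clone ('O_(X i) V) ('O_P (preim_opens proj_continuous V))
       proj_pull_fun _) _ _.
Next Obligation. by move=> c; apply: psec_ext => d f h; exact: (sa_fun_alg (pb _)). Qed.
Next Obligation. by move=> j a pa d f h; exact: (sa_fun_part (pb _) pa). Qed.

End Pull.

Program Definition proj : srs_hom P (X i) :=
  @SrsHom k P (X i) (fun x => x i) proj_continuous proj_pull _.
Next Obligation.
by move=> U V h s; apply: psec_ext => d f hf; exact: pb_restr.
Qed.

Lemma proj_pb (V : opens (X i)) (W : opens P) (h : W `<=` proj @^-1` V) a
  d (f : forall i, srs_hom (psp d) (X i)) (hf : into f W)
  (hV : F d `<=` f i @^-1` V) : (pb h a : psec psp W) d f hf = pb hV a.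
Proof. exact: pb_irr. Qed.

End Projection.

Section Yoneda.
Variables (d : Pr) (f : forall i, srs_hom (psp d) (X i)).

Definition yon_fun (z : psp d) : P := fun i => f i z.

Lemma yon_continuous : continuous yon_fun.
Proof. by apply: box_continuous => i; apply: srs_map_continuous. Qed.

(** The pullback of [s] to a probe [u] of [d] is prescribed to be the value of [s]
    at [f] composed with [u]. *)
Lemma yon_pull_ex (W : opens P) :
  exists g : sa_hom ('O_P W) ('O_(psp d) (preim_opens yon_continuous W)),
  forall s d' (u : srs_hom (psp d') (psp d))
    (h : F d' `<=` u @^-1` preim_opens yon_continuous W)
    (hW : into (fun i => srs_comp (f i) u) W),
    pb h (g s) = (s : psec psp W) d' _ hW.
Proof.
pose ok d' (u : srs_hom (psp d') (psp d)) := into (fun i => srs_comp (f i) u) W.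
have okW d' (u : srs_hom (psp d') (psp d)) :
    ok d' u -> F d' `<=` u @^-1` preim_opens yon_continuous W.
  by move=> h z _; apply: h.
have ok_cov z : (preim_opens yon_continuous W : set _) z ->
    exists d' (u : srs_hom (psp d') (psp d)), [/\ ok d' u, open_imm u & exists y, u y = z].
  move=> Wz; have [d' [u [ou uW yz _]]] := probe_sub_near psp_sub Wz.
  by exists d', u; split=> // y; apply: uW.
pose J := {x : {d' : Pr & srs_hom (psp d') (psp d)} | ok _ (tagged x)}.
pose toJ d' (u : srs_hom (psp d') (psp d)) (h : ok d' u) : J :=
  exist (fun x => ok _ (tagged x)) (Tagged (fun d' => srs_hom (psp d') (psp d)) u) h.
have [|s|g gP] := @sa_hom_of_char k ('O_P W) ('O_(psp d) (preim_opens yon_continuous W)) J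
   (fun x => 'O_(psp (tag (sval x))) (full _))
   (fun x => ps_eval (proj2_sig x)) (fun x => pb (okW _ _ (proj2_sig x))).
- move=> b b0; apply: (@sieve_sep _ _ psp (psp d) _ ok okW ok_cov) => d' u h.
  by rewrite rmorph0; exact: (b0 (toJ d' u h)).
- have [||a aP] := @sieve_glue _ _ _ psp_sub (psp d) _ ok okW ok_cov
    _ (fun d' u h => (s : psec psp W) d' _ h) _.
  + by move=> d1 d2 u v h z; apply: h.
  + move=> d1 d2 u h v hv.
    have hj : into (fun i => srs_comp (srs_comp (f i) u) v) W by move=> z; apply: h.
    rewrite (ps_nat _ _ hj); apply: psec_eq => i.
    exact: (esym (compA (c := SRS k) _ _ _)).
  + by exists a => -[[d' u] h]; exact: (aP d' u h).
- exists g => s d' u h hW; apply: etrans (gP s (toJ d' u hW)).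
  exact: pb_irr.
Qed.

Definition yon_pull W := sval (cid (yon_pull_ex W)).

Lemma yon_pullP (W : opens P) s d' (u : srs_hom (psp d') (psp d))
  (h : F d' `<=` u @^-1` preim_opens yon_continuous W)
  (hW : into (fun i => srs_comp (f i) u) W) :
  pb h (yon_pull W s) = (s : psec psp W) d' _ hW.
Proof. exact: (svalP (cid (yon_pull_ex W))). Qed.

Program Definition yon : srs_hom (psp d) P :=
  @SrsHom k (psp d) P yon_fun yon_continuous yon_pull _.
Next Obligation.
move=> U V h s; apply: section_local => z Vz.
have [d' [u [ou uV yz Vu]]] := probe_sub_near psp_sub Vz.
exists _, (@subset_refl _ _); split=> //; rewrite !restr_id.
apply: (oi_section_inj ou (h := uV)) => //.
have hV : into (fun i => srs_comp (f i) u) V by move=> y; apply: (uV y Logic.I).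
have hU : F d' `<=` u @^-1` preim_opens yon_continuous U.
  by move=> y _; apply: h; apply: hV.
have hU' : into (fun i => srs_comp (f i) u) U by move=> y; apply: h; apply: hV.
rewrite (pb_restr _ _ hU) (yon_pullP _ _ hV) (yon_pullP _ _ hU') /=.
exact: psec_irr.
Qed.

Lemma yon_pb (W : opens P) s d' (u : srs_hom (psp d') (psp d))
  (h : F d' `<=` srs_comp yon u @^-1` W)
  (hW : into (fun i => srs_comp (f i) u) W) :
  pb h s = (s : psec psp W) d' _ hW.
Proof.
have h1 : F d' `<=` u @^-1` preim_opens yon_continuous W by move=> z _; apply: hW.
have h2 : preim_opens yon_continuous W `<=` yon @^-1` W by [].
have e : pb h2 s = yon_pull W s by rewrite /pb /= restr_id.
by rewrite (pb_comp h h1 h2) e (yon_pullP _ _ hW).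
Qed.

End Yoneda.

Lemma yon_nat d d' (f : forall i, srs_hom (psp d) (X i))
  (u : srs_hom (psp d') (psp d)) :
  srs_comp (yon f) u = yon (fun i => srs_comp (f i) u).
Proof.
apply: probe_hom_ext => // V s d2 v h h'.
have hV : into (fun i => srs_comp (srs_comp (f i) u) v) V by move=> z; apply: (h z Logic.I).
rewrite (yon_pb _ h' hV).
have h2 : F d2 `<=` srs_comp (yon f) (srs_comp u v) @^-1` V by [].
have hV2 : into (fun i => srs_comp (f i) (srs_comp u v)) V by [].
rewrite -(pb_eq h2 h s (compA (c := SRS k) _ _ _)) (yon_pb _ h2 hV2).
by apply: psec_eq => i; apply: (compA (c := SRS k)).
Qed.

Lemma proj_yon i d (f : forall i, srs_hom (psp d) (X i)) :
  srs_comp (proj i) (yon f) = f i.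
Proof.
apply: probe_hom_ext => // V a d' u h h'.
pose W := preim_opens (@proj_continuous i) V.
have h1 : F d' `<=` srs_comp (proj i) (srs_comp (yon f) u) @^-1` V by [].
rewrite -(pb_eq h1 h a (compA (c := SRS k) _ _ _)).
have hu : F d' `<=` srs_comp (yon f) u @^-1` W by [].
have hWV : W `<=` proj i @^-1` V by [].
rewrite (pb_comp h1 hu hWV).
have hW : into (fun i => srs_comp (f i) u) W by move=> z; apply: (h z Logic.I).
by rewrite (yon_pb _ hu hW) (proj_pb _ _ _ h').
Qed.

Hypothesis Pcov : forall x : P, exists d (f : forall i, srs_hom (psp d) (X i)),
  open_imm (yon f) /\ exists z, yon f z = x.

(** Locally a morphism to the product factors through one of the charts
    [yon f], and a composite of [yon f] with a morphism of probes is again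
    determined by its components, by [yon_nat] and [proj_yon]. *)
Lemma yon_surj d (e : srs_hom (psp d) P) : e = yon (fun i => srs_comp (proj i) e).
Proof.
apply: oi_ext => z; have [d0 [f [of_ [y yz]]]] := Pcov (e z).
pose W := preim_opens (srs_map_continuous e) (oi_image of_ (F d0)).
have [|d' [u [ou uW [t tz] _]]] := @probe_sub_near _ _ _ psp_sub d W z.
  by exists y.
exists (psp d'), u; split=> //; first by exists t.
have [|v ev] := @oi_lift _ _ _ _ (yon f) (srs_comp e u) of_.
  by move=> s; have [r _ rs] := uW s Logic.I; exists r.
rewrite -ev !yon_nat; congr yon; apply: functional_extensionality_dep => i.
rewrite -[RHS](compA (c := SRS k)) /= -ev.
by rewrite [RHS](compA (c := SRS k)) /= proj_yon.
Qed.

Lemma probe_product_covered : covered psp P.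
Proof. by move=> x; have [d [f [of_ fx]]] := Pcov x; exists d, (yon f). Qed.

(** By [yon_surj] the product property holds for probes, and [probe_colimit]
    extends it to all spaces covered by probes. *)
Theorem probe_product_universal (Q : super_ringed_space k)
  (f : forall i, srs_hom Q (X i)) : covered psp Q ->
  exists! h : srs_hom Q P, forall i, srs_comp (proj i) h = f i.
Proof.
move=> Qcov.
have [d d' j u|h hP] := @probe_colimit _ _ _ psp_sub Q P Qcov
  (fun d j => yon (fun i => srs_comp (f i) j)).
  rewrite yon_nat; congr yon; apply: functional_extensionality_dep => i.
  exact: (compA (c := SRS k)).
exists h; split=> [i|h' h'f]; apply: oi_ext => x;
  have [d [j [oj jx]]] := Qcov x; exists (psp d), j; split=> //.
  by rewrite -[LHS](compA (c := SRS k)) /= hP proj_yon.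
rewrite hP [RHS]yon_surj; congr yon; apply: functional_extensionality_dep => i.
by rewrite [RHS](compA (c := SRS k)) /= h'f.
Qed.

End ProductProperty.

(** * Charts of the product *)

Section ProductChart.
Variables (k : fieldType) (Pr : Type) (psp : Pr -> super_ringed_space k).
Hypothesis psp_sub : closed_under_opens psp.

Variables (I : finType) (X : I -> super_ringed_space k).
Variables (c : I -> Pr) (j : forall i, srs_hom (psp (c i)) (X i)).
Hypothesis oj : forall i, open_imm (j i).

Local Notation P := (probe_product psp_sub X).
Local Notation F d := (full (psp d)).

Variables (E : Pr) (w : forall i, srs_hom (psp E) (psp (c i))).
Hypothesis w_univ : forall d (f : forall i, srs_hom (psp d) (psp (c i))),
  exists! g : srs_hom (psp d) (psp E), forall i, srs_comp (w i) g = f i.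
Hypothesis w_inj : forall z z', (forall i, w i z = w i z') -> z = z'.
Hypothesis w_surj : forall y : forall i, psp (c i), exists z, forall i, w i z = y i.
Hypothesis w_open : forall (V : opens (psp E)) z, (V : set (psp E)) z ->
  exists B : forall i, opens (psp (c i)), (forall i, (B i : set (psp (c i))) (w i z)) /\
    forall z', (forall i, (B i : set (psp (c i))) (w i z')) -> (V : set (psp E)) z'.

Let pi i := srs_comp (j i) (w i).
Let y := yon psp_sub pi.

Lemma chart_lift d (f : forall i, srs_hom (psp d) (X i)) :
  into f (range y) -> exists g : srs_hom (psp d) (psp E),
    forall i, srs_comp (pi i) g = f i.
Proof.
move=> fy; have lift i : exists f' : srs_hom (psp d) (psp (c i)), srs_comp (j i) f' = f i.
  apply: oi_lift => // z; have [e _ ez] := fy z; exists (w i e).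
  by have := congr1 (fun x : P => x i) ez.
have [g [gw _]] := w_univ (fun i => sval (cid (lift i))).
exists g => i; rewrite -(svalP (cid (lift i))) -gw.
exact: (esym (compA (c := SRS k) _ _ _)).
Qed.

Lemma chart_lift_uniq d (g g' : srs_hom (psp d) (psp E)) :
  (forall i, srs_comp (pi i) g = srs_comp (pi i) g') -> g = g'.
Proof.
move=> gg; have [h [_ hU]] := w_univ (fun i => srs_comp (w i) g).
rewrite -(hU g) // -(hU g') // => i; apply: (oi_cancel (oj i)).
by rewrite ![LHS](compA (c := SRS k)) ![RHS](compA (c := SRS k)) /= gg.
Qed.

Lemma chart_inj : injective y.
Proof.
move=> a b ab; apply: w_inj => i; apply: (oi_inj (oj i)).
by have := congr1 (fun x : P => x i) ab.
Qed.

(** A probe into the image of [y] has components that lift through the open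
    immersions [j i], and hence comes from a unique morphism to [E]. So a natural
    family of sections over the image of [y] is the same as a section of [E]. *)
Lemma chart_oi : open_imm y.
Proof.
have lift (V : opens (psp E)) (U : opens P) (hU : U `<=` y @` V) d
    (f : forall i, srs_hom (psp d) (X i)) (fU : into f U) :
    exists g : srs_hom (psp d) (psp E), F d `<=` g @^-1` V /\
      forall i, srs_comp (pi i) g = f i.
  have [|g gf] := @chart_lift d f; first by move=> z; have [t _ tz] := hU _ (fU z); exists t.
  exists g; split=> // z _; have [t Vt tz] := hU _ (fU z).
  suff -> : (g @^-1` V) z = (V : set _) t by [].
  rewrite /preimage /=; congr (oset V _); apply: chart_inj; rewrite tz.
  apply: functional_extensionality_dep => i; rewrite -(gf i).
  by [].
split=> [|V oV|V U h hU s s0|V U h hU t]; first exact: chart_inj.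
- rewrite box_openE => _ [z Vz <-].
  have [B [Bz BV]] := @w_open (Opens oV) z Vz.
  exists (fun i => oi_image (oj i) (B i)); split=> [i|x Bx]; first by exists (w i z).
  have ex i : exists2 b, (B i : set (psp (c i))) b & j i b = x i.
    by have [b Bb bx] := Bx i; exists b.
  pose b i := s2val (cid2 (ex i)).
  have Bb i : (B i : set (psp (c i))) (b i) := s2valP (cid2 (ex i)).
  have bx i : j i (b i) = x i := s2valP' (cid2 (ex i)).
  have [z' z'b] := w_surj b; exists z'.
    by apply: BV => i; rewrite z'b.
  apply: functional_extensionality_dep => i; rewrite -bx -z'b.
  by [].
- apply: psec_ext => d f fU; have [g [gV gf]] := lift _ _ hU d f fU.
  have hW : into (fun i => srs_comp (pi i) g) U.
    by move=> z; have := h _ (gV z Logic.I).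
  have h1 : F d `<=` srs_comp y g @^-1` U by move=> z _; apply: hW.
  transitivity ((s : psec psp U) d _ hW); first by apply: psec_eq => i; rewrite gf.
  by rewrite -(yon_pb s h1 hW) (pb_comp h1 gV h) s0 rmorph0.
- have fU' d (f : forall i, srs_hom (psp d) (X i)) (fU : into f U) := cid (lift V U hU d f fU).
  pose g d f fU := sval (fU' d f fU).
  have gV d f fU : F d `<=` g d f fU @^-1` V := (svalP (fU' d f fU)).1.
  have gf d f fU : forall i, srs_comp (pi i) (g d f fU) = f i := (svalP (fU' d f fU)).2.
  have nat d d' f fU (u : srs_hom (psp d') (psp d)) fuU :
      pb (fullS u) (pb (gV d f fU) t) = pb (gV d' (fun i => srs_comp (f i) u) fuU) t.
    have h1 : F d' `<=` srs_comp (g d f fU) u @^-1` V by move=> z _; apply: gV.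
    rewrite -(pb_comp h1); apply: pb_eq; apply: chart_lift_uniq => i.
    by rewrite gf [LHS](compA (c := SRS k)) /= gf.
  exists (Psec nat : 'O_P U).
  apply: section_local => z Vz; have [d [u [ou uV uz Vu]]] := probe_sub_near psp_sub Vz.
  exists _, (@subset_refl _ _); split=> //; rewrite !restr_id.
  apply: (oi_section_inj ou (h := uV)) => //.
  have hW : into (fun i => srs_comp (pi i) u) U.
    by move=> a; have := h _ (uV a Logic.I).
  have h1 : F d `<=` srs_comp y u @^-1` U by move=> a _; apply: hW.
  rewrite -(pb_comp h1) (yon_pb _ h1 hW) /=; apply: pb_eq.
  by apply: chart_lift_uniq => i; rewrite gf.
Qed.

Lemma chart_range (x : P) : (forall i, exists b, j i b = x i) -> exists z, y z = x.
Proof.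
move=> ex; have [z zb] := w_surj (fun i => sval (cid (ex i))); exists z.
apply: functional_extensionality_dep => i.
have <- : j i (w i z) = x i by rewrite zb (svalP (cid (ex i))).
by [].
Qed.

End ProductChart.

(** * Absolutely summable families *)

Section Sums.
Variables (R : realType) (k : complete_field R).
Local Notation abs := (@cf_abs R k).

Lemma le_abs_eps (x : k) : (forall e, 0 < e -> abs x <= e) -> x = 0.
Proof.
move=> h; apply/eqP; rewrite -(cf_abs_eq0 x) eq_le cf_abs_ge0 andbT.
by apply/ler_addgt0Pr => e e0; rewrite add0r h.
Qed.

Lemma sums_to_uniq (T : choiceType) (u : T -> k) l m :
  sums_to u l -> sums_to u m -> l = m.
Proof.
move=> ul um; apply/eqP; rewrite -subr_eq0; apply/eqP; apply: le_abs_eps => e e0.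
have e2 : 0 < e / 2 by rewrite divr_gt0.
have [F h] := ul _ e2; have [G h'] := um _ e2.
have h1 := h (F `|` G)%fset (fsubsetUl _ _).
have h2 := h' (F `|` G)%fset (fsubsetUr _ _).
set s := \sum_(t <- _) u t in h1 h2.
have -> : l - m = - (s - l) + (s - m) by ring.
rewrite (splitr e); apply: le_trans (cf_absD _ _) _.
by rewrite cf_absN; apply: lerD; apply: ltW.
Qed.

Lemma abs_sum_diff (T : choiceType) (u : T -> k) (F G : {fset T}) :
  (F `<=` G)%fset -> abs (\sum_(t <- G) u t - \sum_(t <- F) u t) <=
    \sum_(t <- G) abs (u t) - \sum_(t <- F) abs (u t).
Proof.
move=> FG; rewrite (fset_sum_cond u FG) (fset_sum_cond (fun t => abs (u t)) FG).
rewrite (bigID (mem F)) /= addrAC subrr add0r.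
rewrite [X in _ <= X - _](bigID (mem F)) /= [leRHS]addrAC subrr add0r.
exact: cf_abs_sum.
Qed.

(** The partial sums over finite sets that nearly exhaust the sum of the absolute
    values form a Cauchy sequence. *)
Lemma abs_summable_sums (T : choiceType) (u : T -> k) :
  abs_summable (fun t => abs (u t)) -> exists l, sums_to u l.
Proof.
move=> /abs_summable_near[t|S S0 [uS near]]; first exact: cf_abs_ge0.
have pos (n : nat) : 0 < (n.+1%:R : R)^-1 by rewrite invr_gt0 ltr0n.
pose A n := sval (cid (near _ (pos n))).
have AP n F : (A n `<=` F)%fset -> S - n.+1%:R^-1 < \sum_(t <- F) abs (u t).
  exact: (svalP (cid (near _ (pos n)))).
pose G n := (\bigcup_(i <- iota 0 n.+1) A i)%fset.
have AG n m : (n <= m)%N -> (A n `<=` G m)%fset.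
  by move=> nm; apply: bigfcup_sup => //; rewrite mem_iota.
have close n (x := n.+1%:R^-1 : R) F : (A n `<=` F)%fset -> forall F', (A n `<=` F')%fset ->
    abs (\sum_(t <- F') u t - \sum_(t <- F) u t) < 2 * x.
  move=> AF F' AF'; 
  have h1 := abs_sum_diff u (fsubsetUl F F').
  have h2 := abs_sum_diff u (fsubsetUr F F').
  have b1 : S - x < _ := AP _ _ AF; have b2 : S - x < _ := AP _ _ AF'; have b3 := uS (F `|` F')%fset.
  set s := \sum_(t <- (F `|` F')%fset) u t in h1 h2.
  have -> : \sum_(t <- F') u t - \sum_(t <- F) u t =
    (s - \sum_(t <- F) u t) - (s - \sum_(t <- F') u t) by ring.
  apply: le_lt_trans (cf_absD _ _) _; rewrite cf_absN; move: x b1 b2 => x b1 b2; lra.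
have small (e : R) : 0 < e -> exists n, 2 * n.+1%:R^-1 < e.
  move=> e0; exists (Num.trunc (2 / e)); rewrite ltr_pdivrMr ?ltr0n //.
  by rewrite mulrC -ltr_pdivrMr // truncnS_gt.
have [|l lP] := @cf_complete R k (fun n => \sum_(t <- G n) u t).
  move=> e /small[N Ne]; exists N => m n Nm Nn; apply: lt_trans Ne.
  by apply: close; apply: AG.
exists l => e e0; have e2 : 0 < e / 2 by rewrite divr_gt0.
have [N Ne] := small _ e2; have [M lM] := lP _ e2.
exists (A N) => F AF; pose n := maxn N M.
have h1 := lM n (leq_maxr _ _); have h2 := close N _ (AG N n (leq_maxl _ _)) F AF.
have -> : \sum_(t <- F) u t - l =
  (\sum_(t <- F) u t - \sum_(t <- G n) u t) + (\sum_(t <- G n) u t - l) by ring.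
rewrite (splitr e); apply: le_lt_trans (cf_absD _ _) _; apply: ltrD => //.
exact: lt_trans h2 Ne.
Qed.

(** The value for a family without sum is a default that carries no information. *)
Definition total (T : choiceType) (u : T -> k) : k :=
  if pselect (exists l, sums_to u l) is left e then sval (cid e) else 0.

Lemma totalE (T : choiceType) (u : T -> k) l : sums_to u l -> total u = l.
Proof.
move=> ul; rewrite /total; case: pselect => [e|[]]; last by exists l.
exact: sums_to_uniq (svalP (cid e)) ul.
Qed.

Lemma totalP (T : choiceType) (u : T -> k) :
  abs_summable (fun t => abs (u t)) -> sums_to u (total u).
Proof. by move=> /abs_summable_sums[l ul]; rewrite (totalE ul). Qed.

Lemma sums_toZ (T : choiceType) (u : T -> k) c l :
  sums_to u l -> sums_to (fun t => c * u t) (c * l).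
Proof.
move=> ul e e0; have c1 : 0 < abs c + 1 by rewrite ltr_wpDl // cf_abs_ge0.
have [F0 h] := ul _ (divr_gt0 e0 c1).
exists F0 => F /h {}h; rewrite -mulr_sumr -mulrBr cf_absM.
apply: (@le_lt_trans _ _ ((abs c + 1) * abs (\sum_(t <- F) u t - l))).
  by rewrite ler_wpM2r ?cf_abs_ge0 // lerDl.
by rewrite mulrC -ltr_pdivlMr.
Qed.

Lemma sums_to_le (T : choiceType) (u : T -> k) l M :
  sums_to u l -> (forall F : {fset T}, \sum_(t <- F) abs (u t) <= M) ->
  abs l <= M.
Proof.
move=> ul uM; apply/ler_addgt0Pr => e e0; have [F h] := ul _ e0.
have {}h := h F (fsubset_refl _); have b := uM F.
have -> : l = \sum_(t <- F) u t - (\sum_(t <- F) u t - l) by ring.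
apply: le_trans (cf_absD _ _) _; rewrite cf_absN.
by apply: lerD (ltW h); apply: le_trans b; apply: cf_abs_sum.
Qed.

Section Reindex.
Variables (S T : choiceType) (phi : S -> T).
Hypothesis phi_inj : injective phi.

Lemma fset_pullback (F : {fset T}) : exists G : {fset S},
  forall s, (s \in G) = (phi s \in F).
Proof.
pose inv t : option S :=
  if pselect (exists s, phi s = t) is left e then Some (sval (cid e)) else None.
have invK s : inv (phi s) = Some s.
  rewrite /inv; case: pselect => [e|[]]; last by exists s.
  by congr Some; apply: phi_inj; exact: (svalP (cid e)).
have invP s t : inv t = Some s -> phi s = t.
  rewrite /inv; case: pselect => // e [<-]; exact: (svalP (cid e)).
exists [fset s in pmap inv F]%fset => s; rewrite in_fset /= mem_pmap.
apply/mapP/idP => [[t tF /esym/invP ->]//|sF].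
by exists (phi s).
Qed.

Lemma sum_pullback (V : nmodType) (u : T -> V) (F : {fset T}) (G : {fset S}) :
  (forall s, (s \in G) = (phi s \in F)) ->
  (forall t, (forall s, phi s <> t) -> u t = 0) ->
  \sum_(t <- F) u t = \sum_(s <- G) u (phi s).
Proof.
move=> GF u0; transitivity (\sum_(t <- [fset phi s | s in G]%fset) u t); last first.
  by rewrite big_imfset //= => x y _ _ /phi_inj.
apply/esym/big_fset_incl; first by apply/fsubsetP => _ /imfsetP[s /= sG ->]; rewrite -GF.
move=> t tF tn; apply: u0 => s st; case/negP: tn; apply/imfsetP; exists s => //=.
by rewrite GF st.
Qed.

Lemma sums_to_reindex (u : T -> k) l :
  (forall t, (forall s, phi s <> t) -> u t = 0) ->
  sums_to (fun s => u (phi s)) l -> sums_to u l.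
Proof.
move=> u0 ul e e0; have [G0 h] := ul _ e0.
exists [fset phi s | s in G0]%fset => F FG.
have [G GF] := fset_pullback F; rewrite (sum_pullback GF u0); apply: h.
apply/fsubsetP => s sG; rewrite GF; apply: (fsubsetP FG).
by apply/imfsetP; exists s.
Qed.

Lemma abs_summable_pullback (w : T -> R) : (forall t, 0 <= w t) ->
  abs_summable w -> abs_summable (fun s => w (phi s)).
Proof.
move=> w0 [M wM]; exists M => G; apply: le_trans (wM [fset phi s | s in G]%fset).
by rewrite big_imfset //= => x y _ _ /phi_inj.
Qed.

Lemma abs_summable_reindex (w : T -> R) :
  (forall t, (forall s, phi s <> t) -> w t = 0) ->
  abs_summable (fun s => w (phi s)) -> abs_summable w.
Proof.
move=> w0 [M wM]; exists M => F; have [G GF] := fset_pullback F.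
by rewrite (sum_pullback GF w0).
Qed.

End Reindex.

Section Fubini.
Variables S T : choiceType.

Lemma abs_summable_pairs (w : S * T -> R) (v : S -> R) M :
  (forall p, 0 <= w p) ->
  (forall s (G : {fset T}), \sum_(t <- G) w (s, t) <= v s) ->
  (forall F : {fset S}, \sum_(s <- F) v s <= M) ->
  forall F : {fset S * T}, \sum_(p <- F) w p <= M.
Proof.
move=> w0 wv vM F; pose A := [fset p.1 | p in F]%fset; pose B := [fset p.2 | p in F]%fset.
have FAB : (F `<=` A `*` B)%fset.
  by apply/fsubsetP => p pF; rewrite inE !in_imfset.
apply: le_trans (fset_sum_le w0 FAB) _; apply: le_trans (vM A).
rewrite big_imfset2 /=; last by move=> [? ?] [? ?] _ _ /= [-> ->].
by apply: ler_sum => s _; apply: wv.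
Qed.

Lemma sum_rect (V : nmodType) (u : S * T -> V) (A : {fset S}) (B : {fset T}) :
  \sum_(p <- (A `*` B)%fset) u p = \sum_(s <- A) \sum_(t <- B) u (s, t).
Proof. by rewrite big_imfset2 //= => -[? ?] [? ?] _ _ /= [-> ->]. Qed.

Variables (u : S * T -> k) (v : S -> k).
Hypothesis uv : forall s, sums_to (fun t => u (s, t)) (v s).

Lemma inner_close (A : {fset S}) (B0 : {fset T}) e : 0 < e ->
  exists B : {fset T}, (B0 `<=` B)%fset /\
    forall s, s \in A -> abs (\sum_(t <- B) u (s, t) - v s) < e.
Proof.
move=> e0; pose b s := sval (cid (uv s e0)).
have bP s B : (b s `<=` B)%fset -> abs (\sum_(t <- B) u (s, t) - v s) < e.
  exact: (svalP (cid (uv s e0))).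
exists (B0 `|` \bigcup_(s <- A) b s)%fset; split; first exact: fsubsetUl.
move=> s sA; apply: bP; apply: fsubset_trans (fsubsetUr _ _).
exact: bigfcup_sup.
Qed.

Lemma fubini_sums l : sums_to u l -> sums_to v l.
Proof.
move=> ul e e0; have e2 : 0 < e / 2 by rewrite divr_gt0.
have [F0 h] := ul _ e2; exists [fset p.1 | p in F0]%fset => A FA.
pose d := e / 2 / (#|` A|.+1%:R).
have d0 : 0 < d by rewrite divr_gt0 // ltr0n.
have [B [B0 hB]] := inner_close A [fset p.2 | p in F0]%fset d0.
have sub : (F0 `<=` A `*` B)%fset.
  apply/fsubsetP => p pF; rewrite inE (fsubsetP FA) ?(fsubsetP B0) ?in_imfset //.
have {}h := h _ sub; rewrite sum_rect in h.
have -> : \sum_(s <- A) v s - l =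
  - (\sum_(s <- A) (\sum_(t <- B) u (s, t) - v s)) +
   (\sum_(s <- A) \sum_(t <- B) u (s, t) - l) by rewrite sumrB; ring.
rewrite (splitr e); apply: le_lt_trans (cf_absD _ _) _; apply: ler_ltD => //.
rewrite cf_absN; apply: le_trans (cf_abs_sum _ _ _) _.
apply: (@le_trans _ _ (\sum_(s <- A) d)).
  by rewrite big_seq [leRHS]big_seq; apply: ler_sum => s sA; apply: ltW; apply: hB.
have <- : d * #|` A|.+1%:R = e / 2 by rewrite divfK // pnatr_eq0.
rewrite big_const_seq count_predT iter_addr_0 -[leLHS]mulr_natr.
by rewrite ler_pM2l // ler_nat leqnSn.
Qed.

(** The weight allows for the powers of the radius in the application to power
    series. *)
Lemma fubini_bound (w : S -> R) M : (forall s, 0 <= w s) ->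
  (forall F : {fset S * T}, \sum_(p <- F) abs (u p) * w p.1 <= M) ->
  forall A : {fset S}, \sum_(s <- A) abs (v s) * w s <= M.
Proof.
move=> w0 uM A; apply/ler_addgt0Pr => e e0.
pose W := \sum_(s <- A) w s; have W0 : 0 <= W by apply: sumr_ge0.
pose d := e / (W + 1); have W1 : 0 < W + 1 by rewrite ltr_wpDl.
have d0 : 0 < d by rewrite divr_gt0.
have [B [_ hB]] := inner_close A fset0 d0.
apply: le_trans (_ : \sum_(s <- A) ((\sum_(t <- B) abs (u (s, t))) * w s + d * w s) <= _).
  rewrite big_seq [leRHS]big_seq; apply: ler_sum => s sA.
  rewrite -mulrDl ler_wpM2r //.
  have -> : v s = \sum_(t <- B) u (s, t) - (\sum_(t <- B) u (s, t) - v s) by ring.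
  apply: le_trans (cf_absD _ _) _; rewrite cf_absN.
  by apply: lerD; [exact: cf_abs_sum|apply: ltW; exact: hB].
rewrite big_split /= -mulr_sumr; apply: lerD.
  apply: le_trans (uM (A `*` B)%fset); rewrite sum_rect.
  by apply: ler_sum => s _; rewrite mulr_suml.
by rewrite /d mulrAC ler_pdivrMr // ler_pM2l // lerDl.
Qed.

End Fubini.

(** This is where the absolute value has to be non-trivial: the powers of a scalar
    of absolute value less than one tend to zero, by Bernoulli's inequality. *)
Lemma small_scalar e : 0 < e -> exists2 t : k, t != 0 & abs t < e.
Proof.
move=> e0; have [x [x0 x1]] := cf_abs_nontrivial k.
have [y [y0 y1]] : exists y : k, y != 0 /\ abs y < 1.
  have [lt|gt|eq] := ltgtP (abs x) 1; first by exists x.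
    exists x^-1; rewrite invr_eq0; split=> //.
    have := cf_absM x x^-1; rewrite mulfV // cf_abs1 => h.
    have p0 : 0 < abs x by apply: lt_trans gt.
    by rewrite -(ltr_pM2l p0) -h mulr1.
  by rewrite eq eqxx in x1.
have p0 : 0 < abs y by rewrite lt_neqAle cf_abs_ge0 eq_sym cf_abs_eq0 y0.
pose d := (abs y)^-1 - 1; have d0 : 0 < d by rewrite subr_gt0 invf_gt1.
have bern n : 1 + n%:R * d <= (abs y)^-1 ^+ n.
  elim: n => [|n IH]; first by rewrite mul0r addr0.
  have n0 : 0 <= (n%:R : R) by rewrite ler0n.
  have nd : 0 <= n%:R * d * d by rewrite !mulr_ge0 // ltW.
  rewrite exprS; apply: le_trans (_ : (1 + d) * (1 + n%:R * d) <= _).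
    rewrite -natr1; lra.
  have -> : 1 + d = (abs y)^-1 by rewrite /d; ring.
  by rewrite ler_pM2l // invr_gt0.
pose n := Num.trunc (e^-1 / d).
exists (y ^+ n.+1); first by rewrite expf_neq0.
have : e^-1 < (abs y)^-1 ^+ n.+1.
  apply: lt_le_trans (bern n.+1); rewrite ltr_wpDl //.
  by rewrite -ltr_pdivrMr // truncnS_gt.
by rewrite cf_absX exprVn ltf_pV2 // posrE exprn_gt0.
Qed.

Lemma common_radius (I : finType) (f : I -> R) : (forall i, 0 < f i) ->
  exists2 r, 0 < r & forall i, r <= f i.
Proof.
move=> f0; exists (\big[Num.min/1]_i f i).
  by elim/big_ind: _ => // x y x0 y0; rewrite lt_min x0.
by move=> i; rewrite (bigD1 i) //= ge_min lexx.
Qed.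

End Sums.

(** * Power series and substitution *)

Notation mi n := {ffun 'I_n -> nat}.

Section PowerSeries.
Variables (R : realType) (k : complete_field R).
Local Notation abs := (@cf_abs R k).

Section OneSpace.
Variable n : nat.
Implicit Types (a b : mi n -> k) (c : mi n) (h : 'rV[k]_n) (r M : R).

Definition mi0 : mi n := [ffun=> 0%N].
Definition mi1 i : mi n := [ffun j => nat_of_bool (j == i)].

Lemma mi_deg0 : mi_deg mi0 = 0%N.
Proof. by rewrite /mi_deg big1 // => i _; rewrite ffunE. Qed.

Lemma mi_deg1 i : mi_deg (mi1 i) = 1%N.
Proof.
rewrite /mi_deg (bigD1 i) //= big1 => [|j /negPf ji]; rewrite ffunE ?ji //.
by rewrite eqxx.
Qed.

Lemma mi_deg_eq0 c : mi_deg c = 0%N -> c = mi0.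
Proof.
move=> c0; apply/ffunP => i; rewrite ffunE; apply/eqP; rewrite -leqn0 -c0.
by rewrite /mi_deg (bigD1 i) //= leq_addr.
Qed.

Lemma monomial0 h : monomial h mi0 = 1.
Proof. by rewrite /monomial big1 // => i _; rewrite ffunE. Qed.

Lemma monomial1 h i : monomial h (mi1 i) = h 0 i.
Proof.
rewrite /monomial (bigD1 i) //= big1 => [|j /negPf ji]; rewrite ffunE ?ji //.
by rewrite eqxx mulr1.
Qed.

(** A power series is given by its coefficients; [r] is a radius of absolute
    convergence and [M] a bound for the norm that belongs to it. The norm is
    submultiplicative, see [ple_mul]. *)
Definition psum a r := abs_summable (fun c => abs (a c) * r ^+ mi_deg c).
Definition ple a r M := forall F : {fset mi n},
  \sum_(c <- F) abs (a c) * r ^+ mi_deg c <= M.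
Definition pval a h := total (fun c => a c * monomial h c).

Lemma ple_psum a r M : ple a r M -> psum a r.
Proof. by move=> aM; exists M. Qed.

Lemma ple_ge0 a r M : ple a r M -> 0 <= M.
Proof. by move=> /(_ fset0); rewrite big_seq_fset0. Qed.

Lemma pterm_ge0 a r c : 0 < r -> 0 <= abs (a c) * r ^+ mi_deg c.
Proof. by move=> r0; rewrite mulr_ge0 ?cf_abs_ge0 ?exprn_ge0 // ltW. Qed.

Lemma pvalP a r h : psum a r -> polydisc r h ->
  sums_to (fun c => a c * monomial h c) (pval a h).
Proof. by move=> ar hr; apply: totalP; apply: term_summable hr. Qed.

Lemma pval_le a r M h : ple a r M -> polydisc r h -> abs (pval a h) <= M.
Proof.
move=> aM hr; apply: sums_to_le (pvalP (ple_psum aM) hr) _ => F.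
apply: le_trans (aM F); apply: ler_sum => c _; rewrite cf_absM.
by rewrite ler_wpM2l ?cf_abs_ge0 //; apply: monomial_le.
Qed.

Lemma ple_radius a r s M : 0 < s -> s <= r -> ple a r M -> ple a s M.
Proof.
move=> s0 sr aM F; apply: le_trans (aM F); apply: ler_sum => c _.
rewrite ler_wpM2l ?cf_abs_ge0 // lerXn2r // ?nnegrE ?ltW //.
exact: lt_le_trans sr.
Qed.

Lemma psum_radius a r s : 0 < s -> s <= r -> psum a r -> psum a s.
Proof. by move=> s0 sr [M aM]; exists M; apply: ple_radius aM. Qed.

Definition psingle c0 (x : k) : mi n -> k := fun c => if c == c0 then x else 0.

Lemma ple_psingle c0 x r : 0 < r -> ple (psingle c0 x) r (abs x * r ^+ mi_deg c0).
Proof.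
move=> r0 F; case cF: (c0 \in F).
  rewrite (big_fsetD1 c0) //= /psingle eqxx big_seq big1 ?addr0 // => c.
  by rewrite !inE => /andP[/negPf-> _]; rewrite cf_abs0 mul0r.
rewrite big_seq big1 ?mulr_ge0 ?cf_abs_ge0 ?exprn_ge0 ?ltW // => c c_F.
by rewrite /psingle; case: eqP => [cc|_]; [rewrite -cc c_F in cF|rewrite cf_abs0 mul0r].
Qed.

Lemma pval_psingle c0 x h : pval (psingle c0 x) h = x * monomial h c0.
Proof.
apply: totalE; have := @sums_to1 _ k _ c0 (fun c => psingle c0 x c * monomial h c).
by rewrite /psingle eqxx; apply=> c /negPf ->; rewrite mul0r.
Qed.

Definition padd a b : mi n -> k := fun c => a c + b c.
Definition popp a : mi n -> k := fun c => - a c.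
Definition pmul a b : mi n -> k := fun c => \sum_(p <- mi_dec c) a p.1 * b p.2.

Lemma ple_add a b r M N : 0 < r -> ple a r M -> ple b r N -> ple (padd a b) r (M + N).
Proof.
move=> r0 aM bN F; apply: le_trans (lerD (aM F) (bN F)).
rewrite -big_split /=; apply: ler_sum => c _.
by rewrite -mulrDl ler_wpM2r ?cf_absD // exprn_ge0 ?ltW.
Qed.

Lemma ple_opp a r M : ple a r M -> ple (popp a) r M.
Proof. by move=> aM F; under eq_bigr do rewrite /popp cf_absN. Qed.

Lemma ple_mul a b r M N : 0 < r -> ple a r M -> ple b r N -> ple (pmul a b) r (M * N).
Proof.
move=> r0 aM bN F.
apply: le_trans (cauchy_bound (@mi_decP n) (fun c => pterm_ge0 a c r0)
  (fun c => pterm_ge0 b c r0) aM bN F).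
apply: ler_sum => c _.
apply: le_trans (_ : (\sum_(p <- mi_dec c) abs (a p.1 * b p.2)) * r ^+ mi_deg c <= _).
  by rewrite ler_wpM2r ?(exprn_ge0 _ (ltW r0)) // cf_abs_sum.
rewrite mulr_suml big_seq [leRHS]big_seq; apply: ler_sum => p.
rewrite mi_decP => /eqP <-; rewrite mi_degD exprD cf_absM.
by rewrite mulrACA.
Qed.

Lemma psum_add a b r : 0 < r -> psum a r -> psum b r -> psum (padd a b) r.
Proof. by move=> r0 [M aM] [N bN]; exists (M + N); apply: ple_add. Qed.

Lemma psum_opp a r : psum a r -> psum (popp a) r.
Proof. by move=> [M aM]; exists M; apply: ple_opp. Qed.

Lemma psum_mul a b r : 0 < r -> psum a r -> psum b r -> psum (pmul a b) r.
Proof. by move=> r0 [M aM] [N bN]; exists (M * N); apply: ple_mul. Qed.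

Lemma pval_add a b r h : psum a r -> psum b r -> polydisc r h ->
  pval (padd a b) h = pval a h + pval b h.
Proof.
move=> ar br hr; apply: totalE; have := sums_toD (pvalP ar hr) (pvalP br hr).
by congr sums_to; apply/funext => c; rewrite mulrDl.
Qed.

Lemma pval_opp a r h : psum a r -> polydisc r h -> pval (popp a) h = - pval a h.
Proof.
move=> ar hr; apply: totalE; have := sums_toN (pvalP ar hr).
by congr sums_to; apply/funext => c; rewrite mulNr.
Qed.

Lemma pval_mul a b r h : psum a r -> psum b r -> polydisc r h ->
  pval (pmul a b) h = pval a h * pval b h.
Proof.
move=> ar br hr; apply: totalE.
have := cauchy_sums_to (@mi_decP n) (term_summable ar hr) (term_summable br hr)
  (pvalP ar hr) (pvalP br hr).
congr sums_to; apply/funext => c; rewrite /pmul mulr_suml big_seq [RHS]big_seq.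
apply: eq_bigr => p; rewrite mi_decP => /eqP <-.
by rewrite monomialD mulrACA.
Qed.

Definition pexp a m := iter m (pmul a) (psingle mi0 1).

Lemma ple_exp a r M m : 0 < r -> ple a r M -> ple (pexp a m) r (M ^+ m).
Proof.
move=> r0 aM; elim: m => [|m IH]; last by rewrite exprS; apply: ple_mul.
have := ple_psingle mi0 1 r0.
by rewrite mi_deg0 cf_abs1 mulr1.
Qed.

Lemma pval_exp a r h m : 0 < r -> psum a r -> polydisc r h ->
  pval (pexp a m) h = pval a h ^+ m.
Proof.
move=> r0 ar hr; elim: m => [|m IH].
  by rewrite /pexp /= pval_psingle monomial0 mulr1.
rewrite exprS -IH; apply: (pval_mul ar _ hr).
have [M aM] := ar; exact: (ple_psum (ple_exp m r0 (aM : ple a r M))).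
Qed.

End OneSpace.

Section Substitution.
Variables m n : nat.
Variables (a : mi n -> k) (u : 'I_n -> mi m -> k) (r rho : R).
Hypotheses (r0 : 0 < r) (a_rho : psum a rho) (u_rho : forall i, ple (u i) r rho).

(** The series that results from substituting the [u i] in a monomial. *)
Definition pmon (al : mi n) : mi m -> k :=
  \big[@pmul m/psingle (mi0 m) 1]_(i < n) pexp (u i) (al i).

Lemma ple_pmon al : ple (pmon al) r (rho ^+ mi_deg al).
Proof.
rewrite /pmon /mi_deg; have -> : rho ^+ (\sum_i al i) = \prod_i rho ^+ al i.
  by elim/big_rec2: _ => //= i y x _ <-; rewrite exprD.
elim/big_rec2: _ => [|i x y _ yx].
  have := ple_psingle (mi0 m) 1 r0.
  by rewrite mi_deg0 cf_abs1 mulr1.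
by apply: ple_mul => //; apply: ple_exp.
Qed.

Lemma pval_pmon al h : polydisc r h ->
  pval (pmon al) h = monomial (\row_i pval (u i) h) al.
Proof.
move=> hr; rewrite /pmon /monomial.
pose K (x : mi m -> k) (y : k) := psum x r /\ pval x h = y.
suff [] : K (\big[@pmul m/psingle (mi0 m) 1]_(i < n) pexp (u i) (al i))
   (\prod_i (\row_i0 pval (u i0) h) 0 i ^+ al i) by [].
elim/big_rec2: _ => [|i y x _ [xs xy]].
  split; last by rewrite pval_psingle monomial0 mulr1.
  exact: ple_psum (ple_psingle (mi0 m) 1 r0).
have es : psum (pexp (u i) (al i)) r by apply: ple_psum (ple_exp _ r0 (u_rho i)).
split; first exact: psum_mul.
rewrite (pval_mul es xs hr) xy mxE (pval_exp _ r0 _ hr) //.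
exact: ple_psum (u_rho i).
Qed.

Definition psubst : mi m -> k := fun c => total (fun al => a al * pmon al c).

(** If the [u i] have norm at most [rho] for the radius [r], then the double series
    that arises by expanding all monomials converges absolutely. *)
Lemma psubst_bound : exists M, forall F : {fset mi m * mi n},
  \sum_(p <- F) abs (a p.2 * pmon p.2 p.1) * r ^+ mi_deg p.1 <= M.
Proof.
case: a_rho => M aM; exists M => F.
pose sw (p : mi n * mi m) := (p.2, p.1).
have sw_inj : injective sw by move=> [? ?] [? ?] [-> ->].
have [G GF] := fset_pullback sw_inj F.
rewrite (sum_pullback sw_inj (u := fun p : mi m * mi n =>
   abs (a p.2 * pmon p.2 p.1) * r ^+ mi_deg p.1) GF); last first.
  by move=> [c al] /(_ (al, c)).
apply: (@abs_summable_pairs R _ _ (fun p : mi n * mi m =>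
  abs (a p.1 * pmon p.1 p.2) * r ^+ mi_deg p.2)
  (fun al => abs (a al) * rho ^+ mi_deg al)) => [p|al H|H] //=.
  by rewrite mulr_ge0 ?cf_abs_ge0 // exprn_ge0 // ltW.
under eq_bigr do rewrite cf_absM -mulrA.
by rewrite -mulr_sumr ler_wpM2l ?cf_abs_ge0 //; apply: ple_pmon.
Qed.

Lemma psubst_sums c : sums_to (fun al => a al * pmon al c) (psubst c).
Proof.
have [M uM] := psubst_bound; apply: totalP.
have rc : 0 < r ^+ mi_deg c by rewrite exprn_gt0.
pose phi (al : mi n) := (c, al).
have phi_inj : injective phi by move=> ? ? [].
have [|N hN] := abs_summable_pullback phi_inj _ (ex_intro _ M uM).
  by move=> p; rewrite mulr_ge0 ?cf_abs_ge0 // exprn_ge0 // ltW.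
exists (N / r ^+ mi_deg c) => F; rewrite ler_pdivlMr // mulr_suml.
exact: hN.
Qed.

Lemma ple_psubst M : (forall F : {fset mi m * mi n},
  \sum_(p <- F) abs (a p.2 * pmon p.2 p.1) * r ^+ mi_deg p.1 <= M) ->
  ple psubst r M.
Proof.
move=> uM; apply: (@fubini_bound R k _ _ (fun p => a p.2 * pmon p.2 p.1)
  psubst psubst_sums (fun c => r ^+ mi_deg c) M _ uM).
by move=> c; rewrite exprn_ge0 // ltW.
Qed.

Lemma psum_psubst : psum psubst r.
Proof. by have [M /ple_psubst] := psubst_bound; apply: ple_psum. Qed.

(** Both sides are iterated sums of the same absolutely convergent double series. *)
Lemma pval_psubst h : polydisc r h ->
  pval psubst h = pval a (\row_i pval (u i) h).
Proof.
move=> hr; apply/esym/totalE; have [M uM] := psubst_bound.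
pose w (p : mi m * mi n) := a p.2 * pmon p.2 p.1 * monomial h p.1.
have ws : abs_summable (fun p => abs (w p)).
  exists M => F; apply: le_trans (uM F); apply: ler_sum => p _.
  by rewrite [leLHS]cf_absM ler_wpM2l ?cf_abs_ge0 //; apply: monomial_le.
have [l wl] := abs_summable_sums ws.
have h1 : sums_to (fun c => psubst c * monomial h c) l.
  apply: (fubini_sums (u := w)) wl => c.
  have := sums_toZ (monomial h c) (psubst_sums c).
  by rewrite mulrC; congr sums_to; apply/funext => al; rewrite mulrC.
rewrite (sums_to_uniq (pvalP psum_psubst hr) h1) {h1}.
pose sw (p : mi n * mi m) := (p.2, p.1).
have sw_inj : injective sw by move=> [? ?] [? ?] [-> ->].
have ws' := abs_summable_pullback sw_inj (fun p => cf_abs_ge0 (w p)) ws.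
have [l' wl'] := abs_summable_sums (u := fun p => w (sw p)) ws'.
have -> : l = l'.
  apply: sums_to_uniq wl _; apply: (sums_to_reindex sw_inj) wl'.
  by move=> [c al] /(_ (al, c)).
apply: (fubini_sums (u := fun p => w (sw p))) wl' => al.
rewrite -pval_pmon //; have := sums_toZ (a al) (pvalP (ple_psum (ple_pmon al)) hr).
by congr sums_to; apply/funext => c; rewrite /w /= mulrA.
Qed.

End Substitution.
End PowerSeries.

(** * Division of power series by coordinates *)

Section Division.
Variables (R : realType) (k : complete_field R) (n : nat).
Local Notation abs := (@cf_abs R k).
Implicit Types (a b : mi n -> k) (c : mi n) (h : 'rV[k]_n) (r M : R) (i : 'I_n).

(** [pkill i a] and [pshift i a] are the remainder and the quotient in the division
    of the power series [a] by the coordinate [i], see [pval_split]. *)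
Definition pshift i a : mi n -> k := fun c => a (mi_add c (mi1 i)).
Definition pkill i a : mi n -> k := fun c => if c i == 0%N then a c else 0.

Lemma mi_add_inj c : injective (fun d => mi_add d c).
Proof.
move=> d d' /ffunP e; apply/ffunP => i; have := e i.
by rewrite !ffunE => /addIn.
Qed.

Lemma mi_add1_surj i c : c i != 0%N -> exists d, mi_add d (mi1 i) = c.
Proof.
move=> ci; exists [ffun j => (c j - (j == i))%N]; apply/ffunP => j.
by rewrite !ffunE; case: eqP => [->|_] /=; rewrite ?subn0 ?addn0 ?subnK // lt0n.
Qed.

Lemma ple_pkill i a r M : 0 < r -> ple a r M -> ple (pkill i a) r M.
Proof.
move=> r0 aM F; apply: le_trans (aM F); apply: ler_sum => c _.
rewrite /pkill; case: ifP => // _; rewrite cf_abs0 mul0r.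
exact: pterm_ge0.
Qed.

Lemma psum_pkill i a r : 0 < r -> psum a r -> psum (pkill i a) r.
Proof. by move=> r0 [M aM]; exists M; apply: ple_pkill. Qed.

Lemma psum_pshift i a r : 0 < r -> psum a r -> psum (pshift i a) r.
Proof.
move=> r0 ar; have [|M hM] := abs_summable_pullback (@mi_add_inj (mi1 i)) _ ar.
  by move=> c; apply: pterm_ge0.
exists (M / r) => F; rewrite ler_pdivlMr // mulr_suml; apply: le_trans (hM F).
by apply: ler_sum => c _; rewrite mi_degD mi_deg1 addn1 exprSr mulrA.
Qed.

Lemma pval_split i a r h : 0 < r -> psum a r -> polydisc r h ->
  pval a h = pval (pkill i a) h + h 0 i * pval (pshift i a) h.
Proof.
move=> r0 ar hr; apply: totalE.
have h1 := pvalP (psum_pkill i r0 ar) hr.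
have h2 := sums_toZ (h 0 i) (pvalP (psum_pshift i r0 ar) hr).
pose w c := if c i == 0%N then 0 else a c * monomial h c.
have h3 : sums_to w (h 0 i * pval (pshift i a) h).
  apply: (sums_to_reindex (@mi_add_inj (mi1 i))).
    move=> c nc; rewrite /w; case: eqP => // /eqP /mi_add1_surj[d dc].
    by case: (nc d).
  move: h2; congr sums_to; apply/funext => c.
  rewrite /w !ffunE eqxx addn1 /= /pshift monomialD monomial1; ring.
have := sums_toD h1 h3; congr sums_to; apply/funext => c.
by rewrite /w /pkill; case: eqP; rewrite ?addr0 // mul0r add0r.
Qed.

Definition put h i (t : k) : 'rV[k]_n := \row_j (if j == i then t else h 0 j).

Lemma polydisc_put h i t r : polydisc r h -> abs t < r -> polydisc r (put h i t).
Proof. by move=> hr tr j; rewrite mxE; case: eqP. Qed.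

Lemma pval_pkill_put i a h t : pval (pkill i a) (put h i t) = pval (pkill i a) h.
Proof.
congr total; apply/funext => c; rewrite /pkill.
case: eqP => [ci|_]; last by rewrite !mul0r.
congr (_ * _); apply: eq_bigr => j _; rewrite mxE; case: eqP => // ->.
by rewrite ci !expr0.
Qed.

Lemma pval_put0 i a r h : 0 < r -> psum a r -> polydisc r h ->
  pval (pkill i a) h = pval a (put h i 0).
Proof.
move=> r0 ar hr; rewrite [RHS](pval_split i r0 ar); last first.
  by apply: polydisc_put; rewrite ?cf_abs0.
by rewrite pval_pkill_put mxE eqxx mul0r addr0.
Qed.

(** Where the coordinate does not vanish one can divide by it. Elsewhere the
    quotient vanishes by continuity, which is made explicit by dividing once more
    and bounding the result. *)
Lemma pshift_null i a r : 0 < r -> psum a r ->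
  (forall h, polydisc r h -> pval a h = 0) ->
  forall h, polydisc r h -> pval (pshift i a) h = 0.
Proof.
move=> r0 ar a0; have [M sM] := psum_pshift i r0 (psum_pshift i r0 ar).
have nz h : polydisc r h -> h 0 i != 0 -> pval (pshift i a) h = 0.
  move=> hr hi; have := pval_split i r0 ar hr; rewrite a0 // (pval_put0 i r0 ar hr).
  rewrite a0; last by apply: polydisc_put; rewrite ?cf_abs0.
  by rewrite add0r => /esym/eqP; rewrite mulf_eq0 (negPf hi) => /eqP.
move=> h hr; have [hi|/nz] := eqVneq (h 0 i) 0; last exact.
have M0 : 0 <= M := ple_ge0 (sM : ple _ _ M).
have M1 : 0 < M + 1 by rewrite ltr_wpDl.
apply: le_abs_eps => e e0.
have [|t t0 tl] := @small_scalar R k (Num.min r (e / (M + 1))).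
  by rewrite lt_min r0 divr_gt0.
move: tl; rewrite lt_min => /andP[tr te].
have hp : polydisc r (put h i t) by apply: polydisc_put.
have := pval_split i r0 (psum_pshift i r0 ar) hp.
rewrite (nz _ hp) ?mxE ?eqxx // pval_pkill_put (pval_put0 i r0 (psum_pshift i r0 ar) hr).
have -> : put h i 0 = h.
  by apply/rowP => j; rewrite mxE; case: eqP => // ->.
move/esym/eqP; rewrite addr_eq0 => /eqP ->; rewrite cf_absN cf_absM.
apply: le_trans (_ : e / (M + 1) * M <= _).
  apply: ler_pM; rewrite ?cf_abs_ge0 ?(ltW te) //.
  exact: pval_le sM hp.
by rewrite mulrAC ler_pdivrMr // ler_pM2l // lerDl.
Qed.

Lemma pval_0 a r : 0 < r -> psum a r -> pval a 0 = a (mi0 n).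
Proof.
move=> r0 ar; apply: totalE.
have := @sums_to1 _ k _ (mi0 n) (fun c => a c * monomial 0 c).
rewrite monomial0 mulr1; apply=> d /eqP dn.
suff -> : monomial (0 : 'rV[k]_n) d = 0 by rewrite mulr0.
have [i di] : exists i, d i != 0%N.
  apply: contrapT => nd; apply: dn; apply/ffunP => i; rewrite ffunE.
  by apply: contrapT => di; apply: nd; exists i; apply/eqP.
by rewrite /monomial (bigD1 i) //= mxE expr0n (negPf di) mul0r.
Qed.

(** Dividing by coordinates moves every coefficient to the constant term, which is
    the value at the origin. *)
Lemma pval_null a r : 0 < r -> psum a r ->
  (forall h, polydisc r h -> pval a h = 0) -> forall c, a c = 0.
Proof.
move=> r0 ar a0 c; have [m cm] : exists m, mi_deg c = m by eexists.
elim: m => [|m IH] in a ar a0 c cm *.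
  rewrite (mi_deg_eq0 cm).
  rewrite -(pval_0 r0 ar).
  by apply: a0; apply: polydisc0.
have [i ci] : exists i, c i != 0%N.
  apply: contrapT => nc; suff c0 : c = mi0 n by rewrite c0 mi_deg0 in cm.
  apply/ffunP => i; rewrite ffunE.
  by apply: contrapT => di; apply: nc; exists i; apply/eqP.
have [d dc] := mi_add1_surj ci; rewrite -dc.
apply: (IH (pshift i a)); first exact: psum_pshift.
  exact: pshift_null.
by apply/eqP; rewrite -(eqn_add2r 1) -(mi_deg1 i) -mi_degD dc cm mi_deg1 addn1.
Qed.

Lemma pval_inj a b r : 0 < r -> psum a r -> psum b r ->
  (forall h, polydisc r h -> pval a h = pval b h) -> a =1 b.
Proof.
move=> r0 ar br ab c; apply/eqP; rewrite -subr_eq0; apply/eqP.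
apply: (@pval_null (padd a (popp b)) r) => //.
  by apply: psum_add => //; apply: psum_opp.
move=> h hr; rewrite (pval_add ar (psum_opp br) hr) (pval_opp br hr).
by rewrite ab // subrr.
Qed.

(** Hadamard's lemma, by dividing successively by all the coordinates. *)
Lemma hadamard a r : 0 < r -> psum a r -> exists b : 'I_n -> mi n -> k,
  (forall i, psum (b i) r) /\
  forall h, polydisc r h -> pval a h = a (mi0 n) + \sum_i h 0 i * pval (b i) h.
Proof.
move=> r0 ar.
suff : exists b : 'I_n -> mi n -> k, exists a', [/\ (forall i, psum (b i) r),
    psum a' r, (forall c, a' c = if [forall (i | i \in enum 'I_n), c i == 0%N] then a c else 0) &
    forall h, polydisc r h -> pval a h = pval a' h + \sum_(i <- enum 'I_n) h 0 i * pval (b i) h].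
  move=> [b [a' [bs a's a'E ab]]]; exists b; split=> // h hr.
  rewrite ab // big_enum /=; congr (_ + _).
  have -> : a' = psingle (mi0 n) (a (mi0 n)).
    apply/funext => c; rewrite a'E /psingle; case: forallP => [c0|nc].
      suff -> : c = mi0 n by rewrite eqxx.
      by apply/ffunP => i; rewrite ffunE; apply/eqP; have := c0 i; rewrite mem_enum.
    by case: eqP => // c0; case: nc => i; rewrite c0 ffunE implybT.
  by rewrite pval_psingle monomial0 mulr1.
elim: (enum 'I_n) (enum_uniq 'I_n) => [|j s IH] /=.
  exists (fun=> a), a; split=> // [c|h _]; last by rewrite big_nil addr0.
  by case: forallP => // -[] i.
move=> /andP[js /IH[b [a' [bs a's a'E ab]]]].
exists (fun i => if i == j then pshift j a' else b i), (pkill j a'); split=> [i|||h hr].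
- by case: eqP => // _; apply: psum_pshift.
- exact: psum_pkill.
- move=> c; rewrite /pkill a'E; case: (eqVneq (c j) 0%N) => cj.
    congr (if _ then _ else _); apply: eq_forallb => i; rewrite inE.
    by have [->|//] := eqVneq i j; rewrite cj eqxx !implybT.
  case: forallP => // /(_ j); rewrite inE eqxx /= => /eqP cj0.
  by rewrite cj0 in cj.
rewrite ab // big_cons eqxx (pval_split j r0 a's hr) -addrA; congr (_ + (_ + _)).
rewrite big_seq [RHS]big_seq; apply: eq_bigr => i si; case: eqP => // ij.
by rewrite -ij si in js.
Qed.

(** Without constant term each term gains at least one factor when the radius is
    scaled down. *)
Lemma ple_small a r e : 0 < r -> psum a r -> a (mi0 n) = 0 -> 0 < e ->
  exists s, [/\ 0 < s, s <= r & ple a s e].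
Proof.
move=> r0 ar a0 e0; have [M aM] := ar; have M0 := ple_ge0 (aM : ple _ _ M).
have M1 : 0 < M + 1 by rewrite ltr_wpDl.
pose d := Num.min 1 (e / (M + 1)).
have d0 : 0 < d by rewrite lt_min ltr01 divr_gt0.
have d1 : d <= 1 by rewrite ge_min lexx.
exists (d * r); split; [exact: mulr_gt0|by rewrite ler_piMl // ltW|move=> F].
apply: (@le_trans _ _ (d * \sum_(c <- F) abs (a c) * r ^+ mi_deg c)).
  rewrite mulr_sumr; apply: ler_sum => c _.
  case E : (mi_deg c) => [|m].
    by rewrite (mi_deg_eq0 E) a0 cf_abs0 !mul0r mulr0.
  rewrite mulrCA ler_wpM2l ?cf_abs_ge0 // exprMn ler_wpM2r ?exprn_ge0 ?(ltW r0) //.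
  by rewrite exprS ler_piMr ?(ltW d0) // exprn_ile1 // ltW.
apply: (@le_trans _ _ (e / (M + 1) * M)).
  apply: ler_pM; [exact: ltW|by apply: sumr_ge0 => c _; apply: pterm_ge0| |exact: aM].
  by rewrite ge_min lexx orbT.
by rewrite mulrAC ler_pdivrMr // ler_pM2l // lerDl.
Qed.

End Division.

(** * Analytic functions *)

Section AnalyticMaps.
Variables (R : realType) (k : complete_field R).
Local Notation abs := (@cf_abs R k).

Definition has_ps n (g : 'rV[k]_n -> k) x (r : R) (a : mi n -> k) :=
  [/\ 0 < r, psum a r & forall h, polydisc r h -> g (x + h) = pval a h].

Section OneSpace.
Variable n : nat.
Implicit Types (g f : 'rV[k]_n -> k) (x h : 'rV[k]_n) (r s : R) (a b : mi n -> k).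

Lemma has_ps_radius g x r s a : 0 < s -> s <= r -> has_ps g x r a -> has_ps g x s a.
Proof.
move=> s0 sr [r0 ar ga]; split=> //; first exact: psum_radius ar.
by move=> h hs; apply: ga; apply: polydiscS hs.
Qed.

Lemma has_ps_uniq g x r s a b : has_ps g x r a -> has_ps g x s b -> a =1 b.
Proof.
move=> ga gb; have [r0 _ _] := ga; have [s0 _ _] := gb.
have t0 : 0 < Num.min r s by rewrite lt_min r0.
have [|_ a' gA] := has_ps_radius t0 _ ga; first by rewrite ge_min lexx.
have [|_ b' gB] := has_ps_radius t0 _ gb; first by rewrite ge_min lexx orbT.
by apply: (pval_inj t0 a' b') => h ht; rewrite -gA // gB.
Qed.

Lemma has_ps_0 g x r a : has_ps g x r a -> a (mi0 n) = g x.
Proof.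
move=> [r0 ar ga]; rewrite -(pval_0 r0 ar) -ga ?addr0 //.
exact: polydisc0.
Qed.

Lemma has_ps_local g f x r a (D : set 'rV[k]_n) : coord_open D -> D x ->
  (forall y, D y -> g y = f y) -> has_ps f x r a -> exists2 s, s <= r & has_ps g x s a.
Proof.
move=> oD Dx gf fa; have [r0 _ _] := fa; have [t t0 tD] := oD x Dx.
have s0 : 0 < Num.min r t by rewrite lt_min r0.
exists (Num.min r t); first by rewrite ge_min lexx.
have [|_ a' fA] := has_ps_radius s0 _ fa; first by rewrite ge_min lexx.
split=> // h hs; rewrite gf ?fA //; apply: tD; apply: polydiscS hs.
by rewrite ge_min lexx orbT.
Qed.

Lemma analytic_has_ps (D : set 'rV[k]_n) g x : analytic_on D g -> D x ->
  exists r a, has_ps g x r a /\ forall h, polydisc r h -> D (x + h).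
Proof.
move=> gD /gD[r [a [r0 ar ha]]]; exists r, a; split=> [|h /ha[]//].
split=> // h hr; apply/esym/totalE.
by have [_] := ha h hr.
Qed.

Lemma has_ps_analytic (D : set 'rV[k]_n) g : coord_open D ->
  (forall x, D x -> exists r a, has_ps g x r a) -> analytic_on D g.
Proof.
move=> oD h x Dx; have [r [a ga]] := h x Dx; have [r0 _ _] := ga.
have [s s0 sD] := oD x Dx; have t0 : 0 < Num.min r s by rewrite lt_min r0.
have [|_ a' gA] := has_ps_radius t0 _ ga; first by rewrite ge_min lexx.
exists (Num.min r s), a; split=> // z zt; split.
  by apply: sD; apply: polydiscS zt; rewrite ge_min lexx orbT.
rewrite gA //; exact: pvalP zt.
Qed.

Lemma has_ps_small g x r a e : has_ps g x r a -> 0 < e ->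
  exists s, [/\ 0 < s, s <= r & ple (padd a (psingle (mi0 n) (- g x))) s e].
Proof.
move=> ga e0; have [r0 ar _] := ga; apply: ple_small => //.
  apply: psum_add => //; exact: ple_psum (ple_psingle _ _ r0).
by rewrite /padd /psingle eqxx (has_ps_0 ga) subrr.
Qed.

Lemma has_ps_diff g x r s a h : has_ps g x r a -> 0 < s -> s <= r -> polydisc s h ->
  pval (padd a (psingle (mi0 n) (- g x))) h = g (x + h) - g x.
Proof.
move=> ga s0 sr hs; have [_ as' gA] := has_ps_radius s0 sr ga.
rewrite (pval_add as' (ple_psum (ple_psingle _ _ s0)) hs) pval_psingle.
by rewrite monomial0 mulr1 gA.
Qed.

Lemma analytic_continuous (D : set 'rV[k]_n) g x e : analytic_on D g -> D x ->
  0 < e -> exists2 s, 0 < s & forall h, polydisc s h ->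
    D (x + h) /\ abs (g (x + h) - g x) <= e.
Proof.
move=> gD Dx e0; have [r [a [ga rD]]] := analytic_has_ps gD Dx.
have [s [s0 sr se]] := has_ps_small ga e0; exists s => // h hs.
split; first by apply: rD; apply: polydiscS hs.
by rewrite -(has_ps_diff ga s0 sr hs); apply: pval_le hs.
Qed.

Lemma polydiscD r s h z : polydisc r h -> polydisc s z ->
  polydisc (r + s) (h + z).
Proof.
by move=> hr zs i; rewrite mxE; apply: le_lt_trans (cf_absD _ _) _; apply: ltrD.
Qed.

Lemma polydisc_room r h : 0 < r -> polydisc r h ->
  exists s, [/\ 0 < s, forall i, abs (h 0 i) + s <= r &
     forall z, polydisc s z -> polydisc r (h + z)].
Proof.
move=> r0 hr; have [i|s s0 hs] := @common_radius R 'I_n (fun i => r - abs (h 0 i)).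
  by rewrite subr_gt0.
have sr i : abs (h 0 i) + s <= r by rewrite -lerBrDl.
exists s; split=> // z zs i; rewrite mxE; apply: le_lt_trans (cf_absD _ _) _.
by apply: lt_le_trans (sr i); rewrite ltrD2l.
Qed.

Lemma polydisc_open x r : coord_open [set x + h | h in polydisc r].
Proof.
move=> _ [h hr <-].
have r_gt0 (i : 'I_n) : 0 < r by apply: le_lt_trans (hr i); apply: cf_abs_ge0.
have [i|s s0 hs] := @common_radius R 'I_n (fun i => r - abs (h 0 i)).
  by rewrite subr_gt0.
exists s => // z zs; exists (h + z); last by rewrite addrA.
move=> i; rewrite mxE; apply: le_lt_trans (cf_absD _ _) _.
by rewrite -ltrBrDl; apply: lt_le_trans (hs i).
Qed.

End OneSpace.

(** After subtracting its constant term the expansion of each [b i] has small norm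
    for a small radius, so that it can be substituted in the expansion of [f]. *)
Lemma analytic_comp m n (U : set 'rV[k]_m) (D : set 'rV[k]_n)
  (b : 'I_n -> 'rV[k]_m -> k) (f : 'rV[k]_n -> k) :
  coord_open U -> (forall i, analytic_on U (b i)) ->
  (forall x, U x -> D (\row_i b i x)) -> analytic_on D f ->
  analytic_on U (fun x => f (\row_i b i x)).
Proof.
move=> oU bU UD fD; apply: has_ps_analytic => // x Ux.
have [rho [a [fa _]]] := analytic_has_ps fD (UD x Ux); have [rho0 as' fA] := fa.
have e0 : 0 < rho / 2 by rewrite divr_gt0.
have ex i : exists v : R * (mi m -> k), has_ps (b i) x v.1 v.2 /\ 0 < v.1 /\
    ple (padd v.2 (psingle (mi0 m) (- b i x))) v.1 (rho / 2).
  have [r [u [bu _]]] := analytic_has_ps (bU i) Ux.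
  have [s [s0 sr us]] := has_ps_small bu e0; exists (s, u); split=> //.
  exact: has_ps_radius bu.
pose v i := sval (cid (ex i)).
have vP i : has_ps (b i) x (v i).1 (v i).2 /\ 0 < (v i).1 /\
    ple (padd (v i).2 (psingle (mi0 m) (- b i x))) (v i).1 (rho / 2).
  exact: (svalP (cid (ex i))).
have [i|r r0 rv] := @common_radius R 'I_n (fun i => (v i).1); first by have [_ []] := vP i.
pose u i := padd (v i).2 (psingle (mi0 m) (- b i x)).
have ur i : ple (u i) r (rho / 2).
  by have [_ [_]] := vP i; apply: ple_radius.
have arho : psum a (rho / 2).
  by apply: psum_radius as' => //; lra.
exists r, (psubst a u); split=> //; first exact: (psum_psubst r0 arho ur).
move=> h hr; rewrite (pval_psubst r0 arho ur hr).
have -> : \row_i b i (x + h) = \row_i b i x + \row_i pval (u i) h.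
  apply/rowP => i; rewrite !mxE; have [bi _] := vP i.
  by rewrite (has_ps_diff bi r0 (rv i) hr) addrC subrK.
apply: fA => i; rewrite mxE.
apply: le_lt_trans (pval_le (ur i) hr) _.
lra.
Qed.

Section OneSpace2.
Variable n : nat.
Implicit Types (g f : 'rV[k]_n -> k) (x h : 'rV[k]_n) (r s : R) (a b : mi n -> k).

(** Re-expansion at another point [x + h] of the polydisc is the substitution of
    the power series [h 0 i + X_i]. *)
Lemma has_ps_analytic_disc g x r a : has_ps g x r a ->
  analytic_on [set x + h | h in polydisc r] g.
Proof.
move=> [r0 ar ga]; apply: has_ps_analytic; first exact: polydisc_open.
move=> _ [h hr <-]; have [s [s0 sr sz]] := polydisc_room r0 hr.
pose u i := padd (psingle (mi0 n) (h 0 i)) (psingle (mi1 i) 1).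
have us i : ple (u i) s r.
  move=> F; apply: le_trans (sr i).
  have := ple_add s0 (ple_psingle (mi0 n) (h 0 i) s0) (ple_psingle (mi1 i) 1 s0).
  by move=> /(_ F); rewrite mi_deg0 mi_deg1 cf_abs1 mulr1 mul1r.
exists s, (psubst a u); split=> //; first exact: (psum_psubst s0 ar us).
move=> z zs; rewrite (pval_psubst s0 ar us zs) -addrA ga; last exact: sz.
congr pval; apply/rowP => i; rewrite !mxE.
rewrite (pval_add (ple_psum (ple_psingle _ _ s0)) (ple_psum (ple_psingle _ _ s0)) zs).
by rewrite !pval_psingle monomial0 monomial1 mulr1 mul1r.
Qed.

Lemma coord_has_ps i x r : 0 < r -> has_ps (fun y => y 0 i) x r
  (padd (psingle (mi0 n) (x 0 i)) (psingle (mi1 i) 1)).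
Proof.
move=> r0; have p1 c y := ple_psum (@ple_psingle R k n c y r r0).
split=> // [|h hr]; first by apply: psum_add.
by rewrite (pval_add (p1 _ _) (p1 _ _) hr) !pval_psingle monomial0 monomial1 mxE
  mulr1 mul1r.
Qed.

Lemma analytic_coord (D : set 'rV[k]_n) i : coord_open D ->
  analytic_on D (fun y => y 0 i).
Proof.
move=> oD; apply: has_ps_analytic => // x _.
by exists 1, (padd (psingle (mi0 n) (x 0 i)) (psingle (mi1 i) 1)); apply: coord_has_ps.
Qed.

(** The geometric series. Instead of summing it, one observes that dividing it by
    the coordinate reproduces it up to a factor. *)
Lemma analytic_coord_inv i (w : k) :
  analytic_on [set x | x 0 i != w] (fun x : 'rV[k]_n => (x 0 i - w)^-1).
Proof.
have oD : coord_open [set x : 'rV[k]_n | x 0 i != w].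
  move=> x /= xw; exists (abs (x 0 i - w)).
    by rewrite lt_neqAle cf_abs_ge0 eq_sym cf_abs_eq0 subr_eq0 xw.
  move=> h /(_ i); apply: contraTneq; rewrite mxE => <-.
  by rewrite opprD addrA subrr add0r cf_absN ltxx.
apply: has_ps_analytic => // x /= xw.
pose d := x 0 i - w; have d0 : d != 0 by rewrite subr_eq0.
have ad : 0 < abs d by rewrite lt_neqAle cf_abs_ge0 eq_sym cf_abs_eq0 d0.
pose a : mi n -> k := fun c =>
  if [forall j, (j == i) || (c j == 0%N)] then d^-1 * (- d^-1) ^+ c i else 0.
pose r := abs d / 2; have r0 : 0 < r by rewrite divr_gt0.
pose phi (m : nat) : mi n := [ffun j => if j == i then m else 0%N].
have phi_inj : injective phi.
  by move=> p q /ffunP/(_ i); rewrite !ffunE eqxx.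
have adV : abs d^-1 = (abs d)^-1.
  by apply: (mulfI (lt0r_neq0 ad)); rewrite -cf_absM !mulfV ?cf_abs1 ?lt0r_neq0.
have as' : psum a r.
  apply: (abs_summable_reindex phi_inj) => [c nc|].
    rewrite /a; case: forallP => [h|_]; last by rewrite cf_abs0 mul0r.
    case: (nc (c i)); apply/ffunP => j; rewrite ffunE; have := h j.
    by case: eqP => [->|_ /eqP].
  exists ((abs d)^-1 * 2) => F.
  have -> : \sum_(m <- F) abs (a (phi m)) * r ^+ mi_deg (phi m) =
      (abs d)^-1 * \sum_(m <- F) (2^-1 : R) ^+ m.
    rewrite mulr_sumr; apply: eq_bigr => m _.
    rewrite /a; case: forallP => [_|[]]; last first.
      by move=> j; rewrite ffunE; case: eqP.
    have -> : mi_deg (phi m) = m.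
      rewrite /mi_deg (bigD1 i) //= big1 => [|j /negPf ji]; rewrite ffunE ?ji //.
      by rewrite eqxx addn0.
    rewrite ffunE eqxx cf_absM cf_absX cf_absN adV -mulrA -exprMn /r.
    by rewrite mulrA mulVf ?mul1r // lt0r_neq0.
  rewrite ler_pM2l ?invr_gt0 //.
  have geo N : \sum_(0 <= m < N) (2^-1 : R) ^+ m = 2 - 2 * 2^-1 ^+ N.
    elim: N => [|N IH]; first by rewrite big_nil expr0 mulr1 subrr.
    by rewrite big_nat_recr //= IH exprS; field.
  pose N := (\max_(m <- F) m).+1.
  apply: (@le_trans _ _ (\sum_(0 <= m < N) (2^-1 : R) ^+ m)).
    have sub : (F `<=` [fset m in iota 0 N])%fset.
      apply/fsubsetP => m mF; rewrite in_fset mem_iota /= add0n ltnS.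
      by rewrite (big_rem m) //= leq_maxl.
    apply: le_trans (fset_sum_le _ sub) _ => [m|]; first by rewrite exprn_ge0 // invr_ge0.
    rewrite le_eqVlt; apply/orP; left; apply/eqP.
    rewrite /index_iota subn0; apply: perm_big; apply: uniq_perm; rewrite ?fset_uniq ?iota_uniq //.
    by move=> m; rewrite in_fset.
  by rewrite geo lerBlDr lerDl mulr_ge0 // exprn_ge0 // invr_ge0.
exists r, a; split=> // h hr.
have sh : pshift i a = (fun c => - d^-1 * a c).
  apply/funext => c; rewrite /pshift /a.
  have -> : [forall j, (j == i) || (mi_add c (mi1 i) j == 0%N)] =
            [forall j, (j == i) || (c j == 0%N)].
    by apply: eq_forallb => j; rewrite !ffunE; case: eqP => //= _; rewrite addn0.
  by case: ifP => _; rewrite ?mulr0 // !ffunE eqxx addn1 exprS mulrCA.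
have ki : pkill i a = psingle (mi0 n) d^-1.
  apply/funext => c; rewrite /pkill /psingle /a; case: (eqVneq c (mi0 n)) => [->|cn].
    rewrite ffunE eqxx expr0 mulr1; case: forallP => // -[] j.
    by rewrite ffunE eqxx orbT.
  case: eqP => // ci; case: forallP => // hc; case/eqP: cn; apply/ffunP => j.
  by rewrite ffunE; have := hc j; case: eqP => [->|_ /eqP].
have := pval_split i r0 as' hr; rewrite ki pval_psingle monomial0 mulr1.
have -> : pval (pshift i a) h = - d^-1 * pval a h.
  apply: totalE; have := sums_toZ (- d^-1) (pvalP as' hr).
  by rewrite sh; congr sums_to; apply/funext => c; rewrite mulrA.
move=> e; rewrite mxE addrAC -/d.
have nz : d + h 0 i != 0.
  rewrite addrC addr_eq0; apply: contraTneq (hr i) => ->.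
  by rewrite cf_absN -leNgt /r; lra.
apply: (mulfI nz); rewrite mulfV //; move: e; set p := pval a h => e.
have: d * p = d * (d^-1 + h 0 i * (- d^-1 * p)) by rewrite -e.
rewrite mulrDr mulfV // => e2.
have -> : (d + h 0 i) * p = d * p + h 0 i * p by ring.
by rewrite e2; field.
Qed.

End OneSpace2.
End AnalyticMaps.

(** * Hasse derivatives *)

Section Hasse.
Variables (R : realType) (k : complete_field R) (n : nat).
Local Notation abs := (@cf_abs R k).
Implicit Types (g f : 'rV[k]_n -> k) (x h : 'rV[k]_n) (r s : R) (a b : mi n -> k).

Definition mi_join (p : mi n * mi n) : mi (n + n) :=
  [ffun i => match fintype.split i with inl j => p.1 j | inr j => p.2 j end].

Lemma mi_join_l p j : mi_join p (lshift n j) = p.1 j.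
Proof. by rewrite ffunE (unsplitK (inl j)). Qed.

Lemma mi_join_r p j : mi_join p (rshift n j) = p.2 j.
Proof. by rewrite ffunE (unsplitK (inr j)). Qed.

Lemma mi_join_inj : injective mi_join.
Proof.
move=> [c d] [c' d'] e; congr (_, _); apply/ffunP => j.
  by rewrite -(mi_join_l (c, d)) e mi_join_l.
by rewrite -(mi_join_r (c, d)) e mi_join_r.
Qed.

Lemma mi_join_surj c : exists p, mi_join p = c.
Proof.
exists ([ffun j => c (lshift n j)], [ffun j => c (rshift n j)]).
apply/ffunP => i; rewrite -(splitK i); case: (fintype.split i) => j /=.
  by rewrite mi_join_l ffunE.
by rewrite mi_join_r ffunE.
Qed.

Lemma mi_deg_join p : mi_deg (mi_join p) = (mi_deg p.1 + mi_deg p.2)%N.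
Proof.
rewrite /mi_deg big_split_ord /=; congr addn; apply: eq_bigr => j _.
  by rewrite mi_join_l.
by rewrite mi_join_r.
Qed.

Lemma monomial_join (h0 h : 'rV[k]_n) p :
  monomial (row_mx h0 h) (mi_join p) = monomial h0 p.1 * monomial h p.2.
Proof.
rewrite /monomial big_split_ord /=; congr (_ * _); apply: eq_bigr => j _.
  by rewrite mi_join_l row_mxEl.
by rewrite mi_join_r row_mxEr.
Qed.

(** Expanding [g (x + h0 + h)] as a power series in the [2 n] variables [h0] and
    [h] exhibits the Taylor coefficients of [g] at [x + h0] as power series in
    [h0]. *)
Lemma taylor_shift g x r a : has_ps g x r a -> exists (s : R) (A : mi n -> mi n -> k),
  [/\ 0 < s, forall be, psum (A be) s & forall h0, polydisc s h0 ->
     has_ps g (x + h0) s (fun be => pval (A be) h0)].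
Proof.
move=> [r0 ar ga]; pose s := r / 2; have s0 : 0 < s by rewrite divr_gt0.
pose u i : mi (n + n) -> k :=
  padd (psingle (mi1 (lshift n i)) 1) (psingle (mi1 (rshift n i)) 1).
have us i : ple (u i) s r.
  have -> : r = s + s by rewrite /s; field.
  move=> F; have := ple_add s0 (ple_psingle (mi1 (lshift n i)) (1 : k) s0)
    (ple_psingle (mi1 (rshift n i)) (1 : k) s0).
  by move=> /(_ F); rewrite !mi_deg1 cf_abs1 mul1r.
pose b := psubst a u; have bs : psum b s := psum_psubst s0 ar us.
pose A be ga := b (mi_join (ga, be)).
have [M bM] := bs.
have AM (F : {fset mi n * mi n}) :
    \sum_(p <- F) abs (A p.1 p.2) * s ^+ mi_deg p.2 * s ^+ mi_deg p.1 <= M.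
  pose phi (p : mi n * mi n) := mi_join (p.2, p.1).
  have phi_inj : injective phi by move=> [? ?] [? ?] /mi_join_inj [-> ->].
  apply: le_trans (bM [fset phi p | p in F]%fset).
  rewrite big_imfset /= => [|p q _ _ /phi_inj//].
  apply: ler_sum => -[c d] _ /=.
  by rewrite mi_deg_join /= exprD mulrA.
have As be : psum (A be) s.
  have sb : 0 < s ^+ mi_deg be by rewrite exprn_gt0.
  exists (M / s ^+ mi_deg be) => F; rewrite ler_pdivlMr // mulr_suml.
  apply: le_trans (AM [fset (be, c) | c in F]%fset).
  by rewrite big_imfset //= => c d _ _ [].
exists s, A; split=> // h0 h0s.
have As0 be : sums_to (fun c => A be c * monomial h0 c) (pval (A be) h0).
  exact: pvalP (As be) h0s.
have Ts : psum (fun be => pval (A be) h0) s.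
  exists M; apply: (@fubini_bound R k _ _ (fun p => A p.1 p.2 * monomial h0 p.2)
    _ As0 (fun be => s ^+ mi_deg be) M) => [c|F]; first by rewrite exprn_ge0 // ltW.
  apply: le_trans (AM F); apply: ler_sum => p _.
  rewrite ler_wpM2r ?exprn_ge0 ?(ltW s0) // cf_absM ler_wpM2l ?cf_abs_ge0 //.
  exact: monomial_le.
split=> // h hs; rewrite -addrA ga; last first.
  by have := polydiscD h0s hs; rewrite /s; congr (polydisc _ _); field.
have hh : polydisc s (row_mx h0 h).
  by move=> i; rewrite -(splitK i); case: (fintype.split i) => j /=;
    rewrite ?row_mxEl ?row_mxEr.
have -> : pval a (h0 + h) = pval b (row_mx h0 h).
  rewrite (pval_psubst s0 ar us hh); congr pval; apply/rowP => i; rewrite !mxE.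
  rewrite (pval_add (ple_psum (ple_psingle _ _ s0)) (ple_psum (ple_psingle _ _ s0)) hh).
  by rewrite !pval_psingle !monomial1 row_mxEl row_mxEr !mul1r.
pose w (p : mi n * mi n) := A p.1 p.2 * monomial h0 p.2 * monomial h p.1.
pose phi (p : mi n * mi n) := mi_join (p.2, p.1).
have phi_inj : injective phi by move=> [? ?] [? ?] /mi_join_inj [-> ->].
have wE p : w p = b (phi p) * monomial (row_mx h0 h) (phi p).
  by rewrite monomial_join /w /A mulrA.
have ws : abs_summable (fun p => abs (w p)).
  exists M => F; apply: le_trans (AM F); apply: ler_sum => p _.
  rewrite !cf_absM -!mulrA ler_wpM2l ?cf_abs_ge0 //.
  by apply: ler_pM; rewrite ?cf_abs_ge0 //; apply: monomial_le.
have [l wl] := abs_summable_sums ws.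
have -> : pval b (row_mx h0 h) = l.
  apply: totalE; apply: (sums_to_reindex phi_inj).
    move=> c nc; have [[d e] de] := mi_join_surj c; case: (nc (e, d)).
    by rewrite -de.
  by move: wl; congr sums_to; apply/funext => p; rewrite wE.
apply/esym/totalE; apply: (fubini_sums (u := w)) wl => be.
have := sums_toZ (monomial h be) (As0 be).
by rewrite mulrC; congr sums_to; apply/funext => c; rewrite /w mulrC.
Qed.

(** The Hasse derivative of index [be], that is, the partial derivative divided by
    the factorial of [be], which makes sense in every characteristic. *)
Definition hasse (be : mi n) g x : k :=
  if pselect (exists p : R * (mi n -> k), has_ps g x p.1 p.2) is left e
  then (sval (cid e)).2 be else 0.

(** By the uniqueness of power series the choice in the definition does not matter. *)
Lemma hasseE be g x r a : has_ps g x r a -> hasse be g x = a be.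
Proof.
move=> ga; rewrite /hasse; case: pselect => [e|[]]; last by exists (r, a).
exact: has_ps_uniq (svalP (cid e)) ga be.
Qed.

Lemma hasse_has_ps be g x r a : has_ps g x r a ->
  exists s b, has_ps (hasse be g) x s b.
Proof.
move=> /taylor_shift[s [A [s0 As gA]]]; exists s, (A be); split=> // h hs.
by rewrite (hasseE be (gA h hs)).
Qed.

Lemma analytic_hasse be (D : set 'rV[k]_n) g :
  analytic_on D g -> analytic_on D (hasse be g).
Proof.
move=> gD; apply: has_ps_analytic; first exact: analytic_open gD.
by move=> x /(analytic_has_ps gD)[r [a [/hasse_has_ps]]].
Qed.

Lemma has_ps_pair f g x r s a b : has_ps f x r a -> has_ps g x s b ->
  exists t, has_ps f x t a /\ has_ps g x t b.
Proof.
move=> fa gb; have [r0 _ _] := fa; have [s0 _ _] := gb; exists (Num.min r s).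
have t0 : 0 < Num.min r s by rewrite lt_min r0.
by split; [apply: has_ps_radius fa|apply: has_ps_radius gb];
  rewrite ?ge_min ?lexx ?orbT.
Qed.

Section Rules.
Variables (D : set 'rV[k]_n) (f g : 'rV[k]_n -> k) (x : 'rV[k]_n).
Hypotheses (fD : analytic_on D f) (gD : analytic_on D g) (Dx : D x).

Lemma hasse_add be : hasse be (fun y => f y + g y) x = hasse be f x + hasse be g x.
Proof.
have [r [a [fa _]]] := analytic_has_ps fD Dx.
have [s [b [gb _]]] := analytic_has_ps gD Dx.
have [t [fa' gb']] := has_ps_pair fa gb; have [t0 at' fA] := fa'.
have [_ bt gB] := gb'; rewrite (hasseE _ fa) (hasseE _ gb).
apply: (@hasseE _ _ _ t (padd a b)); split=> //; first exact: psum_add.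
by move=> h ht; rewrite fA // gB // (pval_add at' bt ht).
Qed.

Lemma hasse_opp be : hasse be (fun y => - f y) x = - hasse be f x.
Proof.
have [r [a [fa _]]] := analytic_has_ps fD Dx; have [r0 ar fA] := fa.
rewrite (hasseE _ fa); apply: (@hasseE _ _ _ r (popp a)).
split=> //; first exact: psum_opp.
by move=> h hr; rewrite fA // (pval_opp ar hr).
Qed.

(** The Leibniz rule, which is the product of power series. *)
Lemma hasse_mul be : hasse be (fun y => f y * g y) x =
  \sum_(p <- mi_dec be) hasse p.1 f x * hasse p.2 g x.
Proof.
have [r [a [fa _]]] := analytic_has_ps fD Dx.
have [s [b [gb _]]] := analytic_has_ps gD Dx.
have [t [fa' gb']] := has_ps_pair fa gb; have [t0 at' fA] := fa'.
have [_ bt gB] := gb'; under eq_bigr do rewrite (hasseE _ fa) (hasseE _ gb).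
apply: (@hasseE _ _ _ t (pmul a b)); split=> //; first exact: psum_mul.
by move=> h ht; rewrite fA // gB // (pval_mul at' bt ht).
Qed.

Lemma hasse_local be : (forall y, D y -> f y = g y) -> hasse be f x = hasse be g x.
Proof.
move=> fg; have [r [a [fa _]]] := analytic_has_ps fD Dx.
have gf y : D y -> g y = f y by move/fg; exact: esym.
have [s _ ga] := has_ps_local (analytic_open fD) Dx gf fa.
by rewrite (hasseE _ fa) (hasseE _ ga).
Qed.

End Rules.

Lemma hasse_cst be (c : k) x : hasse be (fun=> c) x = if be == mi0 n then c else 0.
Proof.
apply: (@hasseE _ _ _ 1 (psingle (mi0 n) c)); split=> //.
  exact: ple_psum (ple_psingle _ _ _).
by move=> h _; rewrite pval_psingle monomial0 mulr1.
Qed.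

Lemma hasse_coord be i x : hasse be (fun y => y 0 i) x =
  (if be == mi0 n then x 0 i else 0) + (if be == mi1 i then 1 else 0).
Proof. exact: (hasseE be (coord_has_ps i x ltr01)). Qed.

End Hasse.

(** * Exterior algebras *)

Section Filtration.
Variables (q : nat) (A : comPzRingType).
Local Notation E := (exterior q A).
Implicit Types (f g : E) (I J K : {set 'I_q}).

(** The powers of the ideal generated by the odd elements. *)
Definition fil (m : nat) f := forall I, (#|I| < m)%N -> f I = 0.

Lemma fil0 f : fil 0 f.
Proof. by []. Qed.

Lemma filD m f g : fil m f -> fil m g -> fil m (f + g).
Proof. by move=> fm gm I Im; rewrite ffunE fm ?gm ?addr0. Qed.

Lemma fil_sum m (T : Type) (s : seq T) (F : T -> E) :
  (forall i, fil m (F i)) -> fil m (\sum_(i <- s) F i).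
Proof.
move=> Fm; elim/big_ind: _ => // [I _|f g]; first by rewrite ffunE.
exact: filD.
Qed.

Lemma filM m m' f g : fil m f -> fil m' g -> fil (m + m') (f * g).
Proof.
move=> fm gm K Km; rewrite [LHS]ext_mulE big1 // => I IK.
have [Im|Im] := ltnP #|I| m; first by rewrite fm // mul0r mulr0.
rewrite gm ?mulr0 // -(ltn_add2l m); apply: leq_ltn_trans Km.
by rewrite -(finset.cardsID I K) (finset.setIidPr IK) leq_add2r.
Qed.

Lemma fil_null f : fil q.+1 f -> f = 0.
Proof.
move=> fq; apply/ffunP => I; rewrite ffunE fq // ltnS.
by rewrite -[X in (_ <= X)%N](card_ord q) max_card.
Qed.

Lemma fil_null_ge m f : (q < m)%N -> fil m f -> f = 0.
Proof. by move=> qm fm; apply: fil_null => I Iq; apply: fm; apply: leq_trans qm. Qed.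

Lemma fil1 f : f finset.set0 = 0 -> fil 1 f.
Proof. by move=> f0 I; rewrite ltnS leqn0 finset.cards_eq0 => /eqP ->. Qed.

Lemma even1 : ext_part false (1 : E).
Proof.
move=> I Io; rewrite ffunE; case: eqP => // I0.
by rewrite I0 finset.cards0 in Io.
Qed.

Lemma even_exp f m : ext_part false f -> ext_part false (f ^+ m).
Proof.
move=> f0; elim: m => [|m IH]; first exact: even1.
by rewrite exprS; apply: (ext_partM f0 IH).
Qed.

Lemma evenD f g : ext_part false f -> ext_part false g -> ext_part false (f + g).
Proof. by move=> f0 g0 I Io; rewrite ffunE f0 ?g0 ?addr0. Qed.

Lemma even_cst c : ext_part false (ext_cst q c : E).
Proof.
move=> I Io; rewrite ffunE; case: eqP => // I0.
by rewrite I0 finset.cards0 in Io.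
Qed.

Lemma fil_exp f m : fil 1 f -> fil m (f ^+ m).
Proof.
move=> f1; elim: m => [|m IH]; first exact: fil0.
by rewrite exprS -add1n; apply: filM.
Qed.

Section Monomials.
Variables (n : nat) (N : 'I_n -> E).
Hypothesis N_even : forall i, ext_part false (N i).

Definition emon (be : mi n) : E := \prod_(i < n) N i ^+ be i.

Lemma emon_even be : ext_part false (emon be).
Proof.
rewrite /emon; elim/big_ind: _ => [|f g f0 g0|i _]; first exact: even1.
  exact: (ext_partM f0 g0).
exact: even_exp.
Qed.

Lemma emonD be ga : emon (mi_add be ga) = emon be * emon ga.
Proof.
suff [] : emon (mi_add be ga) = emon be * emon ga /\ ext_part false (emon be) by [].
rewrite /emon; elim/big_rec3: _ => [|i x y z _ [-> x0]].
  by rewrite mulr1; split=> //; apply: even1.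
split; last exact: (ext_partM (even_exp _ (N_even i)) x0).
rewrite ffunE exprD -!mulrA; congr (_ * _); rewrite !mulrA; congr (_ * _).
exact: (ext_even_central _ (even_exp _ (N_even i))).
Qed.

Lemma emon0 : emon (mi0 n) = 1.
Proof. by rewrite /emon big1 // => i _; rewrite ffunE. Qed.

Lemma emon1 i : emon (mi1 i) = N i.
Proof.
rewrite /emon (eq_bigr (fun j => if j == i then N i else 1)) => [|j _].
  by rewrite -big_mkcond big_pred1_eq.
by rewrite ffunE; case: eqP => [->|].
Qed.

Hypothesis N_fil : forall i, fil 1 (N i).

Lemma emon_fil be : fil (mi_deg be) (emon be).
Proof.
rewrite /emon /mi_deg; elim/big_rec2: _ => [|i f m _ fm]; first exact: fil0.
by apply: filM => //; apply: fil_exp.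
Qed.

End Monomials.
End Filtration.

Section Box.
Variables (n p : nat).

Definition mi_box : {fset mi n} :=
  [fset x in codom (fun x : {ffun 'I_n -> 'I_p.+1} =>
                      [ffun i => nat_of_ord (x i)] : mi n)]%fset.

Lemma mem_mi_box (be : mi n) : (be \in mi_box) = [forall i, be i <= p]%N.
Proof.
rewrite in_fset; apply/codomP/forallP => [[x ->] i|bp]; first by rewrite ffunE -ltnS.
exists [ffun i => inord (be i)]; apply/ffunP => i.
by rewrite !ffunE inordK // ltnS.
Qed.

Lemma mi_box_out (be : mi n) : be \notin mi_box -> (p < mi_deg be)%N.
Proof.
rewrite mem_mi_box negb_forall => /existsP[i]; rewrite -ltnNge => /leq_trans; apply.
by rewrite /mi_deg (bigD1 i) //= leq_addr.
Qed.

End Box.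

Section Taylor.
Variables (n p : nat) (A C : comPzRingType) (D : mi n -> A -> C).
Hypothesis D_B : forall be a b, D be (a - b) = D be a - D be b.
Hypothesis D_1 : forall be, D be 1 = if be == mi0 n then 1 else 0.
Hypothesis D_M : forall be a b,
  D be (a * b) = \sum_(x <- mi_dec be) D x.1 a * D x.2 b.
Variable N : 'I_n -> exterior p C.
Hypothesis N_even : forall i, ext_part false (N i).
Hypothesis N_fil : forall i, fil 1 (N i).

(** The value of [a] at a point with nilpotent increments [N], by Taylor's formula.
    The sum is finite because monomials of degree greater than [p] in the [N i]
    vanish. *)
Definition taylor (a : A) : exterior p C :=
  \sum_(be <- mi_box n p) ext_cst p (D be a) * emon N be.

Lemma emon_out be : be \notin mi_box n p -> emon N be = 0.
Proof. by move=> /mi_box_out h; apply: fil_null_ge h _; apply: emon_fil. Qed.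

Lemma taylor_even a : ext_part false (taylor a).
Proof.
rewrite /taylor; elim/big_ind: _ => [I _|f g|be _]; first by rewrite ffunE.
  exact: evenD.
by apply: (ext_partM (even_cst _)); apply: emon_even.
Qed.

Lemma taylor_cst a c : (forall be, D be a = if be == mi0 n then c else 0) ->
  taylor a = ext_cst p c.
Proof.
move=> Da; have b0 : mi0 n \in mi_box n p.
  by rewrite mem_mi_box; apply/forallP => i; rewrite ffunE.
rewrite /taylor (big_fsetD1 _ b0) /= Da eqxx emon0 mulr1.
rewrite big_seq big1 ?addr0 // => be.
by rewrite !inE => /andP[/negPf h _]; rewrite Da h rmorph0 mul0r.
Qed.

Lemma taylor_coord a c i : (forall be, D be a =
    (if be == mi0 n then c else 0) + (if be == mi1 i then 1 else 0)) ->
  taylor a = ext_cst p c + N i.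
Proof.
move=> Da; have b0 : mi0 n \in mi_box n p.
  by rewrite mem_mi_box; apply/forallP => j; rewrite ffunE.
rewrite /taylor; under eq_bigr do rewrite Da rmorphD mulrDl.
rewrite big_split /=; congr (_ + _).
  rewrite (big_fsetD1 _ b0) /= eqxx emon0 mulr1.
  rewrite big_seq big1 ?addr0 // => be.
  by rewrite !inE => /andP[/negPf h _]; rewrite h rmorph0 mul0r.
have [b1|nb1] := boolP (mi1 i \in mi_box n p).
  rewrite (big_fsetD1 _ b1) /= eqxx rmorph1 mul1r emon1 big_seq big1 ?addr0 // => be.
  by rewrite !inE => /andP[/negPf h _]; rewrite h rmorph0 mul0r.
rewrite -(emon1 N i) emon_out // big_seq big1 // => be beb; case: eqP => [e|_].
  by rewrite e (negPf nb1) in beb.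
by rewrite rmorph0 mul0r.
Qed.

Lemma taylor_zmod_morphism : zmod_morphism taylor.
Proof.
move=> a b; rewrite /taylor -sumrB; apply: eq_bigr => be _.
by rewrite D_B rmorphB mulrBl.
Qed.

(** Leibniz's rule turns the product into a sum over all pairs of multi-indices with
    sum in the box; the remaining pairs with both members in the box contribute
    zero. *)
Lemma taylor_monoid_morphism : monoid_morphism taylor.
Proof.
split=> [|a b]; first by rewrite (taylor_cst (c := 1)) // rmorph1.
pose G (x : mi n * mi n) := ext_cst p (D x.1 a * D x.2 b) * emon N (mi_add x.1 x.2).
have [S [SP SG]] := cauchy_sum (@mi_decP n) (mi_box n p).
transitivity (\sum_(x <- S) G x).
  rewrite -SG /taylor; apply: eq_bigr => be _.
  rewrite D_M rmorph_sum mulr_suml big_seq [RHS]big_seq.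
  by apply: eq_bigr => x; rewrite mi_decP => /eqP <-.
transitivity (\sum_(x <- (mi_box n p `*` mi_box n p)%fset) G x).
  apply: big_fset_incl => [|x _ xS]; last first.
    by rewrite /G emon_out ?mulr0 // -SP.
  apply/fsubsetP => x; rewrite SP in_fsetM !mem_mi_box => /forallP xp.
  by apply/andP; split; apply/forallP => i; apply: leq_trans (xp i);
    rewrite ffunE ?leq_addr ?leq_addl.
rewrite sum_rect mulr_suml; apply: eq_bigr => be _.
rewrite mulr_sumr; apply: eq_bigr => ga _.
rewrite /G /= emonD // rmorphM -!mulrA; congr (_ * _); rewrite !mulrA.
congr (_ * _); exact: (ext_even_central _ (even_cst _)).
Qed.

End Taylor.

Lemma taylor_nat n p (A A' C C' : comPzRingType) (D : mi n -> A -> C)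
  (D' : mi n -> A' -> C') (N : 'I_n -> exterior p C) (N' : 'I_n -> exterior p C')
  (sigma : A -> A') (tau : {rmorphism C -> C'}) :
  (forall be a, tau (D be a) = D' be (sigma a)) ->
  (forall i, ext_map tau (N i) = N' i) ->
  forall a, ext_map tau (taylor D N a) = taylor D' N' (sigma a).
Proof.
move=> DD NN a; rewrite /taylor rmorph_sum; apply: eq_bigr => be _.
rewrite rmorphM; congr (_ * _).
  by apply/ffunP => K; rewrite !ffunE; case: eqP; rewrite ?DD ?rmorph0.
by rewrite /emon rmorph_prod; apply: eq_bigr => i _; rewrite rmorphXn -NN.
Qed.

Lemma sign_comm (B : pzRingType) m (b : B) : (-1) ^+ m * b = b * (-1) ^+ m.
Proof.
by rewrite -signr_odd; case: (odd _); rewrite ?mulr1 ?mul1r // expr1 mulrN1 mulN1r.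
Qed.

Section Lift.
Variables (q : nat) (A : comPzRingType) (B : pzRingType) (T : {rmorphism A -> B}).
Hypothesis T_central : forall a b, T a * b = b * T a.
Variable xi : 'I_q -> B.
Hypothesis xi_anti : forall i j, xi i * xi j = - (xi j * xi i).
Hypothesis xi_sq : forall i, xi i * xi i = 0.
Implicit Types I J K : {set 'I_q}.

Definition xprod J : B := \prod_(j <- enum 'I_q | j \in J) xi j.

Lemma xprod_insert_seq (s : seq 'I_q) (j : 'I_q) J : sorted ltn (map val s) ->
  j \in s -> xi j * \prod_(i <- s | i \in J) xi i =
    if j \in J then 0 else (-1) ^+ (\sum_(i <- s | i \in J) (i < j))%N *
      \prod_(i <- s | i \in j |: J) xi i.
Proof.
elim: s => // i s IH sI; have lt_i : forall l, l \in s -> (i < l)%N.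
  move=> l ls; have := order_path_min ltn_trans sI => /allP /(_ (val l)).
  by apply; apply: map_f.
have {}IH := IH (path_sorted sI); rewrite inE; case: eqP => [ji _|ji /= js].
  rewrite ji in IH *; rewrite !big_cons; case: ifP => iJ.
    by rewrite mulrA xi_sq mul0r.
  have -> : (\sum_(l <- s | l \in J) (l < i))%N = 0%N.
    rewrite big_seq_cond big1 // => l /andP[ls _].
    by apply/eqP; rewrite eqb0 -leqNgt ltnW // lt_i.
  rewrite !inE eqxx /= mul1r; congr (_ * _); rewrite big_seq_cond [RHS]big_seq_cond.
  apply: eq_bigl => l; case ls: (l \in s) => //=; rewrite !inE.
  by case: eqP => // li; have := lt_i l ls; rewrite li ltnn.
rewrite !big_cons !inE (negPf (introN eqP (fun e : i = j => ji (esym e)))) /=.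
have [iJ|iJ] := boolP (i \in J); last exact: IH.
rewrite mulrA xi_anti mulNr -mulrA IH //; case: ifP => _; first by rewrite mulr0 oppr0.
rewrite (lt_i _ js) add1n exprS -!mulrA mulN1r; congr (- _).
by rewrite !mulrA sign_comm.
Qed.

Lemma sorted_enum : sorted ltn (map val (enum 'I_q)).
Proof. by rewrite val_enum_ord iota_ltn_sorted. Qed.

Lemma inversions1 (j : 'I_q) J :
  inversions [set j]%SET J = (\sum_(i <- enum 'I_q | i \in J) (i < j))%N.
Proof. by rewrite /inversions big_set1 big_enum_cond. Qed.

Lemma xprod_insert j J : xi j * xprod J =
  if j \in J then 0 else (-1) ^+ inversions [set j]%SET J * xprod (j |: J)%SET.
Proof.
by rewrite inversions1; apply: xprod_insert_seq; [exact: sorted_enum|rewrite mem_enum].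
Qed.

Lemma xprod0 : xprod finset.set0 = 1.
Proof. by rewrite /xprod big1 // => i; rewrite inE. Qed.

(** By splitting off the smallest element of [I], which is moved past elements of [J]
    only. *)
Lemma xprod_mul I J : xprod I * xprod J =
  if [disjoint I & J] then (-1) ^+ inversions I J * xprod (I :|: J)%SET else 0.
Proof.
have [m Im] : exists m, #|I| = m by eexists.
elim: m => [|m IH] in I Im *.
  have -> : I = finset.set0 by apply/eqP; rewrite -finset.cards_eq0 Im.
  rewrite xprod0 mul1r inversions0l mul1r finset.set0U.
  by rewrite -finset.setI_eq0 finset.set0I eqxx.
have [i0 i0I] : exists i, i \in I by apply/finset.set0Pn; rewrite -finset.card_gt0 Im.
pose i := [arg min_(j < i0 in I) j]%N.
have [iI imin] : i \in I /\ forall j, j \in I -> (i <= j)%N.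
  by rewrite /i; case: arg_minnP.
pose I' := (I :\ i)%SET; have iI' : i \notin I' by rewrite !inE eqxx.
have I'm : #|I'| = m by apply/eqP; rewrite -eqSS -Im (finset.cardsD1 i I) iI.
have eI : I = (i |: I')%SET by rewrite finset.setD1K.
have inv0 : inversions [set i]%SET I' = 0%N.
  rewrite /inversions big_set1 big1 // => j; rewrite !inE => /andP[_ /imin].
  by rewrite leqNgt => /negPf ->.
have xI : xprod I = xi i * xprod I'.
  by rewrite xprod_insert (negPf iI') inv0 mul1r -eI.
rewrite xI -mulrA IH //.
have dI : [disjoint I & J]%B = (i \notin J) && [disjoint I' & J]%B.
  by rewrite eI -finset.setI_eq0 finset.setIUl finset.setU_eq0 !finset.setI_eq0
    finset.disjoints1.
rewrite dI; have [dI'|_] := boolP [disjoint I' & J]%B; last by rewrite mulr0 andbF.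
rewrite mulrA -sign_comm -mulrA xprod_insert !inE eqxx /= andbT.
case iJ: (i \in J) => /=; first by rewrite mulr0.
rewrite mulrA -exprD finset.setUA -eI; congr ((-1) ^+ _ * _).
have iS : [set i]%SET \subset I by rewrite finset.sub1set.
rewrite (inversionsDl J iS) addnC; congr addn.
rewrite (inversionsDr [set i]%SET (finset.subsetUl I' J)) inv0 add0n.
rewrite finset.setDUl finset.setDv finset.set0U; congr inversions.
by apply/finset.setDidPl; rewrite disjoint_sym.
Qed.

(** Elements [xi j] that anticommute and have square zero extend a homomorphism [T]
    with central values to the exterior algebra. *)
Definition ext_lift (f : exterior q A) : B := \sum_(J : {set 'I_q}) T (f J) * xprod J.

Lemma ext_lift_zmod_morphism : zmod_morphism ext_lift.
Proof.
move=> f g; rewrite /ext_lift -sumrB; apply: eq_bigr => J _.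
by rewrite !ffunE rmorphB mulrBl.
Qed.

Lemma ext_lift_cst a : ext_lift (ext_cst q a) = T a.
Proof.
rewrite /ext_lift (bigD1 finset.set0) //= ffunE eqxx xprod0 mulr1 big1 ?addr0 //.
by move=> J /negPf J0; rewrite ffunE J0 rmorph0 mul0r.
Qed.

(** Products of the [xi] multiply like the basis of the exterior algebra, by
    [xprod_mul]. *)
Lemma ext_lift_monoid_morphism : monoid_morphism ext_lift.
Proof.
split=> [|f g]; first by rewrite -[1](rmorph1 (@ext_cst q A)) ext_lift_cst rmorph1.
rewrite /ext_lift mulr_suml.
under eq_bigr => K _ do rewrite [(f * g) K]ext_mulE rmorph_sum mulr_suml.
rewrite (exchange_big_dep xpredT) //=; apply: eq_bigr => I _.
rewrite mulr_sumr [RHS](bigID (fun J : {set 'I_q} => [disjoint I & J]%B)) /=.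
rewrite [X in _ = _ + X]big1 ?addr0; last first.
  move=> J /negPf dIJ; rewrite -mulrA [xprod I * _]mulrA -T_central -mulrA.
  by rewrite xprod_mul dIJ !mulr0.
rewrite (reindex_onto (fun J => I :|: J)%SET (fun K => K :\: I)%SET) /=; last first.
  by move=> K IK; rewrite finset.setDE finset.setUIr finset.setUCr
    finset.setIT; apply/finset.setUidPr.
apply: eq_big => [J|J].
  rewrite finset.subsetUl /= finset.setDUl finset.setDv finset.set0U disjoint_sym.
  by apply/eqP/idP => /finset.setDidPl.
move=> /andP[_ /eqP eJ]; rewrite eJ.
have dJI : [disjoint I & J]%B.
  rewrite disjoint_sym; apply/finset.setDidPl; rewrite -[RHS]eJ.
  by rewrite finset.setDUl finset.setDv finset.set0U.
rewrite -mulrA [xprod I * _]mulrA -[xprod I * _]T_central -mulrA xprod_mul dJI.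
rewrite !rmorphM rmorphXn rmorphN1 !mulrA; congr (_ * _); rewrite -!mulrA.
by rewrite sign_comm mulrA.
Qed.

Lemma xprod1 j : xprod [set j]%SET = xi j.
Proof.
have := xprod_insert j finset.set0.
by rewrite inE inversions0r mul1r finset.setU0 xprod0 mulr1 => ->.
Qed.

Lemma ext_lift_gen j :
  ext_lift ([ffun I => if I == [set j]%SET then 1 else 0] : exterior q A) = xi j.
Proof.
rewrite /ext_lift (bigD1 [set j]%SET) //= ffunE eqxx rmorph1 mul1r xprod1.
by rewrite big1 ?addr0 // => J /negPf Jj; rewrite ffunE Jj rmorph0 mul0r.
Qed.

End Lift.

Lemma ext_lift_nat q (A A' : comPzRingType) (B B' : pzRingType)
  (T : {rmorphism A -> B}) (T' : {rmorphism A' -> B'}) (xi : 'I_q -> B) (xi' : 'I_q -> B')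
  (sigma : {rmorphism A -> A'}) (rho : {rmorphism B -> B'}) :
  (forall a, rho (T a) = T' (sigma a)) -> (forall j, rho (xi j) = xi' j) ->
  forall f, rho (ext_lift T xi f) = ext_lift T' xi' (ext_map sigma f).
Proof.
move=> TT xx f; rewrite /ext_lift rmorph_sum; apply: eq_bigr => J _.
rewrite rmorphM TT ffunE; congr (_ * _).
by rewrite /xprod rmorph_prod; apply: eq_bigr => j _.
Qed.

Section Basis.
Variables (q : nat) (A : comPzRingType).
Local Notation E := (exterior q A).

Definition ext_gen (j : 'I_q) : E := [ffun I => if I == [set j]%SET then 1 else 0].
Definition ext_elt (J : {set 'I_q}) : E := [ffun I => if I == J then 1 else 0].

Lemma ext_gen_odd j : ext_part true (ext_gen j).
Proof.
move=> I Ie; rewrite ffunE; case: eqP => // I0.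
by rewrite I0 finset.cards1 in Ie.
Qed.

Lemma ext_elt_mul (I J : {set 'I_q}) : [disjoint I & J]%B ->
  ext_elt I * ext_elt J = (-1) ^+ inversions I J * ext_elt (I :|: J)%SET.
Proof.
move=> dIJ; apply/ffunP => K; rewrite [LHS]ext_mulE.
have -> : (-1) ^+ inversions I J = ext_cst q ((-1) ^+ inversions I J) :> E.
  by rewrite rmorphXn rmorphN1.
rewrite [RHS]ext_cst_mulE ffunE.
have [->|nK] := eqVneq K (I :|: J)%SET.
  rewrite (bigD1 I) ?finset.subsetUl //= big1 => [|L /andP[_ /negPf LI]].
    rewrite finset.setDUl finset.setDv finset.set0U.
    have -> : J :\: I = J by apply/finset.setDidPl; rewrite disjoint_sym.
    by rewrite !ffunE !eqxx addr0 mulr1.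
  by rewrite ffunE LI mul0r mulr0.
rewrite mulr0 big1 // => L LK; rewrite !ffunE; case: eqP => [LI|]; last by rewrite mul0r mulr0.
case: eqP => [KJ|]; last by rewrite !mulr0.
by case/eqP: nK; rewrite -KJ -LI finset.setDE finset.setUIr finset.setUCr
  finset.setIT; apply/esym/finset.setUidPr.
Qed.

Lemma ext_elt_prod (J : {set 'I_q}) : ext_elt J = xprod ext_gen J.
Proof.
have [m Jm] : exists m, #|J| = m by eexists.
elim: m => [|m IH] in J Jm *.
  have -> : J = finset.set0 by apply/eqP; rewrite -finset.cards_eq0 Jm.
  by rewrite xprod0; apply/ffunP => I; rewrite !ffunE.
have [j jJ] : exists j, j \in J by apply/finset.set0Pn; rewrite -finset.card_gt0 Jm.
pose J' := (J :\ j)%SET; have jJ' : j \notin J' by rewrite !inE eqxx.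
have J'm : #|J'| = m by apply/eqP; rewrite -eqSS -Jm (finset.cardsD1 j J) jJ.
have eJ : (j |: J')%SET = J by rewrite finset.setD1K.
have gen_sq i : ext_gen i * ext_gen i = 0.
  apply/ffunP => K; rewrite [LHS]ext_mulE ffunE big1 // => I IK; rewrite !ffunE.
  case: eqP => [->|]; last by rewrite mul0r mulr0.
  case: eqP => [Ki|]; last by rewrite !mulr0.
  by have := finset.set11 i; rewrite -Ki !inE eqxx.
have gen_anti i i' : ext_gen i * ext_gen i' = - (ext_gen i' * ext_gen i).
  by apply: ext_odd_anticomm; apply: ext_gen_odd.
have e1 := xprod_insert gen_anti gen_sq j J'; rewrite (negPf jJ') eJ in e1.
have e2 := @ext_elt_mul [set j]%SET J'; rewrite eJ (IH J') // in e2.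
have sgn m' (b c : E) : (-1) ^+ m' * b = (-1) ^+ m' * c -> b = c.
  by move/(congr1 (fun x => (-1) ^+ m' * x)); rewrite !mulrA -expr2 sqrr_sign !mul1r.
apply: sgn (inversions [set j]%SET J') _ _ _.
by rewrite -e1 -e2 // finset.disjoints1.
Qed.

Lemma ext_decomp (f : E) : f = \sum_J ext_cst q (f J) * ext_elt J.
Proof.
apply/ffunP => K; rewrite sum_ffunE.
have h J : (ext_cst q (f J) * ext_elt J) K = f J * ext_elt J K := ext_cst_mulE _ _ _.
rewrite (eq_bigr _ (fun J _ => h J)) (bigD1 K) //= big1 => [|J /negPf JK].
  by rewrite ffunE eqxx mulr1 addr0.
by rewrite ffunE eq_sym JK mulr0.
Qed.

End Basis.

(** * Affine super-spaces and the values of their sections *)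

Section Affine.
Variables (R : realType) (k : complete_field R) (n : nat).

(** A copy of the space of row vectors that carries the topology of [coord_open]. *)
Definition aff : Type := 'rV[k]_n.

HB.instance Definition _ := Choice.on aff.

Lemma coord_openT : coord_open (setT : set 'rV[k]_n).
Proof. by move=> x _; exists 1. Qed.

Lemma coord_openI : setI_closed (@coord_open R k n).
Proof.
move=> A B Ao Bo x [/Ao[r r0 rA] /Bo[s s0 sB]]; exists (Num.min r s).
  by rewrite lt_min r0.
by move=> h hr; split; [apply: rA|apply: sB]; apply: polydiscS hr;
  rewrite ge_min lexx ?orbT.
Qed.

Lemma coord_open_bigU (I : Type) (f : I -> set 'rV[k]_n) :
  (forall i, coord_open (f i)) -> coord_open (\bigcup_i f i).
Proof.
move=> fo x [i _ /fo[r r0 rf]]; exists r => // h /rf fh.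
by exists i.
Qed.

HB.instance Definition _ := isOpenTopological.Build aff
  coord_openT coord_openI coord_open_bigU.

Program Definition aff_chart : chart k aff :=
  @Chart R k aff n setT idfun _ _ _ _.
Next Obligation. exact: openT. Qed.
Next Obligation. by []. Qed.
Next Obligation. by move=> D oD; rewrite setTI. Qed.
Next Obligation. by move=> U oU _; rewrite image_id. Qed.

Program Definition affine : manifold k := @Manifold R k aff [set aff_chart] _ _.
Next Obligation. by move=> x; exists aff_chart. Qed.
Next Obligation.
move=> _ _ -> -> i; exists (fun y => y 0 i) => //.
by apply: analytic_coord; rewrite image_id setTI; exact: coord_openT.
Qed.

Lemma aff_image (U : set aff) : (idfun : aff -> 'rV[k]_n) @` (U `&` setT) = U.
Proof. by rewrite setIT image_id. Qed.

Section Functions.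
Variable U : opens affine.

Lemma aff_fun_analytic (g : 'rV[k]_n -> k) : analytic_on (U : set aff) g ->
  forall c, @atlas R k affine c -> @analytic_in_chart R k _ c U (fun x => g (val x)).
Proof. by move=> gU _ ->; exists g => //; rewrite aff_image. Qed.

Definition aff_fun g (h : analytic_on (U : set aff) g) : analytic_fun (U : set affine) :=
  AnalyticFun (aff_fun_analytic h).

(** Analytic functions on [U] are handled through their extension by zero, in order
    to compute with functions on the whole space instead of dependent pairs. *)
Definition tot (f : analytic_fun (U : set affine)) (x : 'rV[k]_n) : k :=
  if pselect ((U : set aff) x) is left h then f (exist _ x (mem_set h)) else 0.

Lemma totE f (y : U) : tot f (val y) = f y.
Proof.
rewrite /tot; case: pselect => [h|[]]; last exact: set_valP.
by congr (f _); apply: val_inj.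
Qed.

Lemma tot_aff_fun g (h : analytic_on (U : set aff) g) x :
  (U : set aff) x -> tot (aff_fun h) x = g x.
Proof. by rewrite /tot; case: pselect. Qed.

Lemma tot_analytic f : analytic_on (U : set aff) (tot f).
Proof.
have [g gf] := af_analytic f (erefl : @atlas R k affine aff_chart).
rewrite aff_image => gU; apply: analytic_local; first exact: (oset_open U).
move=> x Ux; exists (U : set aff), g; split=> // y Uy _.
by rewrite -[y]/(val (exist _ y (mem_set Uy) : U)) totE -gf.
Qed.

Lemma tot_ext f g : (forall x, (U : set aff) x -> tot f x = tot g x) -> f = g.
Proof.
by move=> fg; apply: af_ext => y; rewrite -!totE; apply: fg; exact: set_valP.
Qed.

Lemma totB f g x : tot (f - g) x = tot f x - tot g x.
Proof. by rewrite /tot; case: pselect => // _; rewrite subr0. Qed.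

Lemma tot0 x : tot 0 x = 0.
Proof. by rewrite /tot; case: pselect. Qed.

Lemma totD f g x : tot (f + g) x = tot f x + tot g x.
Proof. by rewrite /tot; case: pselect => // _; rewrite addr0. Qed.

Lemma totN f x : tot (- f) x = - tot f x.
Proof. by rewrite /tot; case: pselect => // _; rewrite oppr0. Qed.

Lemma totM f g x : tot (f * g) x = tot f x * tot g x.
Proof. by rewrite /tot; case: pselect => // _; rewrite mul0r. Qed.

Lemma tot_cst c x : (U : set aff) x -> tot (af_cst U c) x = c.
Proof. by rewrite /tot; case: pselect. Qed.

Lemma tot1 x : (U : set aff) x -> tot 1 x = 1.
Proof. exact: tot_cst. Qed.

Section Eval.
Variables (x : 'rV[k]_n) (Ux : (U : set aff) x).

Definition af_eval (f : analytic_fun (U : set affine)) : k := f (exist _ x (mem_set Ux)).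

Lemma af_evalE f : af_eval f = tot f x.
Proof. by rewrite /af_eval -(totE f (exist _ x (mem_set Ux))). Qed.

Lemma af_eval_zmod_morphism : zmod_morphism af_eval.
Proof. by []. Qed.
Lemma af_eval_monoid_morphism : monoid_morphism af_eval.
Proof. by []. Qed.

HB.instance Definition _ := GRing.isZmodMorphism.Build
  (analytic_fun (U : set affine)) k af_eval af_eval_zmod_morphism.
HB.instance Definition _ := GRing.isMonoidMorphism.Build
  (analytic_fun (U : set affine)) k af_eval af_eval_monoid_morphism.

End Eval.
End Functions.

Lemma tot_restr (U V : opens affine) (h : V `<=` U) f x : (V : set aff) x ->
  tot (af_restr h f) x = tot f x.
Proof.
move=> Vx; have Ux := h _ Vx.
by rewrite /tot; case: pselect => // Vx'; case: pselect => // Ux' /=;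
  congr (f _); apply: val_inj.
Qed.

End Affine.

Lemma ext_body_mul p (A : comPzRingType) (f g : exterior p A) :
  (f * g) finset.set0 = f finset.set0 * g finset.set0.
Proof.
rewrite [LHS]ext_mulE (big_pred1 finset.set0) => [|I].
  by rewrite finset.setD0 inversions0l mul1r.
by rewrite finset.subset0.
Qed.

Section LambdaPoints.
Variables (R : realType) (k : complete_field R).

Definition AA n q : super_ringed_space k := model (affine k n) q.

(** The values of the sections of a super-domain at a point. [lbody] and [lfil] are
    its augmentation and its filtration by the powers of the kernel. *)
Definition lam p : super_algebra k :=
  exterior_super_algebra p (GRing.RMorphism.clone k k idfun _).

Definition lbody p (x : lam p) : k := (x : exterior p k) finset.set0.
Definition lfil p N (x : lam p) := fil N (x : exterior p k).

Lemma lbodyB p (x y : lam p) : lbody (x - y) = lbody x - lbody y.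
Proof. by rewrite /lbody !ffunE. Qed.

Lemma lbodyM p (x y : lam p) : lbody (x * y) = lbody x * lbody y.
Proof. exact: ext_body_mul. Qed.

Lemma lbody_alg p (c : k) : lbody (sa_alg (lam p) c) = c.
Proof. by rewrite /lbody ffunE eqxx. Qed.

Lemma lbody1 p : lbody (1 : lam p) = 1.
Proof. by rewrite -[1 : lam p](rmorph1 (sa_alg (lam p))) lbody_alg. Qed.

Lemma lfil_0 p (x : lam p) : lfil 0 x.
Proof. exact: fil0. Qed.

Lemma lfil_1 p (x : lam p) : lbody x = 0 -> lfil 1 x.
Proof. exact: fil1. Qed.

Lemma lfilM p N N' (x y : lam p) : lfil N x -> lfil N' y -> lfil (N + N') (x * y).
Proof. exact: filM. Qed.

Lemma lfil_sum p N (T : Type) (s : seq T) (F : T -> lam p) :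
  (forall i, lfil N (F i)) -> lfil N (\sum_(i <- s) F i).
Proof. exact: fil_sum. Qed.

Lemma lfil_null p (x : lam p) : lfil p.+1 x -> x = 0.
Proof. exact: fil_null. Qed.

Section Ev.
Variables (m p : nat) (U : opens (AA m p)) (x : 'rV[k]_m) (Ux : (U : set (aff k m)) x).

Definition ev : sa_hom ('O_(AA m p) U) (lam p) :=
  @exterior_hom k p (analytic_fun (U : set (affine k m))) k
    (GRing.RMorphism.clone k (analytic_fun (U : set (affine k m)))
       (@af_cst R k (affine k m) U) _) (GRing.RMorphism.clone k k idfun _)
    (GRing.RMorphism.clone _ _ (@af_eval R k m U x Ux) _) (fun c => erefl).

Lemma evE (s : 'O_(AA m p) U) K : (ev s : exterior p k) K =
  tot ((s : exterior p (analytic_fun (U : set (affine k m)))) K) x.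
Proof. by rewrite ffunE [LHS]af_evalE. Qed.

End Ev.

(** Points suffice although the odd coordinates vanish at each of them, because [ev]
    keeps the odd coefficients instead of passing to the residue field. *)
Lemma ev_ext m p (U : opens (AA m p)) (s t : 'O_(AA m p) U) :
  (forall x (Ux : (U : set (aff k m)) x), ev Ux s = ev Ux t) -> s = t.
Proof.
move=> st; apply/ffunP => K; apply: tot_ext => x Ux.
by rewrite -!(evE Ux) st.
Qed.

Lemma ev_restr m p (U V : opens (AA m p)) (h : V `<=` U) x
  (Ux : (U : set (aff k m)) x) (Vx : (V : set (aff k m)) x) (s : 'O_(AA m p) U) :
  ev Vx (restr 'O_(AA m p) h s) = ev Ux s.
Proof. by apply/ffunP => K; rewrite !evE ffunE tot_restr. Qed.

End LambdaPoints.

(** * A morphism to affine super-space is determined by its coordinates *)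

Section SuperDomainMaps.
Variables (R : realType) (k : complete_field R).
Variables (m p n q : nat) (D : opens (AA k m p)).
Local Notation Q := (open_subspace D).
Local Notation Y := (AA k n q).
Local Notation af V := (analytic_fun (V : set (affine k n))).

Lemma coord_on (V : opens Y) i : analytic_on (V : set (aff k n)) (fun y => y 0 i).
Proof. by apply: analytic_coord; exact: (oset_open V). Qed.

Definition xfun (V : opens Y) i : af V := aff_fun (@coord_on V i).
Definition ycst (V : opens Y) : {rmorphism af V -> 'O_Y V} :=
  GRing.RMorphism.clone (af V) (exterior q (af V)) (@ext_cst q (af V)) _.
Definition xcoord (V : opens Y) i : 'O_Y V := ycst V (xfun V i).
Definition theta (V : opens Y) j : 'O_Y V := ext_gen (af V) j.

Lemma xcoord_restr (V W : opens Y) (h : W `<=` V) i :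
  restr 'O_Y h (xcoord V i) = xcoord W i.
Proof.
apply/ffunP => K; rewrite !ffunE; case: eqP => // _; last exact: af_ext.
by apply: af_ext.
Qed.

Lemma theta_restr (V W : opens Y) (h : W `<=` V) j :
  restr 'O_Y h (theta V j) = theta W j.
Proof. by apply/ffunP => K; rewrite !ffunE; case: eqP => // _; apply: af_ext. Qed.

Lemma ycst_alg (V : opens Y) c : ycst V (af_cst V c) = sa_alg ('O_Y V) c.
Proof. by []. Qed.

Lemma ycst_restr (V W : opens Y) (h : W `<=` V) (f : af V) :
  restr 'O_Y h (ycst V f) = ycst W (af_restr h f).
Proof. by apply/ffunP => K; rewrite !ffunE; case: eqP => // _; apply: af_ext. Qed.

Lemma sub_pt (W : opens Q) (z : Q) : (W : set Q) z -> (image_opens W : set (aff k m)) (val z).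
Proof. by move=> Wz; exists z. Qed.

Definition pval_at (phi : srs_hom Q Y) (V : opens Y) z (h : (V : set Y) (phi z)) :
    sa_hom ('O_Y V) (lam k p) :=
  sa_comp (ev (sub_pt (h : (preim_opens (srs_map_continuous phi) V : set Q) z)))
    (pullback phi V).

Lemma pval_atE (phi : srs_hom Q Y) (V : opens Y) z (h : (V : set Y) (phi z)) s :
  pval_at h s =
  ev (sub_pt (h : (preim_opens (srs_map_continuous phi) V : set Q) z)) (pullback phi V s).
Proof. exact: sa_compE. Qed.

Lemma pval_at_pb (phi : srs_hom Q Y) (V : opens Y) z (h : (V : set Y) (phi z))
  (W : opens Q) (hW : W `<=` phi @^-1` V) (Wz : (W : set Q) z) s :
  pval_at h s = ev (sub_pt Wz) (pb hW s).
Proof.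
rewrite pval_atE.
exact: esym (ev_restr _ (sub_pt (h : (preim_opens _ V : set Q) z)) (sub_pt Wz) _).
Qed.

Lemma pval_at_restr (phi : srs_hom Q Y) (V W : opens Y) (hW : W `<=` V) z
  (h : (V : set Y) (phi z)) (h' : (W : set Y) (phi z)) s :
  pval_at h' (restr 'O_Y hW s) = pval_at h s.
Proof.
rewrite !pval_atE pullback_restr.
exact: (ev_restr _ (sub_pt (h : (preim_opens _ V : set Q) z))).
Qed.

Lemma pval_at_alg (phi : srs_hom Q Y) (V : opens Y) z (h : (V : set Y) (phi z)) c :
  pval_at h (sa_alg _ c) = sa_alg _ c.
Proof. exact: sa_fun_alg. Qed.

(** This is why the underlying map of a morphism can be read off the pullbacks. If
    the value [c] of the pulled back coordinate differed from the coordinate of the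
    image point, then the coordinate minus [c] would be invertible near the image
    point, but not its pullback. *)
Lemma coord_body (phi : srs_hom Q Y) (V : opens Y) z (h : (V : set Y) (phi z)) i :
  lbody (pval_at h (xcoord V i)) = (phi z : 'rV[k]_n) 0 i.
Proof.
pose c := lbody (pval_at h (xcoord V i)).
apply: contrapT => ne.
have oV : open [set y : aff k n | y 0 i != c].
  exact: analytic_open (@analytic_coord_inv R k n i c).
pose V' : opens Y := Opens oV.
have h' : (V' : set Y) (phi z) by apply/eqP => e; apply: ne.
pose inv : af V' := aff_fun (U := V') (@analytic_coord_inv R k n i c).
have e : (xcoord V' i - sa_alg ('O_Y V') c) * ycst V' inv = 1.
  rewrite -ycst_alg -rmorphB -rmorphM.
  have -> : (xfun V' i - af_cst V' c) * inv = 1.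
    apply: tot_ext => y V'y; rewrite totM totB !tot_aff_fun // tot_cst // tot1 //.
    by rewrite mulfV // subr_eq0.
  exact: rmorph1.
have := congr1 (fun s => lbody (pval_at h' s)) e.
rewrite rmorphM rmorph1 lbodyM rmorphB lbodyB pval_at_alg lbody_alg lbody1.
have -> : lbody (pval_at h' (xcoord V' i)) = c.
  pose F := full Y; have hF : (F : set Y) (phi z) by [].
  have hV : V `<=` F by []. have hV' : V' `<=` F by [].
  rewrite -(xcoord_restr hV') (pval_at_restr hV' hF).
  by rewrite /c -(xcoord_restr hV) (pval_at_restr hV hF).
by rewrite subrr mul0r => /esym/eqP; rewrite oner_eq0.
Qed.

Lemma hadamard_near (V : opens Y) (f : af V) (y : aff k n) : (V : set Y) y ->
  exists (V' : opens Y) (h : V' `<=` V) (G : 'I_n -> af V'), (V' : set Y) y /\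
    af_restr h f = af_cst V' (tot f y) +
      \sum_i (xfun V' i - af_cst V' (y 0 i)) * G i.
Proof.
move=> Vy; have [r [a [fa rV]]] := analytic_has_ps (tot_analytic f) Vy.
have [r0 ar fA] := fa; have [b [br ab]] := hadamard r0 ar.
have oV : open ([set y + h | h in polydisc r] : set (aff k n)) := @polydisc_open R k n y r.
pose V' : opens Y := Opens oV.
have hV : V' `<=` V by move=> _ [h hr <-]; apply: rV.
have bps i : has_ps (fun x => pval (b i) (x - y)) y r (b i).
  by split=> // h hr; rewrite addrAC subrr add0r.
exists V', hV, (fun i => aff_fun (U := V') (has_ps_analytic_disc (bps i))); split.
  by exists 0; [exact: polydisc0|rewrite addr0].
apply: tot_ext => _ [h hr <-]; set x := y + h.
have V'x : (V' : set Y) x by exists h.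
rewrite (tot_restr hV) // fA // ab // -(has_ps_0 fa).
rewrite -[RHS](af_evalE V'x) rmorphD rmorph_sum; congr (_ + _).
apply: eq_bigr => i _; rewrite rmorphM rmorphB; congr (_ * _).
  transitivity (tot (xfun V' i) x - tot (af_cst V' (y 0 i)) x).
    by rewrite tot_aff_fun // tot_cst // /x mxE addrAC subrr add0r.
  by rewrite -!(af_evalE V'x).
apply: etrans (esym (af_evalE V'x _)); rewrite tot_aff_fun //.
by rewrite /x addrAC subrr add0r.
Qed.

Section Unique.
Variables phi psi : srs_hom Q Y.
Hypothesis same_coord : forall i,
  pb (fullS phi) (xcoord (full Y) i) = pb (fullS psi) (xcoord (full Y) i).
Hypothesis same_theta : forall j,
  pb (fullS phi) (theta (full Y) j) = pb (fullS psi) (theta (full Y) j).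

Lemma coord_at (V : opens Y) z (h : (V : set Y) (phi z)) (h' : (V : set Y) (psi z)) i :
  pval_at h (xcoord V i) = pval_at h' (xcoord V i).
Proof.
have Fz : (full Q : set Q) z by [].
have hV : V `<=` full Y by [].
rewrite -(xcoord_restr hV) (pval_at_restr hV Logic.I).
rewrite (pval_at_restr hV Logic.I).
by rewrite (pval_at_pb _ (fullS phi) Fz) (pval_at_pb _ (fullS psi) Fz) same_coord.
Qed.

Lemma theta_at (V : opens Y) z (h : (V : set Y) (phi z)) (h' : (V : set Y) (psi z)) j :
  pval_at h (theta V j) = pval_at h' (theta V j).
Proof.
have Fz : (full Q : set Q) z by [].
have hV : V `<=` full Y by [].
rewrite -(theta_restr hV) (pval_at_restr hV Logic.I).
rewrite (pval_at_restr hV Logic.I).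
by rewrite (pval_at_pb _ (fullS phi) Fz) (pval_at_pb _ (fullS psi) Fz) same_theta.
Qed.

Lemma same_map z : phi z = psi z.
Proof.
apply/rowP => i; have F (y : Y) : (full Y : set Y) y by [].
by rewrite -(coord_body (F (phi z))) -(coord_body (F (psi z))) (coord_at _ (F (psi z))).
Qed.

(** By [hadamard_near] the difference of the two values of [f] is a combination of
    such differences with coefficients in the augmentation ideal, namely the common
    values of the coordinates minus their constant terms. *)
Lemma pval_at_fil N (V : opens Y) (f : af V) z (h : (V : set Y) (phi z))
    (h' : (V : set Y) (psi z)) :
  lfil N (pval_at h (ycst V f) - pval_at h' (ycst V f)).
Proof.
elim: N => [|N IH] in V f h h' *; first exact: lfil_0.
have [V' [hV [G [V'y e]]]] := hadamard_near f h.
have V'y' : (V' : set Y) (psi z) by rewrite -same_map.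
rewrite -(pval_at_restr hV h V'y) -(pval_at_restr hV h' V'y') ycst_restr e.
rewrite !rmorphD !rmorph_sum.
rewrite !ycst_alg !pval_at_alg opprD addrACA subrr add0r -sumrB.
apply: lfil_sum => i; rewrite rmorphM rmorphB ycst_alg -/(xcoord V' i).
rewrite !rmorphM !rmorphB !pval_at_alg.
rewrite (coord_at V'y V'y') -mulrBr -add1n; apply: lfilM; last exact: IH.
apply: lfil_1; rewrite lbodyB lbody_alg coord_body same_map.
by rewrite subrr.
Qed.

Lemma pval_at_eq (V : opens Y) (s : 'O_Y V) z (h : (V : set Y) (phi z))
    (h' : (V : set Y) (psi z)) : pval_at h s = pval_at h' s.
Proof.
have cst (f : af V) : pval_at h (ycst V f) = pval_at h' (ycst V f).
  apply/eqP; rewrite -subr_eq0; apply/eqP; apply: lfil_null.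
  exact: pval_at_fil.
have -> : s = \sum_J ycst V ((s : exterior q (af V)) J) *
    (\prod_(j <- enum 'I_q | j \in J) theta V j).
  rewrite [LHS](@ext_decomp q (af V)); apply: eq_bigr => J _; congr (_ * _).
  exact: ext_elt_prod.
rewrite !rmorph_sum; apply: eq_bigr => J _; rewrite !rmorphM cst; congr (_ * _).
rewrite !rmorph_prod; apply: eq_bigr => j _.
exact: theta_at.
Qed.

(** By [pval_at_eq] the two morphisms agree on values at points, and [ev_ext]
    applies. *)
Lemma domain_map_uniq : phi = psi.
Proof.
apply: srs_ext_local => [z|V s z Vz]; first exact: same_map.
pose W := preim_opens (srs_map_continuous phi) V.
have hW : W `<=` psi @^-1` V by move=> y; rewrite /W /= same_map.
exists W, (preimP (V := V)), hW; split=> //.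
apply: (@ev_ext R k m p (image_opens W)) => x Ux; have [y Wy yx] := Ux.
move: Ux; rewrite -yx => Ux; have -> : Ux = sub_pt Wy by apply: Prop_irrelevance.
by rewrite -(pval_at_pb Wy) -(pval_at_pb (hW _ Wy)); apply: pval_at_eq.
Qed.

End Unique.
End SuperDomainMaps.

(** * Morphisms with prescribed coordinates *)

Section Substitution.
Variables (R : realType) (k : complete_field R).
Hypothesis two_neq0 : (2%:R : k) != 0.
Variables (m p n q : nat).

Local Notation afm U := (analytic_fun (U : set (affine k m))).
Local Notation afn V := (analytic_fun (V : set (affine k n))).

Definition base_point (U : opens (affine k m)) (X : 'I_n -> exterior p (afm U))
  (x : 'rV[k]_m) : 'rV[k]_n := \row_i tot (X i finset.set0) x.

Section At.
Variables (V : opens (affine k n)) (U : opens (affine k m)).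
Variables (X : 'I_n -> exterior p (afm U)) (Xi : 'I_q -> exterior p (afm U)).
Local Notation xf i := (@xfun R k n q (V : opens (AA k n q)) i).
Hypothesis X_even : forall i, ext_part false (X i).
Hypothesis Xi_odd : forall j, ext_part true (Xi j).
Hypothesis XV : forall x, (U : set (aff k m)) x -> (V : set (aff k n)) (base_point X x).

Lemma hasse_base_analytic be (f : afn V) : analytic_on (U : set (aff k m))
  (fun x => hasse be (tot f) (base_point X x)).
Proof.
apply: (analytic_comp (D := (V : set (aff k n)))).
- exact: (oset_open U).
- by move=> i; apply: tot_analytic.
- exact: XV.
- by apply: analytic_hasse; apply: tot_analytic.
Qed.

Definition hbase be (f : afn V) : afm U := aff_fun (@hasse_base_analytic be f).
Definition nilp i : exterior p (afm U) := X i - ext_cst p (X i finset.set0).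

Lemma tot_hbase be f x : (U : set (aff k m)) x ->
  tot (hbase be f) x = hasse be (tot f) (base_point X x).
Proof. exact: tot_aff_fun. Qed.

Lemma nilp_even i : ext_part false (nilp i).
Proof.
move=> I Io; rewrite !ffunE (X_even i Io); have [I0|_] := eqVneq I finset.set0; last by rewrite subr0.
by rewrite I0 finset.cards0 in Io.
Qed.

Lemma nilp_fil i : fil 1 (nilp i).
Proof. by apply: fil1; rewrite !ffunE eqxx subrr. Qed.

Lemma hbase_B be f g : hbase be (f - g) = hbase be f - hbase be g.
Proof.
apply: tot_ext => x Ux; rewrite totB !tot_hbase //.
have -> : tot (f - g) = (fun y => tot f y + - tot g y).
  by apply/funext => y; rewrite totB.
have Vx := XV Ux; have fa := @tot_analytic _ _ _ _ f; have ga := @tot_analytic _ _ _ _ g.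
by rewrite (hasse_add fa (analyticN ga) Vx) (hasse_opp ga Vx).
Qed.

Lemma hbase_cst be c : hbase be (af_cst V c) =
  if be == mi0 n then af_cst U c else 0.
Proof.
apply: tot_ext => x Ux; rewrite tot_hbase //.
rewrite (@hasse_local _ _ _ V _ (fun=> c) _ (@tot_analytic _ _ _ _ (af_cst V c)) (XV Ux)).
  rewrite hasse_cst; case: eqP => _; first by rewrite tot_cst.
  by rewrite tot0.
by move=> y Vy; rewrite tot_cst.
Qed.

Lemma hbase_coord be i : hbase be (xf i) =
  (if be == mi0 n then X i finset.set0 else 0) + (if be == mi1 i then 1 else 0).
Proof.
apply: tot_ext => x Ux; rewrite tot_hbase //.
rewrite (@hasse_local _ _ _ V _ (fun y => y 0 i) _ (@tot_analytic _ _ _ _ (xf i)) (XV Ux)).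
  rewrite hasse_coord totD mxE.
  by congr (_ + _); case: eqP => _; rewrite ?tot0 ?tot1.
by move=> y Vy; rewrite tot_aff_fun.
Qed.

Lemma hbase_M be f g : hbase be (f * g) =
  \sum_(x <- mi_dec be) hbase x.1 f * hbase x.2 g.
Proof.
apply: tot_ext => x Ux; rewrite tot_hbase //.
have -> : tot (f * g) = (fun y => tot f y * tot g y).
  by apply/funext => y; rewrite totM.
have Vx := XV Ux; have fa := @tot_analytic _ _ _ _ f; have ga := @tot_analytic _ _ _ _ g.
rewrite (hasse_mul fa ga Vx) -(af_evalE Ux) rmorph_sum; apply: eq_bigr => y _.
by rewrite rmorphM; congr (_ * _); rewrite -tot_hbase // -(af_evalE Ux).
Qed.

Lemma hbase_1 be : hbase be 1 = if be == mi0 n then 1 else 0.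
Proof. exact: hbase_cst. Qed.

(** A function [f] of the even coordinates is evaluated at [X = b + nilp] by Taylor's
    formula at the body [b] of [X]. *)
Definition subst0_fun : afn V -> exterior p (afm U) := taylor hbase nilp.
Definition subst0 : {rmorphism afn V -> exterior p (afm U)} := HB.pack subst0_fun
  (GRing.isZmodMorphism.Build _ _ subst0_fun (taylor_zmod_morphism hbase_B nilp))
  (GRing.isMonoidMorphism.Build _ _ subst0_fun
     (taylor_monoid_morphism hbase_1 hbase_M nilp_even nilp_fil)).

Lemma subst0_even f : ext_part false (subst0 f).
Proof. exact: taylor_even nilp_even f. Qed.

Lemma subst0_central f (b : exterior p (afm U)) : subst0 f * b = b * subst0 f.
Proof. exact: ext_even_central (subst0_even f). Qed.

Lemma Xi_anti i j : Xi i * Xi j = - (Xi j * Xi i).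
Proof. exact: ext_odd_anticomm. Qed.

(** Anticommutation gives twice the square, whence the assumption on the
    characteristic. *)
Lemma Xi_sq j : Xi j * Xi j = 0.
Proof.
have := Xi_anti j j; set y := Xi j * Xi j => yy.
apply/ffunP => K; have -> : (0 : exterior p (afm U)) K = 0 by rewrite ffunE.
apply: tot_ext => x Ux.
have e : y K = - y K by rewrite {1}yy ffunE.
have e2 : tot (y K) x = - tot (y K) x by rewrite {1}e totN.
apply/eqP; rewrite tot0; have : 2%:R * tot (y K) x == 0.
  by rewrite mulr_natl mulr2n {2}e2 subrr.
by rewrite mulf_eq0 (negPf two_neq0).
Qed.

Definition subst_fun : exterior q (afn V) -> exterior p (afm U) :=
  ext_lift subst0 Xi.
Definition subst_rmorph : {rmorphism exterior q (afn V) -> exterior p (afm U)} :=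
  HB.pack subst_fun
  (GRing.isZmodMorphism.Build _ _ subst_fun (ext_lift_zmod_morphism subst0 Xi))
  (GRing.isMonoidMorphism.Build _ _ subst_fun
     (ext_lift_monoid_morphism subst0_central Xi_anti Xi_sq)).

Lemma subst_cst c : subst_rmorph (ext_cst q (af_cst V c)) = ext_cst p (af_cst U c).
Proof.
apply: etrans (ext_lift_cst _ _ _) _.
by apply: taylor_cst => be; apply: hbase_cst.
Qed.

Lemma subst_coord i : subst_rmorph (ext_cst q (xf i)) = X i.
Proof.
apply: etrans (ext_lift_cst _ _ _) _.
apply: etrans (taylor_coord nilp_fil (fun be => hbase_coord be i)) _.
by rewrite /nilp addrC subrK.
Qed.

Lemma subst_gen j : subst_rmorph (ext_gen (afn V) j) = Xi j.
Proof. exact: ext_lift_gen Xi_anti Xi_sq j. Qed.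

Lemma xprod_part (J : {set 'I_q}) : ext_part (odd #|J|) (xprod Xi J).
Proof.
have [l Jl] : exists l, #|J| = l by eexists.
elim: l => [|l IH] in J Jl *.
  have -> : J = finset.set0 by apply/eqP; rewrite -finset.cards_eq0 Jl.
  by rewrite xprod0 finset.cards0; apply: even1.
have [j jJ] : exists j, j \in J by apply/finset.set0Pn; rewrite -finset.card_gt0 Jl.
pose J' := (J :\ j)%SET; have jJ' : j \notin J' by rewrite !inE eqxx.
have J'l : #|J'| = l by apply/eqP; rewrite -eqSS -Jl (finset.cardsD1 j J) jJ.
have := xprod_insert Xi_anti Xi_sq j J'; rewrite (negPf jJ') finset.setD1K // => e.
have e' : xprod Xi J = ext_cst p ((-1) ^+ inversions [set j]%SET J') * (Xi j * xprod Xi J').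
  by rewrite e mulrA rmorphXn rmorphN1 -expr2 sqrr_sign mul1r.
rewrite e' Jl /= -[X in ext_part X]addbF addbC; apply: (ext_partM (even_cst _)).
rewrite -J'l -addTb; apply: (ext_partM (Xi_odd j)); exact: IH.
Qed.

Lemma subst_part i (f : exterior q (afn V)) : ext_part i f -> ext_part i (subst_rmorph f).
Proof.
move=> fi I Ii; change (subst_fun f I = 0); rewrite /subst_fun /ext_lift sum_ffunE big1 // => J _.
have [Ji|Ji] := eqVneq (odd #|J|) i; last by rewrite fi // rmorph0 mul0r ffunE.
rewrite -Ji in Ii; have := ext_partM (@subst0_even (f J)) (@xprod_part J).
by move/(_ I); apply; rewrite addFb.
Qed.

Definition subst : sa_hom (exterior_super_algebra q
     (GRing.RMorphism.clone k (afn V) (@af_cst R k (affine k n) V) _))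
    (exterior_super_algebra p
     (GRing.RMorphism.clone k (afm U) (@af_cst R k (affine k m) U) _)) :=
  @SaHom k (exterior_super_algebra q
     (GRing.RMorphism.clone k (afn V) (@af_cst R k (affine k n) V) _))
    (exterior_super_algebra p
     (GRing.RMorphism.clone k (afm U) (@af_cst R k (affine k m) U) _))
    subst_rmorph subst_cst subst_part.

End At.
End Substitution.

Section SubstitutionNatural.
Variables (R : realType) (k : complete_field R).
Hypothesis two_neq0 : (2%:R : k) != 0.
Variables (m p n q : nat).

Local Notation afm U := (analytic_fun (U : set (affine k m))).
Local Notation afn V := (analytic_fun (V : set (affine k n))).

(** Hasse derivatives are local, so that the pullbacks over the various open sets
    are compatible with restriction. *)
Lemma subst_nat (V V' : opens (affine k n)) (U U' : opens (affine k m))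
  (hV : V' `<=` V) (hU : U' `<=` U)
  (X : 'I_n -> exterior p (afm U)) (Xi : 'I_q -> exterior p (afm U))
  (X' : 'I_n -> exterior p (afm U')) (Xi' : 'I_q -> exterior p (afm U'))
  (Xe : forall i, ext_part false (X i)) (Xio : forall j, ext_part true (Xi j))
  (Xe' : forall i, ext_part false (X' i)) (Xio' : forall j, ext_part true (Xi' j))
  (XV : forall x, (U : set (aff k m)) x -> (V : set (aff k n)) (base_point X x))
  (XV' : forall x, (U' : set (aff k m)) x -> (V' : set (aff k n)) (base_point X' x)) :
  (forall i, ext_map (af_restr hU) (X i) = X' i) ->
  (forall j, ext_map (af_restr hU) (Xi j) = Xi' j) ->
  forall s, ext_map (af_restr hU) (subst two_neq0 Xe Xio XV s) =
    subst two_neq0 Xe' Xio' XV' (ext_map (af_restr hV) s).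
Proof.
move=> XX XXi s.
pose sigma : {rmorphism afn V -> afn V'} := GRing.RMorphism.clone _ _ (af_restr hV) _.
pose tau : {rmorphism afm U -> afm U'} := GRing.RMorphism.clone _ _ (af_restr hU) _.
pose rho : {rmorphism exterior p (afm U) -> exterior p (afm U')} :=
  GRing.RMorphism.clone _ _ (@ext_map p _ _ tau) _.
apply: (@ext_lift_nat q _ _ _ _ (subst0 Xe XV) (subst0 Xe' XV') Xi Xi' sigma rho) => //.
move=> f; apply: (@taylor_nat n p _ _ _ _ (hbase XV) (hbase XV') (nilp X) (nilp X') sigma tau).
- move=> be g; apply: tot_ext => x Ux.
  rewrite [LHS](tot_restr hU) // !tot_hbase //; last exact: (hU _ Ux).
  have e : base_point X x = base_point X' x.
    by apply/rowP => i; rewrite !mxE -XX ffunE tot_restr.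
  have Vx := XV' _ Ux; rewrite e.
  have gV' : analytic_on (V' : set (aff k n)) (tot g).
    by apply: analytic_sub (tot_analytic g) => //; exact: (oset_open V').
  by apply: (hasse_local gV' Vx) => y Vy; rewrite tot_restr.
- move=> i; rewrite /nilp rmorphB /= -XX; congr (_ - _).
  by apply/ffunP => K; rewrite !ffunE; case: eqP => // _; rewrite rmorph0.
Qed.

End SubstitutionNatural.

Section DomainMap.
Variables (R : realType) (k : complete_field R).
Hypothesis two_neq0 : (2%:R : k) != 0.
Variables (m p n q : nat) (D : opens (AA k m p)).
Local Notation Q := (open_subspace D).
Local Notation Y := (AA k n q).
Variables (X : 'I_n -> 'O_Q (full Q)) (Xi : 'I_q -> 'O_Q (full Q)).
Hypothesis X_even : forall i, sa_part _ false (X i).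
Hypothesis Xi_odd : forall j, sa_part _ true (Xi j).

Local Notation afm U := (analytic_fun (U : set (affine k m))).

Lemma sub_full (W : opens Q) : W `<=` full Q.
Proof. by []. Qed.

Definition Xon (W : opens Q) i : exterior p (afm (image_opens W)) :=
  restr 'O_Q (@sub_full W) (X i).
Definition Xion (W : opens Q) j : exterior p (afm (image_opens W)) :=
  restr 'O_Q (@sub_full W) (Xi j).

Lemma Xon_even W i : ext_part false (Xon W i).
Proof. exact: (sa_fun_part (restr 'O_Q (@sub_full W)) (X_even i)). Qed.

Lemma Xion_odd W j : ext_part true (Xion W j).
Proof. exact: (sa_fun_part (restr 'O_Q (@sub_full W)) (Xi_odd j)). Qed.

Lemma Xon_restr (W W' : opens Q) (h : W' `<=` W) i :
  restr 'O_Q h (Xon W i : 'O_Q W) = Xon W' i.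
Proof. exact: restr_comp. Qed.

Lemma Xion_restr (W W' : opens Q) (h : W' `<=` W) j :
  restr 'O_Q h (Xion W j : 'O_Q W) = Xion W' j.
Proof. exact: restr_comp. Qed.

Definition dmap_fun (z : Q) : Y := base_point (Xon (full Q)) (val z).

Lemma Xon_base (W : opens Q) x : (image_opens W : set (aff k m)) x ->
  base_point (Xon W) x = base_point (Xon (full Q)) x.
Proof.
move=> Wx; apply/rowP => i; rewrite !mxE.
have h := image_opensS (@sub_full W).
rewrite -(tot_restr h (Xon (full Q) i finset.set0) Wx); congr tot.
by rewrite -(Xon_restr (@sub_full W)) ffunE /= (Prop_irrelevance h (image_opensS (@sub_full W))).
Qed.

Lemma dmap_continuous : continuous dmap_fun.
Proof.
apply/continuousP => V oV; pose U := image_opens (full Q).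
pose b i := Xon (full Q) i finset.set0.
exists [set x : aff k m | (U : set (aff k m)) x /\ V (base_point (Xon (full Q)) x)].
  move=> x [Ux Vx]; have [r r0 rV] := oV _ Vx.
  have r2 : 0 < r / 2 by rewrite divr_gt0.
  have ex i := analytic_continuous (tot_analytic (b i)) Ux r2.
  pose s i := s2val (cid2 (ex i)).
  have s0 i : 0 < s i := s2valP (cid2 (ex i)).
  have sP i h : polydisc (s i) h -> (U : set (aff k m)) (x + h) /\
      cf_abs (tot (b i) (x + h) - tot (b i) x) <= r / 2.
    exact: (s2valP' (cid2 (ex i))).
  have [t t0 tU] := (oset_open U : coord_open _) x Ux.
  have [i|s' s'0 s's] := @common_radius R 'I_n s; first exact: s0.
  exists (Num.min t s'); first by rewrite lt_min t0.
  move=> h hr; split; first by apply: tU; apply: polydiscS hr; rewrite ge_min lexx.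
  have -> : base_point (Xon (full Q)) (x + h) = base_point (Xon (full Q)) x +
      (base_point (Xon (full Q)) (x + h) - base_point (Xon (full Q)) x).
    by rewrite [RHS]addrC subrK.
  apply: rV => i; rewrite !mxE; have [|_ le] := sP i h.
    by apply: polydiscS hr; apply: le_trans (s's i); rewrite ge_min lexx orbT.
  apply: le_lt_trans le _; lra.
apply/seteqP; split=> [z [_ Vz]//|z Vz]; split=> //.
by exists z.
Qed.

Lemma dmap_base (V : opens Y) x :
  (image_opens (preim_opens dmap_continuous V) : set (aff k m)) x ->
  (V : set (aff k n)) (base_point (Xon (preim_opens dmap_continuous V)) x).
Proof. by move=> Vx; rewrite Xon_base //; have [z Vz <-] := Vx. Qed.

Definition dmap_pull (V : opens Y) : sa_hom ('O_Y V) ('O_Q (preim_opens dmap_continuous V)) :=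
  subst two_neq0 (@Xon_even _) (@Xion_odd _) (@dmap_base V).

Lemma dmap_pull_restr (V V' : opens Y) (h : V' `<=` V) (s : 'O_Y V) :
  dmap_pull V' (restr 'O_Y h s) =
  restr 'O_Q (preim_opensS (cf := dmap_continuous) h) (dmap_pull V s).
Proof.
apply/esym; apply: (subst_nat two_neq0 h) => i; first exact: Xon_restr.
exact: Xion_restr.
Qed.

Definition dmap : srs_hom Q Y := SrsHom dmap_pull_restr.

Lemma dmap_coord i : pb (fullS dmap) (xcoord (full Y) i) = X i.
Proof.
apply: etrans (congr1 _ (subst_coord two_neq0 _ _ _ i)) _.
by apply: etrans (Xon_restr _ i) _; apply: restr_id.
Qed.

Lemma dmap_theta j : pb (fullS dmap) (theta (full Y) j) = Xi j.
Proof.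
apply: etrans (congr1 _ (subst_gen two_neq0 _ _ _ j)) _.
by apply: etrans (Xion_restr _ j) _; apply: restr_id.
Qed.

Lemma domain_map_ex : exists phi : srs_hom Q Y,
  (forall i, pb (fullS phi) (xcoord (full Y) i) = X i) /\
  (forall j, pb (fullS phi) (theta (full Y) j) = Xi j).
Proof. by exists dmap; split; [exact: dmap_coord|exact: dmap_theta]. Qed.

End DomainMap.

(** * Charts of super-manifolds *)

Section Probe.
Variables (R : realType) (k : complete_field R).

(** The super-domains, that is, the open subspaces of affine super-spaces. They form
    a class that is small enough to be quantified over in [psec]. *)
Record probe := Probe { pr_n : nat; pr_q : nat; pr_dom : opens (AA k pr_n pr_q) }.
Definition psp (d : probe) : super_ringed_space k := open_subspace (pr_dom d).

Lemma psp_sub : closed_under_opens psp.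
Proof.
move=> d W.
pose D' : opens (AA k (pr_n d) (pr_q d)) := image_opens W.
have [|u uE] := @oi_lift k (open_subspace D') _ _ _ (incl D') (incl_oi (pr_dom d)).
  by move=> y; have [z Wz zy] := incl_in y; exists z.
have uP y : val (u y) = val y.
  exact: (congr1 (fun f : srs_hom _ _ => f y) uE).
exists (Probe D'), u; split.
  by apply: (oi_factor (incl_oi (pr_dom d))); rewrite uE; apply: incl_oi.
move=> z; split=> [Wz|[y <-]].
  have Dz : (D' : set _) (val z) by exists z.
  by exists (exist _ (val z) (mem_set Dz)); apply: val_inj; rewrite uP.
have [t Wt ty] := incl_in y.
suff <- : t = u y by [].
by apply: val_inj; rewrite uP.
Qed.

End Probe.

Section ImmersionImage.
Variable k : fieldType.

Lemma oi_iso_image (Z X : super_ringed_space k) (j : srs_hom Z X) (U : opens X) :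
  open_imm j -> (forall x, (U : set X) x <-> exists z, j z = x) ->
  @isomorphic (SRS k) (open_subspace U) Z.
Proof.
move=> oj Uj; have oU := incl_oi U.
have [|f fE] := @oi_lift k _ _ _ j (incl U) oj; first by move=> y; apply/Uj; exact: incl_in.
have [|g gE] := @oi_lift k _ _ _ (incl U) j oU.
  by move=> z; apply: incl_range; apply/Uj; exists z.
exists f, g; split; [apply: (oi_cancel oU)|apply: (oi_cancel oj)].
  rewrite [LHS](compA (c := SRS k)) /= gE fE.
  exact: esym (compm1 (c := SRS k) _).
rewrite [LHS](compA (c := SRS k)) /= fE gE.
exact: esym (compm1 (c := SRS k) _).
Qed.

Lemma iso_oi (Z X : super_ringed_space k) : @isomorphic (SRS k) X Z ->
  exists j : srs_hom Z X, open_imm j /\ forall x, exists z, j z = x.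
Proof.
move=> [f [g [gf fg]]]; exists g; split; first exact: oi_iso fg gf.
by move=> x; exists (f x); have := congr1 (fun u : srs_hom _ _ => u x) gf.
Qed.

End ImmersionImage.

Section OpenSubmanifold.
Variables (R : realType) (k : complete_field R) (n : nat) (D : opens (affine k n)).

Local Notation T := (set_type (D : set (affine k n))).
Definition dom_pt (z : T) : 'rV[k]_n := val z.

Program Definition dom_chart : chart k T := @Chart R k T n setT dom_pt _ _ _ _.
Next Obligation. exact: openT. Qed.
Next Obligation. by move=> x y _ _ /val_inj. Qed.
Next Obligation. by move=> D' oD'; rewrite setTI; exists D'. Qed.
Next Obligation. by move=> U oU _; exact: (@image_open k (AA k n 0) D (Opens oU)). Qed.

Lemma dom_image (U : set T) : dom_pt @` (U `&` setT) = dom_pt @` U.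
Proof. by rewrite setIT. Qed.

Lemma dom_open (U : opens T) : coord_open (dom_pt @` (U : set T)).
Proof. exact: (@image_open k (AA k n 0) D U). Qed.

Program Definition dom_mfd : manifold k := @Manifold R k T [set dom_chart] _ _.
Next Obligation. by move=> x; exists dom_chart. Qed.
Next Obligation.
move=> _ _ -> -> i; exists (fun y => y 0 i) => //=.
apply: analytic_coord; rewrite dom_image; exact: (@dom_open (Opens (@openT T))).
Qed.

Lemma dom_analytic (W : opens T) (g : 'rV[k]_n -> k) : analytic_on (dom_pt @` (W : set T)) g ->
  forall c, @atlas R k dom_mfd c -> @analytic_in_chart R k _ c W (fun x => g (dom_pt (val x))).
Proof. by move=> gW _ ->; exists g => //=; rewrite dom_image. Qed.

Section Embedding.
Variables (M : manifold k) (phi : T -> M) (phi_c : continuous phi).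
Hypothesis phi_inj : injective phi.
Hypothesis phi_open : forall V : set T, open V -> open (phi @` V).
Hypothesis phi_pull : forall (V : opens M) (f : analytic_fun (V : set M)),
  exists2 g, analytic_on (dom_pt @` (phi @^-1` V)) g &
    forall z (h : (V : set M) (phi z)), g (dom_pt z) = f (exist _ (phi z) (mem_set h)).
Hypothesis phi_push : forall (W : opens T) g, analytic_on (dom_pt @` (W : set T)) g ->
  exists f : analytic_fun (phi @` (W : set T)), forall z (Wz : (W : set T) z),
    f (exist _ (phi z) (mem_set (imageP phi Wz))) = g (dom_pt z).
Variable q : nat.

Section Pull.
Variable V : opens M.
Local Notation W := (preim_opens phi_c V).

Definition emb_fun (f : analytic_fun (V : set M)) (z : W) : k :=
  f (exist _ (phi (val z)) (mem_set (set_valP z : (V : set M) (phi (val z))))).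

Lemma emb_analytic f c : @atlas R k dom_mfd c -> @analytic_in_chart R k _ c W (emb_fun f).
Proof.
have [g gW gf] := phi_pull f; move=> Mc; have [g' g'E g'W] := @dom_analytic W g gW c Mc.
exists g' => // y cy; rewrite g'E //; exact: gf.
Qed.

Definition emb_pull (f : analytic_fun (V : set M)) : analytic_fun (W : set dom_mfd) :=
  AnalyticFun (emb_analytic f).

Lemma emb_pull_zmod_morphism : zmod_morphism emb_pull.
Proof. by move=> f g; apply: af_ext. Qed.
Lemma emb_pull_monoid_morphism : monoid_morphism emb_pull.
Proof. by split=> [|f g]; apply: af_ext. Qed.

HB.instance Definition _ := GRing.isZmodMorphism.Build
  (analytic_fun (V : set M)) (analytic_fun (W : set dom_mfd)) emb_pull emb_pull_zmod_morphism.
HB.instance Definition _ := GRing.isMonoidMorphism.Build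
  (analytic_fun (V : set M)) (analytic_fun (W : set dom_mfd)) emb_pull emb_pull_monoid_morphism.

Program Definition emb_hom : sa_hom (model_sections q V) (@model_sections R k dom_mfd q W) :=
  @exterior_hom k q (analytic_fun (V : set M)) (analytic_fun (W : set dom_mfd)) _ _
    (GRing.RMorphism.clone _ _ emb_pull _) _.
Next Obligation. by move=> c; apply: af_ext. Qed.

End Pull.

Program Definition emb : srs_hom (model dom_mfd q) (model M q) :=
  @SrsHom k (model dom_mfd q) (model M q) phi phi_c emb_hom _.
Next Obligation.
move=> U V h s; apply/ffunP => K; rewrite !ffunE; apply: af_ext => z.
by rewrite /= /emb_fun /=; congr (_ _); apply: val_inj.
Qed.

(** [phi] identifies the analytic functions on an open subset of the source with those
    on its image, hence also the sections of the two models. *)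
Lemma emb_oi : open_imm emb.
Proof.
have pbE (V : opens (model dom_mfd q)) (U : opens (model M q)) (h : V `<=` emb @^-1` U)
    (s : 'O_(model M q) U) K z (Vz : (V : set T) z) :
  ((pb h s : exterior q (analytic_fun (V : set dom_mfd))) K) (exist _ z (mem_set Vz)) =
  ((s : exterior q (analytic_fun (U : set M))) K) (exist _ (phi z) (mem_set (h z Vz))).
  rewrite /pb /= !ffunE /= /emb_fun /=; congr (_ _); exact: val_inj.
split=> // V U h hU.
- move=> s s0; apply/ffunP => K; rewrite ffunE; apply: af_ext => -[x Ux].
  have [z Vz zx] := hU x (set_mem Ux); move: Ux; rewrite -zx => Ux.
  have := pbE V U h s K z Vz; rewrite s0 ffunE => /esym e.
  by apply: etrans e; congr (_ _); apply: val_inj.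
- move=> t; have ex K : exists f : analytic_fun (U : set M), forall z (Vz : (V : set T) z),
    f (exist _ (phi z) (mem_set (h z Vz))) =
    ((t : exterior q (analytic_fun (V : set dom_mfd))) K) (exist _ z (mem_set Vz)).
    pose tK := (t : exterior q (analytic_fun (V : set dom_mfd))) K.
    have [g gt gV] := af_analytic tK (erefl : @atlas R k dom_mfd dom_chart).
    rewrite dom_image in gV; have [f fg] := phi_push gV.
    pose U' : opens M := Opens (phi_open (oset_open V)).
    exists (af_restr (U := U') hU f) => z Vz.
    rewrite /= -(gt (exist _ z (mem_set Vz))) // -(fg z Vz).
    by congr (_ _); apply: val_inj.
  pose s : exterior q (analytic_fun (U : set M)) := [ffun K => sval (cid (ex K))].
  exists s; apply/ffunP => K; apply: af_ext => -[z Vz].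
  rewrite (Prop_irrelevance Vz (mem_set (set_mem Vz))).
  apply: etrans (pbE V U h s K z (set_mem Vz)) _.
  have -> : s K = sval (cid (ex K)) by rewrite ffunE.
  exact: (svalP (cid (ex K)) z (set_mem Vz)).
Qed.

End Embedding.

Lemma affine_embedding q : exists j : srs_hom (model dom_mfd q) (AA k n q),
  open_imm j /\ forall z, j z = val z.
Proof.
have vc : continuous (val : T -> affine k n) by exact: (@set_val_continuous k (AA k n 0) D).
have vo (V : set T) : open V -> open ((val : T -> affine k n) @` V).
  by move=> oV; exact: (@image_open k (AA k n 0) D (Opens oV)).
have vpull (V : opens (affine k n)) (f : analytic_fun (V : set (affine k n))) :
  exists2 g, analytic_on (dom_pt @` ((val : T -> affine k n) @^-1` V)) g &
    forall z (h : (V : set (affine k n)) (val z)), g (dom_pt z) = f (exist _ (val z) (mem_set h)).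
  exists (tot f) => [|z h]; last exact: (totE f (exist _ (val z) (mem_set h))).
  apply: analytic_sub (tot_analytic f); first exact: (@dom_open (preim_opens vc V)).
  by move=> _ [z Vz <-].
have vpush (W : opens T) g : analytic_on (dom_pt @` (W : set T)) g ->
  exists f : analytic_fun ((val : T -> affine k n) @` (W : set T)), forall z (Wz : (W : set T) z),
    f (exist _ (val z) (mem_set (imageP val Wz))) = g (dom_pt z).
  by move=> gW; exists (aff_fun (U := Opens (vo _ (oset_open W))) gW).
exists (emb vc vpull q); split=> //.
by apply: emb_oi => //; apply: val_inj.
Qed.

End OpenSubmanifold.

Section ManifoldCharts.
Variables (R : realType) (k : complete_field R).

Section ChartEmbedding.
Variables (M : manifold k) (c : chart k M) (Mc : atlas c).
Local Notation n := (chart_dim c).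

Lemma chart_image_dom : coord_open (chart_map c @` chart_dom c).
Proof. by apply: chart_map_open => //; apply: chart_dom_open. Qed.

Definition chart_dom_opens : opens (affine k n) := @Opens (affine k n) _ chart_image_dom.
Local Notation D := chart_dom_opens.
Local Notation T := (set_type (D : set (affine k n))).

Lemma chart_inv_ex (z : T) : exists2 x, chart_dom c x & chart_map c x = val z.
Proof. by case: (set_valP z) => x; exists x. Qed.

Definition chart_inv (z : T) : M := s2val (cid2 (chart_inv_ex z)).

Lemma chart_inv_dom z : chart_dom c (chart_inv z).
Proof. exact: (s2valP (cid2 (chart_inv_ex z))). Qed.

Lemma chart_invK z : chart_map c (chart_inv z) = val z.
Proof. exact: (s2valP' (cid2 (chart_inv_ex z))). Qed.

Lemma chart_inv_surj x : chart_dom c x -> exists z, chart_inv z = x.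
Proof.
move=> cx; have Dx : (D : set (affine k n)) (chart_map c x) by exists x.
exists (exist (fun y : affine k n => y \in (D : set (affine k n))) (chart_map c x) (mem_set Dx)).
apply: (chart_map_inj (c := c)) => //.
  exact: chart_inv_dom.
by rewrite chart_invK.
Qed.

Lemma chart_inv_inj : injective chart_inv.
Proof. by move=> y z e; apply: val_inj; rewrite -!chart_invK e. Qed.

Lemma chart_inv_preim (V : set M) :
  (@dom_pt R k n D) @` (chart_inv @^-1` V) = chart_map c @` (V `&` chart_dom c).
Proof.
apply/seteqP; split=> [_ [z Vz <-]|_ [x [Vx cx] <-]].
  exists (chart_inv z); last exact: chart_invK.
  by split=> //; apply: chart_inv_dom.
have [z zx] := chart_inv_surj cx; exists z; first by rewrite /= zx.
by rewrite -zx chart_invK.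
Qed.

Lemma chart_inv_continuous : continuous chart_inv.
Proof.
apply/continuousP => V oV; exists (chart_map c @` (V `&` chart_dom c)).
  apply: chart_map_open => [|x []//].
  by apply: openI => //; apply: chart_dom_open.
rewrite -chart_inv_preim; apply/seteqP; split=> [z [y Vy /val_inj <-]//|z Vz].
by exists z.
Qed.

Lemma chart_inv_open (W : set T) : open W -> open (chart_inv @` W).
Proof.
move=> [D' oD' <-].
suff -> : chart_inv @` (set_val @^-1` D') = chart_dom c `&` chart_map c @^-1` D'.
  exact: chart_map_continuous.
apply/seteqP; split=> [_ [z D'z <-]|x [cx D'x]].
  split; first exact: chart_inv_dom.
  by rewrite /= chart_invK.
have [z zx] := chart_inv_surj cx; exists z => //=.
by move: D'x; rewrite /= -zx chart_invK.
Qed.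

Lemma chart_inv_pull (V : opens M) (f : analytic_fun (V : set M)) :
  exists2 g, analytic_on ((@dom_pt R k n D) @` (chart_inv @^-1` V)) g &
    forall z (h : (V : set M) (chart_inv z)),
      g (dom_pt z) = f (exist _ (chart_inv z) (mem_set h)).
Proof.
have [g gf gV] := af_analytic f Mc; exists g; first by rewrite chart_inv_preim.
move=> z h; rewrite -(gf (exist _ (chart_inv z) (mem_set h))) /= ?chart_invK //.
exact: chart_inv_dom.
Qed.

(** The change of charts is analytic, so that a function that is analytic in one
    chart is analytic in all the others. *)
Lemma chart_inv_push (W : opens T) g : analytic_on ((@dom_pt R k n D) @` (W : set T)) g ->
  exists f : analytic_fun (chart_inv @` (W : set T)), forall z (Wz : (W : set T) z),
    f (exist _ (chart_inv z) (mem_set (imageP chart_inv Wz))) = g (dom_pt z).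
Proof.
move=> gW; pose V : opens M := Opens (chart_inv_open (oset_open W)).
have Vc x : (V : set M) x -> chart_dom c x by move=> [z _ <-]; apply: chart_inv_dom.
have fa c' : atlas c' -> @analytic_in_chart R k M c' V (fun x => g (chart_map c (val x))).
  move=> Mc'; pose b i := s2val (cid2 (atlas_compatible Mc' Mc i)).
  have bE i : forall y : chart_dom c, chart_dom c' (val y) ->
      b i (chart_map c' (val y)) = chart_map c (val y) 0 i.
    exact: (s2valP (cid2 (atlas_compatible Mc' Mc i))).
  have ba i : analytic_on (chart_map c' @` (chart_dom c `&` chart_dom c')) (b i).
    exact: (s2valP' (cid2 (atlas_compatible Mc' Mc i))).
  have bV x : (V : set M) x -> chart_dom c' x ->
      \row_i b i (chart_map c' x) = chart_map c x.
    move=> Vx c'x; apply/rowP => i; rewrite mxE.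
    exact: (bE i (exist _ x (mem_set (Vc x Vx))) c'x).
  exists (fun y => g (\row_i b i y)).
    by move=> y c'y; congr g; apply: bV => //; exact: set_valP.
  apply: (analytic_comp (D := (@dom_pt R k n D) @` (W : set T))) => //.
  - exact: chart_image_open.
  - move=> i; apply: analytic_sub (ba i); first exact: chart_image_open.
    by move=> _ [x [Vx c'x] <-]; exists x => //; split=> //; apply: Vc.
  - move=> _ [x [Vx c'x] <-]; rewrite bV //.
    by have [z Wz <-] := Vx; exists z => //; rewrite chart_invK.
by exists (AnalyticFun fa) => z Wz /=; rewrite chart_invK.
Qed.

Lemma chart_probe q x : chart_dom c x -> exists (j : srs_hom (open_subspace (D : opens (AA k n q))) (model M q)),
  open_imm j /\ exists z, j z = x.
Proof.
move=> cx; pose e := emb chart_inv_continuous chart_inv_pull q.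
have oe : open_imm e := emb_oi chart_inv_continuous chart_inv_inj chart_inv_open
  chart_inv_pull chart_inv_push q.
have [a [oa aE]] := affine_embedding (D : opens (affine k n)) q.
have [|u uE] := @oi_lift k (open_subspace (D : opens (AA k n q))) _ _ a
  (incl (D : opens (AA k n q))) oa.
  by move=> y; exists y; rewrite aE.
have ou : open_imm u by apply: (oi_factor oa); rewrite uE; apply: incl_oi.
exists (srs_comp e u); split; first exact: oi_comp.
have [z zx] := chart_inv_surj cx; exists z.
have uP y : a (u y) = val y by exact: (congr1 (fun f : srs_hom _ _ => f y) uE).
by rewrite -zx /=; congr chart_inv; apply: val_inj; rewrite -[LHS]aE uP.
Qed.

End ChartEmbedding.

Lemma smfd_covered (X : super_ringed_space k) :
  is_super_manifold X -> covered (@psp R k) X.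
Proof.
move=> sX x; have [U [Ux [M [q iso]]]] := sX x.
have [j [oj js]] := iso_oi iso.
have [y yx] := incl_range Ux; have [z zy] := js y.
have [c Mc cz] := atlas_cover (z : M).
have [u [ou [t tz]]] := chart_probe Mc q cz.
exists (@Probe R k _ q (chart_dom_opens c)), (srs_comp (incl U) (srs_comp j u)); split.
  by apply: oi_comp; [exact: incl_oi|apply: oi_comp].
by exists t => /=; rewrite tz zy.
Qed.

Lemma covered_smfd (X : super_ringed_space k) :
  covered (@psp R k) X -> is_super_manifold X.
Proof.
move=> cX x; have [[n q D] [j [oj [z zx]]]] := cX x.
have [a [oa aE]] := affine_embedding (D : opens (affine k n)) q.
have [|u uE] := @oi_lift k (model (dom_mfd (D : opens (affine k n))) q) _ _ (incl D) a (incl_oi D).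
  by move=> y; exists y; rewrite aE.
have ou : open_imm u by apply: (oi_factor (incl_oi D)); rewrite uE.
have uP y : val (u y) = a y by exact: (congr1 (fun f : srs_hom _ _ => f y) uE).
have us y : u y = y by apply: val_inj; rewrite uP aE.
have oju := oi_comp oj ou.
exists (oi_image oju (full _)); split; first by exists z => //=; rewrite us.
exists (dom_mfd (D : opens (affine k n))), q.
apply: (oi_iso_image oju) => y; split=> [[t _ <-]|[t <-]]; first by exists t.
by exists t.
Qed.

End ManifoldCharts.

(** * Products of super-domains and of super-manifolds *)

Section ProbeProducts.
Variables (R : realType) (k : complete_field R).
Hypothesis two_neq0 : (2%:R : k) != 0.

Lemma pb_full_comp (X Y Z : super_ringed_space k) (g : srs_hom Y Z) (f : srs_hom X Y) s :
  pb (fullS (srs_comp g f)) s = pb (fullS f) (pb (fullS g) s).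
Proof. exact: pb_comp. Qed.

Lemma xcoord_even n q i : sa_part _ false (xcoord (full (AA k n q)) i).
Proof. exact: even_cst. Qed.

Lemma theta_odd n q j : sa_part _ true (theta (full (AA k n q)) j).
Proof. exact: ext_gen_odd. Qed.

Lemma coord_same m p (D : opens (AA k m p)) n q n' q'
  (f : srs_hom (open_subspace D) (AA k n q)) (g : srs_hom (open_subspace D) (AA k n' q')) i j :
  pb (fullS f) (xcoord (full (AA k n q)) i) = pb (fullS g) (xcoord (full (AA k n' q')) j) ->
  forall z, (f z : 'rV[k]_n) 0 i = (g z : 'rV[k]_n') 0 j.
Proof.
move=> e z; have Fz : (full (open_subspace D) : set _) z by [].
rewrite -(coord_body (V := full _) (z := z) Logic.I).
rewrite -[RHS](coord_body (V := full _) (z := z) Logic.I).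
by rewrite (pval_at_pb _ (fullS f) Fz) (pval_at_pb _ (fullS g) Fz) e.
Qed.

Variables (I : finType) (c : I -> probe k).

Local Notation n i := (pr_n (c i)).
Local Notation q i := (pr_q (c i)).
Local Notation dom i := (pr_dom (c i)).

Let S := {i : I & 'I_(n i)}.
Let Sq := {i : I & 'I_(q i)}.
Local Notation N := #|{: S}|.
Local Notation Nq := #|{: Sq}|.

(** The coordinates of the product of the super-domains [c i] are all the coordinates
    of all the factors, numbered in some order. *)
Definition even_idx i (j : 'I_(n i)) : 'I_N :=
  enum_rank (Tagged (fun i => 'I_(n i)) j).
Definition odd_idx i (j : 'I_(q i)) : 'I_Nq :=
  enum_rank (Tagged (fun i => 'I_(q i)) j).

Lemma even_idx_surj (s : 'I_N) : exists i (j : 'I_(n i)), s = even_idx j.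
Proof.
have := enum_valK s; case: (enum_val s) => i j <-.
by exists i, j.
Qed.

Lemma odd_idx_surj (s : 'I_Nq) : exists i (j : 'I_(q i)), s = odd_idx j.
Proof.
have := enum_valK s; case: (enum_val s) => i j <-.
by exists i, j.
Qed.

Definition block i (y : 'rV[k]_N) : 'rV[k]_(n i) := \row_j y 0 (even_idx j).

Lemma prod_dom_open :
  coord_open [set y : 'rV[k]_N | forall i, (dom i : set (aff k (n i))) (block i y)].
Proof.
move=> y yD; have ex i := (oset_open (dom i) : coord_open _) _ (yD i).
pose r i := s2val (cid2 (ex i)).
have r0 i : 0 < r i := s2valP (cid2 (ex i)).
have rD i h : polydisc (r i) h -> (dom i : set (aff k (n i))) (block i y + h).
  exact: (s2valP' (cid2 (ex i))).
have [s s0 sr] := common_radius r0; exists s => // h hs i.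
have -> : block i (y + h) = block i y + block i h by apply/rowP => j; rewrite !mxE.
by apply: rD => j; rewrite mxE; apply: lt_le_trans (sr i).
Qed.

Definition prod_dom : opens (AA k N Nq) := @Opens (AA k N Nq) _ prod_dom_open.
Definition prod_probe : probe k := Probe prod_dom.
Local Notation E := (psp prod_probe).
Local Notation in_E := (incl prod_dom).
Local Notation in_ i := (incl (dom i)).

Definition blk_x i j : 'O_E (full E) := pb (fullS in_E) (xcoord (full _) (even_idx (i := i) j)).
Definition blk_t i j : 'O_E (full E) := pb (fullS in_E) (theta (full _) (odd_idx (i := i) j)).

Lemma blk_x_even i j : sa_part _ false (@blk_x i j).
Proof. by apply: sa_fun_part; apply: xcoord_even. Qed.
Lemma blk_t_odd i j : sa_part _ true (@blk_t i j).
Proof. by apply: sa_fun_part; apply: theta_odd. Qed.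

Definition blk i : srs_hom E (AA k (n i) (q i)) :=
  sval (cid (domain_map_ex two_neq0 (@blk_x_even i) (@blk_t_odd i))).

Lemma blk_coord i j : pb (fullS (blk i)) (xcoord (full _) j) = blk_x j.
Proof. exact: (svalP (cid (domain_map_ex two_neq0 (@blk_x_even i) (@blk_t_odd i)))).1. Qed.

Lemma blk_theta i j : pb (fullS (blk i)) (theta (full _) j) = blk_t j.
Proof. exact: (svalP (cid (domain_map_ex two_neq0 (@blk_x_even i) (@blk_t_odd i)))).2. Qed.

Lemma blkE i z : blk i z = block i (val z).
Proof. by apply/rowP => j; rewrite [RHS]mxE; exact: (coord_same (blk_coord j) z). Qed.

Lemma blk_lift i : exists w : srs_hom E (psp (c i)), srs_comp (in_ i) w = blk i.
Proof.
apply: oi_lift; first exact: incl_oi.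
by move=> z; apply: incl_range; rewrite blkE; exact: (set_valP z i).
Qed.

Definition prod_proj i : srs_hom E (psp (c i)) := sval (cid (blk_lift i)).

Lemma prod_projE i : srs_comp (in_ i) (prod_proj i) = blk i.
Proof. exact: (svalP (cid (blk_lift i))). Qed.

Lemma val_prod_proj i z : val (prod_proj i z) = block i (val z).
Proof.
rewrite -blkE -prod_projE.
by [].
Qed.

Section Pairing.
Variables (d : probe k) (f : forall i, srs_hom (psp d) (psp (c i))).

Definition pair_x (s : 'I_N) : 'O_(psp d) (full (psp d)) :=
  (fun x : S => pb (fullS (srs_comp (in_ (tag x)) (f (tag x)))) (xcoord (full _) (tagged x)))
    (enum_val s).
Definition pair_t (s : 'I_Nq) : 'O_(psp d) (full (psp d)) :=
  (fun x : Sq => pb (fullS (srs_comp (in_ (tag x)) (f (tag x)))) (theta (full _) (tagged x)))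
    (enum_val s).

Lemma pair_x_even s : sa_part _ false (pair_x s).
Proof. by apply: sa_fun_part; apply: xcoord_even. Qed.
Lemma pair_t_odd s : sa_part _ true (pair_t s).
Proof. by apply: sa_fun_part; apply: theta_odd. Qed.

Lemma pair_xE i (j : 'I_(n i)) : pair_x (even_idx j) =
  pb (fullS (srs_comp (in_ i) (f i))) (xcoord (full _) j).
Proof. by rewrite /pair_x /even_idx enum_rankK. Qed.

Lemma pair_tE i (j : 'I_(q i)) : pair_t (odd_idx j) =
  pb (fullS (srs_comp (in_ i) (f i))) (theta (full _) j).
Proof. by rewrite /pair_t /odd_idx enum_rankK. Qed.

Lemma pairing_ex : exists g : srs_hom (psp d) E,
  (forall s, pb (fullS (srs_comp in_E g)) (xcoord (full _) s) = pair_x s) /\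
  (forall s, pb (fullS (srs_comp in_E g)) (theta (full _) s) = pair_t s).
Proof.
have [g0 [g0x g0t]] := domain_map_ex two_neq0 pair_x_even pair_t_odd.
have [|z|g gE] := @oi_lift _ _ _ _ in_E g0; first exact: incl_oi.
  apply: incl_range => i; have -> : block i (g0 z) = val (f i z).
    apply/rowP => j; rewrite [LHS]mxE.
    exact: (coord_same (etrans (g0x (even_idx j)) (pair_xE j)) z).
  exact: set_valP.
by exists g; rewrite gE.
Qed.

(** Morphisms to a super-domain correspond to tuples of sections, so that a product of
    super-domains is obtained by collecting all the coordinates. *)
Lemma pairing_unique : exists! g : srs_hom (psp d) E,
  forall i, srs_comp (prod_proj i) g = f i.
Proof.
have [g [gx gt]] := pairing_ex.
have assoc i (g' : srs_hom (psp d) E) :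
    srs_comp (in_ i) (srs_comp (prod_proj i) g') = srs_comp (blk i) g'.
  by rewrite [LHS](compA (c := SRS k)) /= prod_projE.
exists g; split=> [i|g' g'f].
  apply: (oi_cancel (incl_oi (dom i))); rewrite assoc.
  apply: domain_map_uniq => j; rewrite pb_full_comp.
    by rewrite blk_coord /blk_x -pb_full_comp gx pair_xE.
  by rewrite blk_theta /blk_t -pb_full_comp gt pair_tE.
apply: (oi_cancel (incl_oi prod_dom)); apply: domain_map_uniq => s.
  have [i [j ->]] := even_idx_surj s; apply: etrans (gx _) _.
  apply: etrans (pair_xE j) _; rewrite -g'f assoc.
  by rewrite (pb_full_comp (blk i) g') (pb_full_comp in_E g') blk_coord.
have [i [j ->]] := odd_idx_surj s; apply: etrans (gt _) _.
apply: etrans (pair_tE j) _; rewrite -g'f assoc.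
by rewrite (pb_full_comp (blk i) g') (pb_full_comp in_E g') blk_theta.
Qed.

End Pairing.

Lemma prod_proj_inj z z' : (forall i, prod_proj i z = prod_proj i z') -> z = z'.
Proof.
move=> zz; apply: val_inj; apply/rowP => s; have [i [j ->]] := even_idx_surj s.
have := congr1 (fun y : psp (c i) => (val y : 'rV[k]_(n i)) 0 j) (zz i).
by rewrite !val_prod_proj !mxE.
Qed.

Lemma prod_proj_surj (y : forall i, psp (c i)) : exists z, forall i, prod_proj i z = y i.
Proof.
pose v : 'rV[k]_N := \row_s
  (fun x : S => (val (y (tag x)) : 'rV[k]_(n (tag x))) 0 (tagged x)) (enum_val s).
have vE i : block i v = val (y i).
  by apply/rowP => j; rewrite !mxE /even_idx enum_rankK.
have Dv : (prod_dom : set _) v by move=> i; rewrite vE; exact: set_valP.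
exists (exist (fun x : aff k N => x \in (prod_dom : set (aff k N))) v (mem_set Dv)) => i.
by apply: val_inj; rewrite val_prod_proj vE.
Qed.

Lemma prod_proj_open (V : opens E) z : (V : set E) z ->
  exists B : forall i, opens (psp (c i)),
    (forall i, (B i : set (psp (c i))) (prod_proj i z)) /\
    forall z', (forall i, (B i : set (psp (c i))) (prod_proj i z')) -> (V : set E) z'.
Proof.
move=> Vz; have [r r0 rV] := (image_open V : coord_open _) (val z) (ex_intro2 _ _ z Vz erefl).
have oB i : open (set_val @^-1` [set val (prod_proj i z) + h | h in polydisc r] : set (psp (c i))).
  by exists [set val (prod_proj i z) + h | h in polydisc r]; first exact: polydisc_open.
exists (fun i => Opens (oB i)); split=> [i|z' z'B].
  by exists 0; [exact: polydisc0|rewrite addr0].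
have hr : polydisc r (val z' - val z : 'rV[k]_N).
  move=> s; have [i [j ->]] := even_idx_surj s; have [h hr e] := z'B i.
  have {e} : block i (val z) + h = block i (val z') by rewrite -!val_prod_proj.
  move=> /rowP/(_ j); rewrite !mxE => <-.
  by rewrite addrAC subrr add0r.
have [z2 Vz2 z2z'] := rV _ hr.
suff <- : z2 = z' by [].
by apply: val_inj; rewrite [LHS]z2z' addrC subrK.
Qed.

End ProbeProducts.

Theorem proposition4p6 (R : realType) (k : complete_field R)
    (hchar : 2%N \notin [pchar k]%R) :
  has_finite_products (SMFD k).
Proof.
have two_neq0 : (2%:R : k) != 0 by rewrite inE /= in hchar.
move=> I X; pose Y i := sval (X i).
have Ycov i : covered (@psp R k) (Y i) := smfd_covered (svalP (X i)).
have Pcov (x : probe_product (@psp_sub R k) Y) :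
    exists d (f : forall i, srs_hom (psp d) (Y i)),
      open_imm (yon (@psp_sub R k) f) /\ exists z, yon (@psp_sub R k) f z = x.
  pose c i := sval (cid (Ycov i (x i))).
  pose j i : srs_hom (psp (c i)) (Y i) := sval (cid (svalP (cid (Ycov i (x i))))).
  have jP i : open_imm (j i) /\ exists z, j i z = x i :=
    svalP (cid (svalP (cid (Ycov i (x i))))).
  have oj i := (jP i).1.
  exists (prod_probe c), (fun i => srs_comp (j i) (prod_proj two_neq0 c i)); split.
    exact: (@chart_oi k _ (@psp R k) (@psp_sub R k) I Y c j oj (prod_probe c)
      (prod_proj two_neq0 c) (@pairing_unique R k two_neq0 I c)
      (@prod_proj_inj R k two_neq0 I c) (@prod_proj_surj R k two_neq0 I c)
      (@prod_proj_open R k two_neq0 I c)).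
  have hit i : exists b, j i b = x i by case: (jP i).
  exact: (@chart_range k _ (@psp R k) (@psp_sub R k) I Y c j (prod_probe c)
    (prod_proj two_neq0 c) (@prod_proj_surj R k two_neq0 I c) x hit).
exists (exist _ (probe_product (@psp_sub R k) Y)
  (covered_smfd (probe_product_covered Pcov))), (fun i => proj (@psp_sub R k) Y i).
move=> [Q sQ] f; exact: (probe_product_universal Pcov f (smfd_covered sQ)).
Qed.
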